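(* For every integer $k\ge0$, the generating function $\mathrm{SG}^{>0}_k(z)$ of positive graphs of excess $k$ has the following two expressions: $$\mathrm{SG}^{>0}_k(z)=\frac{\mathrm{SK}_k(T(z))}{(1-T(z))^{3k}},\qquad \mathrm{SG}^{>0}_k(z)=\sum_{\ell=0}^k(2(k-\ell)-1)!!\,[x^{2k}]\,C_\ell(z,x)B(z,x)^k,$$ where $$B(z,x)=\left(1-T(z)\frac{e^x-1-x}{x^2/2}\right)^{-1},$$ $$C_\ell(z,x)=x^{2\ell}\,\mathrm{Patch}^{>0}_\ell(T(z)e^x,-1)\sqrt{1-T(z)}\;e^{-T(z)\frac{e^x-1}{2}-T(z)^2\frac{e^{2x}-1}{4}}\,B(z,x)^{-\ell+1/2},$$ and $$\mathrm{SK}_k(T)=(1-T)^{3k}\sum_{\ell=0}^k(2(k-\ell)-1)!!\,[x^{2(k-\ell)}]\frac{\mathrm{Patch}^{>0}_\ell(Te^x,-1)\,e^{-T\frac{e^x-1}{2}-T^2\frac{e^{2x}-1}{4}}}{(1-T)^{k-\ell}\left(1-\frac{T}{1-T}\frac{e^x-1-x-x^2/2}{x^2/2}\right)^{k-\ell+1/2}}$$ is a polynomial in $T$; here $\mathrm{Patch}^{>0}_\ell(z,-1)$ is the polynomial obtained by setting $u=-1$ in the generating function $\mathrm{Patch}^{>0}_\ell(z,u)$ of positive patchworks of excess $\ell$.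
   Context: Graphs are finite simple graphs with labelled vertices $\{1,\dots,n\}$ and unlabelled, unoriented edges. The excess of a graph or multigraph is its number of edges minus its number of vertices. A graph is positive if every connected component has positive excess (the empty graph is positive). $\mathrm{SG}^{>0}_k(z)=\sum_G\frac{z^{n(G)}}{n(G)!}$, summed over positive graphs $G$ of excess $k$, with $n(G)$ the number of vertices. A multigraph has vertex set $\{1,\dots,n\}$ and $m$ edges labelled $1,\dots,m$, each edge being a triple $(v,w,e)$ with $v,w$ vertices (possibly equal; the edge is oriented from $v$ to $w$) and $e$ its label. A loop of a multigraph is a subgraph made of one vertex $v$ and one edge $(v,v,e)$; a double edge is a subgraph made of two distinct vertices and two distinct edges, each joining these two vertices (in either orientation). A patchwork is a finite set $P=\{(V_1,E_1),\dots,(V_p,E_p)\}$ of distinct pairs (possibly $p=0$) such that $\mathrm{MG}(P)=(\cup_iV_i,\cup_iE_i)$ is a multigraph and each $(V_i,E_i)$ is a loop or a double edge of $\mathrm{MG}(P)$ (the $V_i$, and the $E_i$, need not be disjoint). Write $|P|=p$, and let $n(P),m(P),k(P)=m(P)-n(P)$ be the numbers of vertices, edges, and the excess of $\mathrm{MG}(P)$. $P$ is positive if every connected component of $\mathrm{MG}(P)$ has positive excess. The generating function of positive patchworks of excess $\ell$ is $$\mathrm{Patch}^{>0}_\ell(z,u)=\sum_{P\text{ positive},\,k(P)=\ell}u^{|P|}\frac{1}{2^{m(P)}m(P)!}\frac{z^{n(P)}}{n(P)!},$$ which is a polynomial in $z$ and $u$. $T(z)=\sum_{n\ge1}n^{n-1}\frac{z^n}{n!}$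 is the generating function of rooted labelled trees ($T(z)=ze^{T(z)}$). $(2j-1)!!=\frac{(2j)!}{2^jj!}$ for $j\ge0$, and $[x^j]$ denotes coefficient extraction in formal power series. *)

(* Defs.v *)
From HB Require Import structures.
From mathcomp Require Import all_boot all_order all_algebra.
From mathcomp Require Import boolp.
Set Implicit Arguments.
Unset Strict Implicit.
Unset Printing Implicit Defensive.
Import Order.TTheory GRing.Theory Num.Theory.
Local Open Scope ring_scope.

(******************************************************************************)
(* Formal power series: f n is the coefficient of degree n of f : {fps R}.    *)
(* Bivariate series are iterated: in {fps {fps rat}} = Q[[x]][[z]] the        *)
(* variable of the outer layer is z and that of the coefficients is x.        *)
(******************************************************************************)

Record fps (R : Type) := Fps { fpscoef :> nat -> R }.

Notation "{ 'fps' R }" := (fps R) (at level 0, format "{ 'fps'  R }").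

Lemma fpsP (R : Type) (f g : {fps R}) : (forall n, f n = g n) <-> f = g.
Proof.
split=> [fg|->//]; case: f g fg => [f] [g] /= fg; congr Fps; exact: funext.
Qed.

HB.instance Definition _ (R : Type) := gen_eqMixin {fps R}.
HB.instance Definition _ (R : Type) := gen_choiceMixin {fps R}.

Section Ring.
Context {R : comNzRingType}.
Implicit Types f g h : {fps R}.

Definition fps0 : {fps R} := Fps (fun=> 0).
Definition fps_add f g : {fps R} := Fps (fun n => f n + g n).
Definition fps_opp f : {fps R} := Fps (fun n => - f n).

Lemma fps_addA : associative fps_add.
Proof. by move=> f g h; apply/fpsP => n /=; rewrite addrA. Qed.
Lemma fps_addC : commutative fps_add.
Proof. by move=> f g; apply/fpsP => n /=; rewrite addrC. Qed.
Lemma fps_add0 : left_id fps0 fps_add.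
Proof. by move=> f; apply/fpsP => n /=; rewrite add0r. Qed.
Lemma fps_addN : left_inverse fps0 fps_opp fps_add.
Proof. by move=> f; apply/fpsP => n /=; rewrite addNr. Qed.

HB.instance Definition _ :=
  GRing.isZmodule.Build {fps R} fps_addA fps_addC fps_add0 fps_addN.

Definition fpsC (c : R) : {fps R} := Fps (fun n => if n is 0 then c else 0).
Definition fps_mul f g : {fps R} :=
  Fps (fun n => \sum_(i < n.+1) f i * g (n - i)%N).

Definition fps_trunc (N : nat) f : {poly R} := \poly_(i < N) f i.

Lemma fps_mul_trunc N f g n : (n < N)%N ->
  fps_mul f g n = (fps_trunc N f * fps_trunc N g)`_n.
Proof.
move=> nN; rewrite coefM /=; apply: eq_bigr => i _.
rewrite !coef_poly (leq_ltn_trans _ nN) 1?(leq_ltn_trans _ nN) ?leq_subr //.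
by rewrite -ltnS.
Qed.

Lemma fps_mulA : associative fps_mul.
Proof.
move=> f g h; apply/fpsP => n.
transitivity ((fps_trunc n.+1 f * (fps_trunc n.+1 g * fps_trunc n.+1 h))`_n).
  rewrite coefM; apply: eq_bigr => i _.
  rewrite -fps_mul_trunc; last by rewrite ltnS leq_subr.
  by rewrite coef_poly ltn_ord.
rewrite mulrA coefM; apply: eq_bigr => i _.
rewrite -fps_mul_trunc; last exact: ltn_ord.
by rewrite coef_poly ltnS leq_subr.
Qed.

Lemma fps_mulC : commutative fps_mul.
Proof.
by move=> f g; apply/fpsP => n; rewrite !(@fps_mul_trunc n.+1) // mulrC.
Qed.

Lemma fps_mulCl c f n : fps_mul (fpsC c) f n = c * f n.
Proof.
rewrite /= big_ord_recl subn0 /= big1 ?addr0 // => i _.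
by rewrite /bump /= mul0r.
Qed.

Lemma fps_mul1 : left_id (fpsC 1) fps_mul.
Proof. by move=> f; apply/fpsP => n; rewrite fps_mulCl mul1r. Qed.

Lemma fps_mulDl : left_distributive fps_mul fps_add.
Proof.
move=> f g h; apply/fpsP => n /=; rewrite -big_split /=.
by apply: eq_bigr => i _; rewrite mulrDl.
Qed.

Lemma fps_1neq0 : fpsC 1 != 0.
Proof. by apply/eqP => /fpsP/(_ 0%N)/eqP; rewrite /= oner_eq0. Qed.

HB.instance Definition _ := GRing.Zmodule_isComNzRing.Build {fps R}
  fps_mulA fps_mulC fps_mul1 fps_mulDl fps_1neq0.

Definition fps_scale (c : R) f : {fps R} := Fps (fun n => c * f n).

Lemma fps_scaleA a b f : fps_scale a (fps_scale b f) = fps_scale (a * b) f.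
Proof. by apply/fpsP => n /=; rewrite mulrA. Qed.
Lemma fps_scale1 : left_id 1 fps_scale.
Proof. by move=> f; apply/fpsP => n /=; rewrite mul1r. Qed.
Lemma fps_scaleDr : right_distributive fps_scale +%R.
Proof. by move=> c f g; apply/fpsP => n /=; rewrite mulrDr. Qed.
Lemma fps_scaleDl f : {morph fps_scale^~ f : a b / a + b}.
Proof. by move=> a b; apply/fpsP => n /=; rewrite mulrDl. Qed.

HB.instance Definition _ := GRing.Zmodule_isLmodule.Build R {fps R}
  fps_scaleA fps_scale1 fps_scaleDr fps_scaleDl.

Lemma fps_scaleAl (c : R) f g : c *: (f * g) = (c *: f) * g.
Proof.
apply/fpsP => n /=; rewrite mulr_sumr.
by apply: eq_bigr => i _; rewrite mulrA.
Qed.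

HB.instance Definition _ :=
  GRing.Lmodule_isLalgebra.Build R {fps R} fps_scaleAl.
HB.instance Definition _ := GRing.Lalgebra_isComAlgebra.Build R {fps R}.

Definition fpsX : {fps R} := Fps (fun n => (n == 1%N)%:R).

Definition fps_of_poly (p : {poly R}) : {fps R} := Fps (fun n => p`_n).

(* The quotient of f by the d-th power of the variable, for an f divisible by *)
(* that power.                                                                *)
Definition fps_divXn (d : nat) f : {fps R} := Fps (fun n => f (n + d)%N).

(* The composition f(g). It is meaningful only when g has no constant term;   *)
(* then only the powers g ^+ i with i <= n contribute in degree n.            *)
Definition fps_comp f g : {fps R} :=
  Fps (fun n => \sum_(i < n.+1) f i * (g ^+ i) n).

Lemma fps_expr_low g i n : g 0%N = 0 -> (n < i)%N -> (g ^+ i) n = 0.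
Proof.
move=> g0; elim: i n => // i IHi n; rewrite ltnS => ni.
rewrite exprS /= big1 // => -[[|j] /= jn] _; first by rewrite g0 mul0r.
rewrite IHi ?mulr0 //; apply: leq_trans ni.
by rewrite ltn_subrL /=; case: n jn.
Qed.

End Ring.

Notation "f \oF g" := (fps_comp f g) (at level 50, g at next level).

Section Unit.
Context {R : comUnitRingType}.
Implicit Types f g : {fps R}.

Definition fps_unit : {pred {fps R}} :=
  fun f => (f : nat -> R) 0%N \is a GRing.unit.

(* With h := 1 - f / f(0), this is the geometric series of h divided by f(0). *)
Definition fps_inv f : {fps R} :=
  if fps_unit f then
    (f 0%N)^-1 *: (Fps (fun=> 1) \oF (1 - (f 0%N)^-1 *: f))
  else f.

Lemma fps_mulVr : {in fps_unit, left_inverse 1 fps_inv *%R}.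
Proof.
move=> f Uf; rewrite /fps_inv [fps_unit f]Uf.
set h := 1 - _; set c := f 0%N.
have h0 : h 0%N = 0 by rewrite /h /= mulVr // subrr.
rewrite -scalerAl scalerAr (_ : c^-1 *: f = 1 - h); last by rewrite /h subKr.
apply/fpsP => n; pose S := \sum_(i < n.+1) h ^+ i.
have sumE (J : finType) (F : J -> {fps R}) m : (\sum_j F j) m = \sum_j F j m.
  exact: (big_morph (fun f : {fps R} => f m)).
have SE m : (m <= n)%N -> (Fps (fun=> 1) \oF h) m = S m.
  move=> mn; rewrite sumE /=.
  rewrite (big_ord_widen n.+1 (fun i => 1 * (h ^+ i) m)) // big_mkcond /=.
  apply: eq_bigr => i _; rewrite mul1r; case: ifP => // /negbT.
  by rewrite -leqNgt => mi; rewrite fps_expr_low.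
have -> : ((Fps (fun=> 1) \oF h) * (1 - h)) n = (S * (1 - h)) n.
  by apply: eq_bigr => i _; rewrite SE // -ltnS.
rewrite mulrC /S -opprB mulNr -subrX1 opprB.
by rewrite [LHS]/= (fps_expr_low h0) // subr0.
Qed.

Lemma fps_unitPl f g : g * f = 1 -> fps_unit f.
Proof.
move=> /fpsP/(_ 0%N) /=; rewrite big_ord_recl big_ord0 addr0 subn0 /= => gf.
by apply/unitrPr; exists (g 0%N); rewrite mulrC.
Qed.

Lemma fps_inv_out : {in [predC fps_unit], fps_inv =1 id}.
Proof.
by move=> f; rewrite inE /fps_inv => /negPf nUf; rewrite [fps_unit f]nUf.
Qed.

HB.instance Definition _ := GRing.ComNzRing_hasMulInverse.Build {fps R}
  fps_mulVr fps_unitPl fps_inv_out.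

End Unit.

Definition fps_map (R S : Type) (h : R -> S) (f : {fps R}) : {fps S} :=
  Fps (fun n => h (f n)).

Definition fps_exp : {fps rat} := Fps (fun n => (n`!%:R)^-1).

Definition fps_binom (a : rat) : {fps rat} :=
  Fps (fun n => (\prod_(i < n) (a - i%:R)) / n`!%:R).

(* The inclusions of Q[[z]] and Q[[x]] in Q[[x]][[z]].                        *)
Definition liftz : {fps rat} -> {fps {fps rat}} := fps_map fpsC.
Definition liftx : {fps rat} -> {fps {fps rat}} := fpsC.

(* [x^j] F, as a series in z.                                                 *)
Definition coefx (j : nat) : {fps {fps rat}} -> {fps rat} :=
  fps_map (fun c : {fps rat} => c j).

(* exp(F) and F^a, for F with coefficient of z^0 equal to 0 and 1             *)
(* respectively; all uses below satisfy this.                                 *)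
Definition expF (F : {fps {fps rat}}) : {fps {fps rat}} := liftz fps_exp \oF F.
Definition powF (F : {fps {fps rat}}) (a : rat) : {fps {fps rat}} :=
  liftz (fps_binom a) \oF (F - 1).

Definition excess (edges vertices : nat) : int := edges%:Z - vertices%:Z.

(******************************************************************************)
(* Simple graphs on 'I_n, given by their edge sets                            *)
(******************************************************************************)

Definition simple_graph (n : nat) (G : {set {set 'I_n}}) : bool :=
  [forall e in G, #|e| == 2%N].

Definition sg_component (n : nat) (G : {set {set 'I_n}}) (v : 'I_n) :
    {set 'I_n} :=
  [set w | connect (fun a b => [set a; b] \in G) v w].

Definition sg_positive (n : nat) (G : {set {set 'I_n}}) : bool :=
  [forall v, let C := sg_component G v in
     0 < excess #|[set e in G | e \subset C]| #|C|].

Definition SGpos (k : nat) : {fps rat} :=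
  Fps (fun n =>
    #|[set G : {set {set 'I_n}} |
        [&& simple_graph G, sg_positive G & excess #|G| n == k%:Z]]|%:R
    / n`!%:R).

(******************************************************************************)
(* Multigraphs with vertices in 'I_n and edge labels in 'I_m, and patchworks  *)
(******************************************************************************)

Definition medge (n m : nat) : Type := ('I_n * 'I_n * 'I_m)%type.
HB.instance Definition _ (n m : nat) := Finite.on (medge n m).

Definition mgraph (n m : nat) : Type := ({set 'I_n} * {set medge n m})%type.
HB.instance Definition _ (n m : nat) := Finite.on (mgraph n m).

(* H is a multigraph with n vertices and m edges: its vertex set is the whole *)
(* of 'I_n and each label in 'I_m is that of exactly one edge.                *)
Definition multigraph (n m : nat) (H : mgraph n m) : bool :=
  (H.1 == setT) && [forall e : 'I_m, #|[set t in H.2 | t.2 == e]| == 1%N].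

Definition joins (n m : nat) (t : medge n m) (v w : 'I_n) : bool :=
  (t.1 == (v, w)) || (t.1 == (w, v)).

Definition mg_component (n m : nat) (H : mgraph n m) (v : 'I_n) : {set 'I_n} :=
  [set w | connect (fun a b => [exists t in H.2, joins t a b]) v w].

Definition mg_positive (n m : nat) (H : mgraph n m) : bool :=
  [forall v in H.1, let C := mg_component H v in
     0 < excess #|[set t in H.2 | (t.1.1 \in C) && (t.1.2 \in C)]| #|C|].

Definition is_loop (n m : nat) (H : mgraph n m) : bool :=
  [exists v : 'I_n, exists e : 'I_m, H == ([set v], [set (v, v, e)])].

Definition is_double_edge (n m : nat) (H : mgraph n m) : bool :=
  [exists v : 'I_n, exists w : 'I_n,
   exists s : medge n m, exists t : medge n m,
     [&& v != w, s != t, joins s v w, joins t v w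
       & H == ([set v; w], [set s; t])]].

Definition MG (n m : nat) (P : {set mgraph n m}) : mgraph n m :=
  (\bigcup_(H in P) H.1, \bigcup_(H in P) H.2).

(* Elements of P are subgraphs of MG P by construction.                       *)
Definition patchwork (n m : nat) (P : {set mgraph n m}) : bool :=
  multigraph (MG P) && [forall H in P, is_loop H || is_double_edge H].

(* A series in z with coefficients in Q[u]; excess l means n + l edges.       *)
Definition Patchpos (l : nat) : {fps {poly rat}} :=
  Fps (fun n => let m := (n + l)%N in
    \sum_(P : {set mgraph n m} | patchwork P && mg_positive (MG P))
      (((2 ^ m * m`!)%:R * n`!%:R)^-1 : rat) *: 'X^#|P|).

(* Patch_l(z, -1)                                                             *)
Definition PatchposN1 (l : nat) : {fps rat} :=
  fps_map (fun p : {poly rat} => p.[-1]) (Patchpos l).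

(* (2j-1)!!                                                                   *)
Definition odd_dfact (j : nat) : rat := ((2 * j)`!)%:R / (2 ^ j * j`!)%:R.

(* T(z); the coefficient of degree n >= 1 is n^(n-1)/n!                      *)
Definition treegf : {fps rat} :=
  Fps (fun n => if n is n'.+1 then (n ^ n')%:R / n`!%:R else 0).

Definition ex : {fps rat} := fps_exp.
Definition e2x : {fps rat} := fps_exp \oF (2%:R *: fpsX).

(* e^{-T (e^x-1)/2 - T^2 (e^{2x}-1)/4}                                        *)
Definition loops_double_edges (T : {fps {fps rat}}) : {fps {fps rat}} :=
  expF (- (T * liftx (2^-1 *: (ex - 1))) - T ^+ 2 * liftx (4^-1 *: (e2x - 1))).

(* Patch_l(T e^x, -1)                                                         *)
Definition Patch_at (l : nat) (T : {fps {fps rat}}) : {fps {fps rat}} :=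
  liftz (PatchposN1 l) \oF (T * liftx ex).

(* For a series y, 2 *: fps_divXn 2 y is y / (x^2/2).                         *)
Definition Bser : {fps {fps rat}} :=
  (1 - liftz treegf * liftx (2 *: fps_divXn 2 (ex - 1 - fpsX)))^-1.

Definition Cser (l : nat) : {fps {fps rat}} :=
  let T := liftz treegf in
  liftx (fpsX ^+ (2 * l)) * Patch_at l T * powF (1 - T) (1 / 2)
  * loops_double_edges T * powF Bser (- l%:R + 1 / 2).

(* Here the outer variable plays the role of the indeterminate T.             *)
Definition SKser (k : nat) : {fps rat} :=
  let T : {fps {fps rat}} := fpsX in
  (1 - fpsX) ^+ (3 * k) *
  \sum_(l < k.+1) odd_dfact (k - l) *: coefx (2 * (k - l))
    (Patch_at l T * loops_double_edges T
     / ((1 - T) ^+ (k - l)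
        * powF (1 - T / (1 - T)
                    * liftx (2 *: fps_divXn 2 (ex - 1 - fpsX - 2^-1 *: fpsX ^+ 2)))
               ((k - l)%:R + 1 / 2))).

(* Main.v *)
Require Import Defs.
From HB Require Import structures.
From mathcomp Require Import all_boot all_order all_algebra.
From mathcomp Require Import ring lra zify.
Set Implicit Arguments.
Unset Strict Implicit.
Unset Printing Implicit Defensive.
Import Order.TTheory GRing.Theory Num.Theory.
Local Open Scope ring_scope.

(** All the counting is done in Q[[w]][[z]], where [z] marks vertices and [w]
    marks edges, and a series is graded by the excess.

    A graph with [m] edges is the same thing as [2^m m!] multigraphs, namely
    maps from labels to ordered pairs of vertices, that have no loop and no
    double edge ([simple_graph_count]). Inclusion and exclusion over the sets of
    loops and double edges writes the number of these multigraphs as a signed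
    sum over patchworks, the edges outside the patchwork being arbitrary
    ([simple_patch]). On [n] vertices arbitrary edges have the generating
    function [e^{w n^2 / 2}], so that the series of graphs is
    [\sum_i H_i(w) \sum_n z^n / (n - i)! e^{w n^2 / 2}], where [H] is the series
    of patchworks at [u = -1] ([SGF_kernel]).

    A multigraph is the disjoint union of its components of positive excess and
    of the other ones, and both weights are multiplicative ([split_sum]). So
    each of the two series is a product [N P], where [N] has constant
    coefficient 1 and only has monomials [z^n w^m] with [m <= n], and [P] only has the monomial 1 and monomials with
    [m > n]. Such a factorisation is unique ([factorisation_uniq]). It is
    therefore enough to exhibit any factorisation with these supports: trees,
    unicyclic graphs, isolated loops and isolated double edges never have to be
    enumerated.

    For patchworks, [(1 + w)^{n (n - 1) / 2} e^{- w n^2 / 2}] satisfies a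
    differential equation in [w] that is polynomial in [n]. It becomes a partial
    differential equation for [H], from which one reads that [H] has no part of
    negative excess ([patch_no_deficit]), and that its part of excess 0 is
    [e^{- z / 2 - z^2 / 4}] ([patch_diagonal]). The part of excess [l] is then
    this exponential times the series of positive patchworks of excess [l]
    ([patch_of_excess]).

    For graphs, [e^{w n^2 / 2}] is the expectation of [e^{n x}] for a Gaussian
    variable [x] of variance [w]. After the substitution [z = t e^{- t w}] the
    factor [e^{- t w}] is absorbed by a translation of [x] by [t w]
    ([gauss_shift]), which gives
      [e^{t - t^2 w / 2} \sum_i H_i(w) t^i E(e^{i x} e^{t (e^x - 1 - x)})]
    ([S_comp]). As [e^x - 1 - x] has a double zero, this expectation has no part
    of negative excess, and its part of excess [k] is a finite sum of moments
    ([gauss_rowE]), which sum to the coefficients [[x^j]] of the statement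
    ([eps_positive_gf]). The factor [e^{t - t^2 w / 2}] has support in
    [m <= n], so by uniqueness the positive graphs of excess [k] are
    counted by [positive_gf] ([positive_gf_comp]). On the part of excess [k],
    the substitution is [z = t e^{- t}], whose inverse is [t = T(z)]
    ([tree_inv_treegf]).

    Both expressions of the statement are rewritings of [positive_gf]
    ([SKserE], [Cser_positive_gf]). The polynomiality of the numerator comes
    from the fact that extracting [[x^j]] creates no denominator worse than
    [(1 - T)^j] ([is_poly_SKser]), and that of the series of patchworks from a
    bound on the number of vertices of a positive patchwork ([patch_bound]). *)

(** * Edges as sets of endpoints *)

Lemma connect_closed_ind (T : finType) (r : rel T) (Q : T -> Prop) x y :
  connect r x y -> (forall a b, r a b -> Q a -> Q b) -> Q x -> Q y.
Proof.
case/connectP => p; elim: p x => [|z p IH] x /=; first by move=> _ ->.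
by move=> /andP[rxz pz] yE step Qx; apply: (IH z) => //; apply: step rxz Qx.
Qed.

Section Hypergraph.
Variables (V L : finType) (E : L -> {set V}).

Definition adj (a b : V) := [exists e, (a \in E e) && (b \in E e)].
Definition component (v : V) : {set V} := [set w | connect adj v w].
Definition inner (C : {set V}) : {set L} := [set e | E e \subset C].
Definition posat (v : V) : bool := (#|component v| < #|inner (component v)|)%N.

(** A set of edges that forms a loop or a double edge: a loop is one edge with
    one end, a double edge is two edges with the same two ends. *)
Definition piece (B : {set L}) : bool :=
  [exists e in B, [forall f in B, E f == E e] && (#|E e| == #|B|)].
Definition pieces : {set {set L}} := [set B | piece B].

Definition spanning : bool := [forall v, exists e, v \in E e].
Definition full (P : {set {set L}}) : bool := (cover P == setT) && spanning.

Lemma adj_sym : symmetric adj.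
Proof. by move=> a b; apply: eq_existsb => e; rewrite andbC. Qed.

Lemma connect_adj_sym : connect_sym adj.
Proof. exact: sym_connect_sym adj_sym. Qed.

Lemma mem_comp v : v \in component v.
Proof. by rewrite inE connect0. Qed.

Lemma comp_eq v w : w \in component v -> component w = component v.
Proof.
rewrite inE => vw; apply/setP => x; rewrite !inE.
by rewrite (same_connect connect_adj_sym vw).
Qed.

Lemma posat_comp v w : w \in component v -> posat w = posat v.
Proof. by move=> wv; rewrite /posat (comp_eq wv). Qed.

Lemma edge_comp e v w : v \in E e -> w \in E e -> w \in component v.
Proof. by move=> ve we; rewrite inE connect1 //; apply/existsP; exists e; rewrite ve we. Qed.

Lemma posat_edge e v w : v \in E e -> w \in E e -> posat w = posat v.
Proof. by move=> ve we; apply: posat_comp (edge_comp ve we). Qed.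

Lemma pieceP (B : {set L}) : reflect (exists2 e, e \in B & [/\ forall f, f \in B -> E f = E e & #|E e| = #|B|])
  (piece B).
Proof.
apply: (iffP existsP) => [[e /and3P[eB /forallP h /eqP c]]|[e eB [h c]]].
  by exists e => //; split=> // f fB; apply/eqP; exact: (implyP (h f)).
exists e; rewrite eB c eqxx andbT /=.
by apply/forallP => f; apply/implyP => fB; rewrite h.
Qed.

Lemma mem_pieces B : (B \in pieces) = piece B.
Proof. by rewrite inE. Qed.

Lemma piece_neq0 B : piece B -> B != set0.
Proof. by case/pieceP => e eB _; apply/set0Pn; exists e. Qed.

Lemma spanningP : reflect (forall v, exists e, v \in E e) spanning.
Proof. exact: 'forall_existsP. Qed.

End Hypergraph.

Lemma imset_imset_inj (T U : finType) (g : T -> U) : injective g ->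
  injective (fun B : {set T} => g @: B).
Proof. by move=> gI; exact: imset_inj. Qed.

Lemma cover_image (T U : finType) (g : T -> U) (P : {set {set T}}) :
  cover ((fun B : {set T} => g @: B) @: P) = g @: cover P.
Proof.
apply/setP => x; apply/bigcupP/imsetP => [[C /imsetP[B BP ->] /imsetP[y yB ->]]|].
  by exists y => //; apply/bigcupP; exists B.
by move=> [y /bigcupP[B BP yB] ->]; exists (g @: B); apply: imset_f.
Qed.

(** [V1] and [L1] are the vertices and the edges of a union of components:
    [closed] says that no other edge touches these vertices. Components, and
    hence their excess, are then the same in both multigraphs. *)
Section Embedding.
Variables (V L V1 L1 : finType) (E : L -> {set V}) (E1 : L1 -> {set V1}).
Variables (f : V1 -> V) (g : L1 -> L).
Hypotheses (fI : injective f) (gI : injective g).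
Hypothesis Eg : forall e, E (g e) = f @: E1 e.

Lemma piece_imset (B : {set L1}) : piece E (g @: B) = piece E1 B.
Proof.
apply/pieceP/pieceP => [[_ /imsetP[e eB ->] [h c]]|[e eB [h c]]].
  exists e => //; split=> [x xB|].
    by apply: (imset_inj fI); rewrite -!Eg h // imset_f.
  by rewrite -(card_imset _ fI) -Eg c card_imset.
exists (g e); first exact: imset_f.
split=> [_ /imsetP[x xB ->]|]; first by rewrite !Eg h.
by rewrite Eg !card_imset.
Qed.

Hypothesis closed : forall e v, f v \in E e -> exists e1, e = g e1.
Hypothesis En0 : forall e, E e != set0.

Lemma emb_adj a w : reflect (exists2 b, w = f b & adj E1 a b) (adj E (f a) w).
Proof.
apply: (iffP existsP) => [[e /andP[ae we]]|[b -> /existsP[e /andP[ae be]]]].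
  have [e1 eE] := closed ae; move: ae we; rewrite eE Eg (mem_imset _ _ fI) => ae /imsetP[b be ->].
  by exists b => //; apply/existsP; exists e1; rewrite ae be.
by exists (g e); rewrite Eg !(mem_imset _ _ fI) ae be.
Qed.

Lemma emb_comp v : component E (f v) = f @: component E1 v.
Proof.
apply/setP => w; apply/idP/imsetP.
  rewrite inE => vw.
  apply: (connect_closed_ind (Q := fun w => exists2 x, x \in component E1 v & w = f x) vw).
    move=> a b ab [x xv aE]; move: ab; rewrite aE => /emb_adj[y -> xy].
    by exists y => //; move: xv; rewrite !inE => xv; apply: connect_trans xv (connect1 xy).
  by exists v => //; exact: mem_comp.
move=> [x]; rewrite !inE => vx ->.
apply: (connect_closed_ind (Q := fun x => connect (adj E) (f v) (f x)) vx).
  by move=> a b ab fa; apply: connect_trans fa _; apply/connect1/emb_adj; exists b.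
exact: connect0.
Qed.

Lemma emb_inner (C : {set V1}) : inner E (f @: C) = g @: inner E1 C.
Proof.
apply/setP => e; apply/idP/imsetP; rewrite inE.
  move=> eC; have /set0Pn[w we] := En0 e.
  have /imsetP[v vC wE] := subsetP eC w we; rewrite wE in we.
  have [e1 e1E] := closed we; exists e1 => //; rewrite inE.
  apply/subsetP => x xe; have := subsetP eC (f x).
  by rewrite e1E Eg !(mem_imset _ _ fI); apply.
by move=> [e1]; rewrite inE => e1C ->; rewrite Eg; exact: imsetS.
Qed.

Lemma emb_posat v : posat E (f v) = posat E1 v.
Proof. by rewrite /posat emb_comp emb_inner !card_imset. Qed.

End Embedding.

(** * Sums over subsets *)

Lemma sum_subset_card (R : nmodType) (T : finType) (X : {set T}) (F : nat -> R) :
  \sum_(P : {set T} | P \subset X) F #|P| = \sum_(k < #|X|.+1) F k *+ 'C(#|X|, k).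
Proof.
rewrite (partition_big (fun P : {set T} => inord #|P| : 'I_#|X|.+1) xpredT) //=.
apply: eq_bigr => k _; rewrite -cards_draws -sumr_const.
rewrite [RHS](eq_bigl (fun P : {set T} => (P \subset X) && (#|P| == k))); last first.
  by move=> P; rewrite inE.
apply: eq_big => [P|P /andP[PX /eqP <-]].
  apply: andb_id2l => PX; rewrite -val_eqE /= inordK //.
  by rewrite ltnS subset_leq_card.
by rewrite inordK // ltnS subset_leq_card.
Qed.

Lemma sum_set_card (R : nmodType) n (F : nat -> R) :
  \sum_(S : {set 'I_n}) F #|S| = \sum_(i < n.+1) F i *+ 'C(n, i).
Proof.
have := sum_subset_card (setT : {set 'I_n}) F; rewrite cardsT card_ord => <-.
by apply: eq_bigl => S; rewrite subsetT.
Qed.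

Lemma sum_subset_sign (T : finType) (X : {set T}) :
  \sum_(P : {set T} | P \subset X) (-1) ^+ #|P| = (X == set0)%:R :> rat.
Proof.
rewrite (sum_subset_card X (fun k => (-1) ^+ k)).
transitivity ((1 - 1 : rat) ^+ #|X|).
  by rewrite exprDn; apply: eq_bigr => k _; rewrite expr1n mul1r.
by rewrite subrr expr0n cards_eq0.
Qed.

(** * Cutting a multigraph in two *)

Notation emap n m := {ffun 'I_m -> 'I_n * 'I_n}.

Definition ends (V L : finType) (M : {ffun L -> V * V}) (e : L) : {set V} :=
  [set (M e).1; (M e).2].

Lemma ends_neq0 (V L : finType) (M : {ffun L -> V * V}) e : ends M e != set0.
Proof. by apply/set0Pn; exists (M e).1; rewrite !inE eqxx. Qed.

(** The generating functions count multigraphs on ['I_n] with labels in ['I_m],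
    so a part of a multigraph has to be relabelled by initial segments; the
    enumeration of a set does this. *)
Definition incl (T : finType) (S : {set T}) (i : 'I_#|S|) : T := enum_val i.
Arguments incl {T} S i.

Lemma incl_inj (T : finType) (S : {set T}) : injective (incl S).
Proof. exact: enum_val_inj. Qed.

Lemma incl_mem (T : finType) (S : {set T}) i : incl S i \in S.
Proof. exact: enum_valP. Qed.

Lemma incl_surj (T : finType) (S : {set T}) x : x \in S -> exists i, x = incl S i.
Proof. by move=> xS; exists (enum_rank_in xS x); rewrite /incl enum_rankK_in. Qed.

Lemma incl_image (T : finType) (S : {set T}) : incl S @: setT = S.
Proof.
apply/setP => x; apply/imsetP/idP => [[i _ ->]|/incl_surj[i ->]]; first exact: incl_mem.
by exists i.
Qed.

Lemma notin_setC (T : finType) (A : {set T}) x : x \notin A -> x \in ~: A.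
Proof. by rewrite inE. Qed.

Definition sumboolP (b : bool) : {b} + {~~ b} :=
  if b is true then left isT else right isT.

Definition side (T : finType) (A : {set T}) (x : T) : 'I_#|A| + 'I_#|~: A| :=
  match sumboolP (x \in A) with
  | left xA => inl (enum_rank_in xA x)
  | right xA => inr (enum_rank_in (notin_setC xA) x)
  end.

Lemma side_incl (T : finType) (A : {set T}) i : side A (incl A i) = inl i.
Proof.
rewrite /side; case: (sumboolP _) => [xA|xA]; last by have := incl_mem (S := A) i; rewrite (negPf xA).
by rewrite /incl enum_valK_in.
Qed.

Lemma side_inclC (T : finType) (A : {set T}) i : side A (incl (~: A) i) = inr i.
Proof.
rewrite /side; case: (sumboolP _) => [xA|xA]; last by rewrite /incl enum_valK_in.
by have := incl_mem (S := ~: A) i; rewrite inE xA.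
Qed.

Lemma incl_ind (T : finType) (A : {set T}) (Q : T -> Prop) :
  (forall i, Q (incl A i)) -> (forall i, Q (incl (~: A) i)) -> forall x, Q x.
Proof.
move=> QA QC x; case: (boolP (x \in A)) => [/incl_surj[i ->] //|xA].
by have [i ->] := incl_surj (notin_setC xA).
Qed.

Section Paste.
Variables (V V1 V2 L : finType) (f1 : V1 -> V) (f2 : V2 -> V) (A : {set L}).
Hypotheses (f1I : injective f1) (f2I : injective f2).

Definition map2 (V V' : finType) (f : V -> V') (p : V * V) := (f p.1, f p.2).

Lemma map2_inj (W W' : finType) (f : W -> W') : injective f -> injective (map2 f).
Proof. by move=> fI [a b] [c d] [/fI -> /fI ->]. Qed.

(** The multigraph whose edges with label in [A] come from [M1], and the others
    from [M2]. The images of [f1] and [f2] may overlap: they do not when a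
    multigraph is cut into components, but they do when a patchwork is
    completed by arbitrary edges. *)
Definition paste (M1 : {ffun 'I_#|A| -> V1 * V1}) (M2 : {ffun 'I_#|~: A| -> V2 * V2})
    : {ffun L -> V * V} :=
  [ffun e => match side A e with
             | inl i => map2 f1 (M1 i)
             | inr i => map2 f2 (M2 i)
             end].

Lemma paste_incl M1 M2 i : paste M1 M2 (incl A i) = map2 f1 (M1 i).
Proof. by rewrite ffunE side_incl. Qed.
Lemma paste_inclC M1 M2 i : paste M1 M2 (incl (~: A) i) = map2 f2 (M2 i).
Proof. by rewrite ffunE side_inclC. Qed.

Lemma ends_paste M1 M2 i : ends (paste M1 M2) (incl A i) = f1 @: ends M1 i.
Proof. by rewrite /ends paste_incl imsetU1 imset_set1. Qed.
Lemma ends_pasteC M1 M2 i : ends (paste M1 M2) (incl (~: A) i) = f2 @: ends M2 i.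
Proof. by rewrite /ends paste_inclC imsetU1 imset_set1. Qed.

Definition sorted_by (S1 S2 : {set V}) (M : {ffun L -> V * V}) :=
  [forall e, ends M e \subset (if e \in A then S1 else S2)].

Lemma paste_sum (R : nmodType) (S1 S2 : {set V}) (F : {ffun L -> V * V} -> R) :
  f1 @: setT = S1 -> f2 @: setT = S2 ->
  \sum_(M | sorted_by S1 S2 M) F M = \sum_M1 \sum_M2 F (paste M1 M2).
Proof.
move=> S1E S2E; rewrite pair_big /=.
pose h (p : {ffun 'I_#|A| -> V1 * V1} * {ffun 'I_#|~: A| -> V2 * V2}) := paste p.1 p.2.
have hI : injective h.
  move=> [M1 M2] [M1' M2'] hh; congr (_, _); apply/ffunP => i.
    by have /ffunP/(_ (incl A i)) := hh; rewrite !paste_incl => /(map2_inj f1I).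
  by have /ffunP/(_ (incl (~: A) i)) := hh; rewrite !paste_inclC => /(map2_inj f2I).
have pre (W : finType) (f : W -> V) S p : f @: setT = S -> [set p.1; p.2] \subset S ->
    exists q, p == map2 f q.
  move=> <- /subsetP sub.
  have /imsetP[a _ aE] : p.1 \in f @: setT by apply: sub; rewrite !inE eqxx.
  have /imsetP[b _ bE] : p.2 \in f @: setT by apply: sub; rewrite !inE eqxx orbT.
  by exists (a, b); rewrite /map2 -aE -bE -surjective_pairing.
transitivity (\sum_(M in h @: setT) F M); last first.
  rewrite big_imset /=; last by move=> ? ? _ _; exact: hI.
  by apply: eq_bigl => p; rewrite inE.
apply: eq_bigl => M; apply/idP/imsetP.
  move=> /forallP onM.
  have /fin_all_exists[m1 m1E] i : exists q, M (incl A i) == map2 f1 q.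
    by apply: pre S1E _; have := onM (incl A i); rewrite incl_mem.
  have /fin_all_exists[m2 m2E] i : exists q, M (incl (~: A) i) == map2 f2 q.
    apply: pre S2E _; have := onM (incl (~: A) i).
    by have := incl_mem (S := ~: A) i; rewrite inE => /negPf ->.
  exists (finfun m1, finfun m2) => //; apply/ffunP; apply: (incl_ind (A := A)) => i.
    by rewrite paste_incl ffunE; apply/eqP.
  by rewrite paste_inclC ffunE; apply/eqP.
move=> [[M1 M2] _ ->]; apply/forallP; apply: (incl_ind (A := A)) => i.
  by rewrite incl_mem ends_paste -S1E imsetS ?subsetT.
have := incl_mem (S := ~: A) i; rewrite inE => /negPf ->.
by rewrite ends_pasteC -S2E imsetS ?subsetT.
Qed.

End Paste.

Section PasteEmb.
Variables (n m : nat) (S : {set 'I_n}) (A : {set 'I_m}).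
Variables (M1 : emap #|S| #|A|) (M2 : emap #|~: S| #|~: A|).
Let M := paste (incl S) (incl (~: S)) M1 M2.

Lemma paste_closed e v : incl S v \in ends M e -> exists e1, e = incl A e1.
Proof.
move: e v; apply: (incl_ind (A := A)) => e v; first by exists e.
rewrite ends_pasteC => /imsetP[w _ vw].
by have := incl_mem (S := ~: S) w; rewrite -vw inE incl_mem.
Qed.

Lemma paste_closedC e v : incl (~: S) v \in ends M e -> exists e1, e = incl (~: A) e1.
Proof.
move: e v; apply: (incl_ind (A := A)) => e v; last by exists e.
rewrite ends_paste => /imsetP[w _ vw].
by have := incl_mem (S := ~: S) v; rewrite vw inE incl_mem.
Qed.

Lemma posat_paste v : posat (ends M) (incl S v) = posat (ends M1) v.
Proof.
apply: (emb_posat (g := incl A)); try exact: incl_inj.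
- exact: ends_paste.
- exact: paste_closed.
- exact: ends_neq0.
Qed.

Lemma posat_pasteC v : posat (ends M) (incl (~: S) v) = posat (ends M2) v.
Proof.
apply: (emb_posat (g := incl (~: A))); try exact: incl_inj.
- exact: ends_pasteC.
- exact: paste_closedC.
- exact: ends_neq0.
Qed.

End PasteEmb.

Definition all_pos n m (M : emap n m) := [forall v, posat (ends M) v].
Definition none_pos n m (M : emap n m) := [forall v, ~~ posat (ends M) v].

Section Split.
Variable om : forall n m, emap n m -> rat.
Hypothesis om_paste : forall n m (S : {set 'I_n}) (A : {set 'I_m}) M1 M2,
  om (paste (incl S) (incl (~: S)) M1 M2 : emap n m) =
    om (M1 : emap #|S| #|A|) * om (M2 : emap #|~: S| #|~: A|).

Definition pos_sum n m : rat := \sum_(M : emap n m | all_pos M) om M.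
Definition neg_sum n m : rat := \sum_(M : emap n m | none_pos M) om M.

(** The set [S] of the vertices that lie in components of positive excess and the
    set [A] of the edges between them determine how a multigraph is cut, and any
    two multigraphs of the right kinds on [S] and on its complement can be
    pasted. *)
Lemma split_sum n m : \sum_(M : emap n m) om M =
  \sum_(S : {set 'I_n}) \sum_(A : {set 'I_m})
    pos_sum #|S| #|A| * neg_sum #|~: S| #|~: A|.
Proof.
pose PV (M : emap n m) := [set v | posat (ends M) v].
pose PE (M : emap n m) := [set e | ends M e \subset PV M].
rewrite (partition_big PV xpredT) //=; apply: eq_bigr => S _.
rewrite (partition_big PE xpredT) //=; apply: eq_bigr => A _.
transitivity (\sum_(M : emap n m | sorted_by A S (~: S) M) if PV M == S then om M else 0).
  rewrite -big_mkcondr; apply: eq_bigl => M; rewrite andbC.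
  apply/andP/andP => -[]; last first.
    move=> /forallP onM /eqP SE; split; last by rewrite SE.
    apply/eqP/setP => e; rewrite inE SE; have := onM e; case: ifP => // eA eS.
    apply/negP => eS'; have /set0Pn[w we] := ends_neq0 M e.
    by have := subsetP eS w we; rewrite inE (subsetP eS' w we).
  move=> /eqP <- /eqP SE; split; last by rewrite SE.
  apply/forallP => e; rewrite inE SE; case: ifP => // /negP eS.
  apply/subsetP => w we; rewrite inE -SE inE; apply/negP => pw; apply: eS.
  by apply/subsetP => x xe; rewrite -SE inE (posat_edge we xe).
rewrite (paste_sum _ (@incl_inj _ S) (@incl_inj _ (~: S)) _ (incl_image _) (incl_image _)).
rewrite /pos_sum /neg_sum [X in _ = X * _]big_mkcond [X in _ = _ * X]big_mkcond /=.
rewrite mulr_suml; apply: eq_bigr => M1 _; rewrite mulr_sumr; apply: eq_bigr => M2 _.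
have -> : (PV (paste (incl S) (incl (~: S)) M1 M2) == S) = all_pos M1 && none_pos M2.
  apply/eqP/andP => [SE|[/forallP p1 /forallP p2]].
    split; apply/forallP => v.
      by have /setP/(_ (incl S v)) := SE; rewrite inE incl_mem posat_paste.
    have /setP/(_ (incl (~: S) v)) := SE; rewrite inE posat_pasteC => ->.
    by have := incl_mem (S := ~: S) v; rewrite inE.
  apply/setP; apply: (incl_ind (A := S)) => v; rewrite inE.
    by rewrite posat_paste p1 incl_mem.
  rewrite posat_pasteC (negPf (p2 v)); have := incl_mem (S := ~: S) v.
  by rewrite inE => /negPf ->.
by case: all_pos; case: none_pos; rewrite /= ?mul0r ?mulr0 ?om_paste.
Qed.

End Split.

(** * Simple multigraphs and patchworks *)

Definition simple_wt n m (M : emap n m) : rat := (pieces (ends M) == set0)%:R.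

(** The patchworks whose multigraph is [M], each counted with [u = -1]. *)
Definition patch_wt n m (M : emap n m) : rat :=
  \sum_(P : {set {set 'I_m}} | (P \subset pieces (ends M)) && full (ends M) P)
     (-1) ^+ #|P|.

(** Transport of the sets of labels of a patchwork between a multigraph and a
    relabelled part of it. *)
Definition push (T : finType) (A : {set T}) (P : {set {set 'I_#|A|}}) : {set {set T}} :=
  (fun B : {set 'I_#|A|} => incl A @: B) @: P.
Definition pull (T : finType) (A : {set T}) (P : {set {set T}}) : {set {set 'I_#|A|}} :=
  [set B : {set 'I_#|A|} | incl A @: B \in P].

Lemma incl_imset_inj (T : finType) (A : {set T}) :
  injective (fun B : {set 'I_#|A|} => incl A @: B).
Proof. exact: imset_imset_inj (@incl_inj _ A). Qed.

Lemma mem_push (T : finType) (A : {set T}) P (B : {set 'I_#|A|}) :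
  (incl A @: B \in push P) = (B \in P).
Proof. exact: mem_imset (@incl_imset_inj _ A). Qed.

Lemma pushK (T : finType) (A : {set T}) : cancel (@push T A) (@pull T A).
Proof. by move=> P; apply/setP => B; rewrite inE mem_push. Qed.

Lemma card_push (T : finType) (A : {set T}) P : #|@push T A P| = #|P|.
Proof. exact: card_imset (@incl_imset_inj _ A). Qed.

Lemma cover_push (T : finType) (A : {set T}) P : cover (@push T A P) = incl A @: cover P.
Proof. exact: cover_image. Qed.

Lemma subset_incl_image (T : finType) (A B : {set T}) : B \subset A ->
  B = incl A @: [set i | incl A i \in B].
Proof.
move=> /subsetP BA; apply/setP => x; apply/idP/imsetP => [xB|[i]].
  by have [i xi] := incl_surj (BA x xB); exists i; rewrite // inE -xi.
by rewrite inE => iB ->.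
Qed.

Lemma pullK (T : finType) (A : {set T}) (P : {set {set T}}) : cover P \subset A ->
  push (pull A P) = P.
Proof.
move=> PA; apply/setP => B; apply/imsetP/idP => [[B1]|BP]; first by rewrite inE => BP ->.
have BA : B \subset A by apply: subset_trans PA; exact: bigcup_sup.
by exists [set i | incl A i \in B]; rewrite ?inE -subset_incl_image.
Qed.

(** A loop or a double edge is connected, so it lies on one side of the cut. *)
Section PasteWeights.
Variables (n m : nat) (S : {set 'I_n}) (A : {set 'I_m}).
Variables (M1 : emap #|S| #|A|) (M2 : emap #|~: S| #|~: A|).
Let M : emap n m := paste (incl S) (incl (~: S)) M1 M2.

Let piece1 (B : {set 'I_#|A|}) : piece (ends M) (incl A @: B) = piece (ends M1) B.
Proof. by apply: piece_imset; [exact: incl_inj | exact: incl_inj | exact: ends_paste]. Qed.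

Let piece2 (B : {set 'I_#|~: A|}) :
  piece (ends M) (incl (~: A) @: B) = piece (ends M2) B.
Proof. by apply: piece_imset; [exact: incl_inj | exact: incl_inj | exact: ends_pasteC]. Qed.

Let piece_side B : piece (ends M) B -> (B \subset A) \/ (B \subset ~: A).
Proof.
case/pieceP => e; move: e; apply: (incl_ind (A := A)) => e eB [BE _]; [left|right].
  apply/subsetP => f fB; have := BE f fB; have /set0Pn[v ve] := ends_neq0 M1 e.
  rewrite [in RHS]ends_paste => fE; have : incl S v \in ends M f.
    by rewrite fE imset_f.
  by move=> /paste_closed[g ->]; exact: incl_mem.
apply/subsetP => f fB; have := BE f fB; have /set0Pn[v ve] := ends_neq0 M2 e.
rewrite [in RHS]ends_pasteC => fE; have : incl (~: S) v \in ends M f.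
  by rewrite fE imset_f.
by move=> /paste_closedC[g ->]; exact: incl_mem.
Qed.

Lemma simple_wt_paste : simple_wt M = simple_wt M1 * simple_wt M2.
Proof.
rewrite /simple_wt -natrM mulnb; congr (_%:R); congr nat_of_bool.
apply/eqP/andP => [E0|[/eqP E1 /eqP E2]].
  split; apply/eqP/setP => B; rewrite mem_pieces in_set0.
    by rewrite -piece1 -mem_pieces E0 in_set0.
  by rewrite -piece2 -mem_pieces E0 in_set0.
apply/setP => B; rewrite mem_pieces in_set0; apply: contraFF (erefl false) => pB.
have [BA|BA] := piece_side pB; move: pB; rewrite (subset_incl_image BA).
  by rewrite piece1 -mem_pieces E1 in_set0.
by rewrite piece2 -mem_pieces E2 in_set0.
Qed.

Let up (p : {set {set 'I_#|A|}} * {set {set 'I_#|~: A|}}) := push p.1 :|: push p.2.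
Let down (P : {set {set 'I_m}}) := (pull A P, pull (~: A) P).

Let full_up p : full (ends M) (up p) = full (ends M1) p.1 && full (ends M2) p.2.
Proof.
have coverU : cover (up p) = incl A @: cover p.1 :|: incl (~: A) @: cover p.2.
  by rewrite -!cover_push /cover /up bigcup_setU.
rewrite /full coverU; apply/andP/andP.
  move=> [/eqP cT /spanningP sp]; split; apply/andP; split.
  - apply/eqP/setP => i; rewrite inE; have /setP/(_ (incl A i)) := cT.
    rewrite !inE (mem_imset _ _ (@incl_inj _ A)) => /orP[//|/imsetP[j _ ij]].
    by have := incl_mem (S := ~: A) j; rewrite -ij inE incl_mem.
  - apply/spanningP => v; have [e ve] := sp (incl S v).
    have [e1 eE] := paste_closed ve; exists e1; move: ve.
    by rewrite eE ends_paste (mem_imset _ _ (@incl_inj _ S)).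
  - apply/eqP/setP => i; rewrite inE; have /setP/(_ (incl (~: A) i)) := cT.
    rewrite !inE (mem_imset _ _ (@incl_inj _ (~: A))) => /orP[/imsetP[j _ ij]|//].
    by have := incl_mem (S := ~: A) i; rewrite ij inE incl_mem.
  - apply/spanningP => v; have [e ve] := sp (incl (~: S) v).
    have [e1 eE] := paste_closedC ve; exists e1; move: ve.
    by rewrite eE ends_pasteC (mem_imset _ _ (@incl_inj _ (~: S))).
move=> [/andP[/eqP c1 /spanningP s1] /andP[/eqP c2 /spanningP s2]]; split.
  by rewrite c1 c2 !incl_image setUCr.
apply/spanningP; apply: (incl_ind (A := S)) => v.
  by have [e ve] := s1 v; exists (incl A e); rewrite ends_paste imset_f.
by have [e ve] := s2 v; exists (incl (~: A) e); rewrite ends_pasteC imset_f.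
Qed.

Lemma patch_wt_paste : patch_wt M = patch_wt M1 * patch_wt M2.
Proof.
have disj (B1 : {set 'I_#|A|}) (B2 : {set 'I_#|~: A|}) : piece (ends M1) B1 -> incl A @: B1 != incl (~: A) @: B2.
  move=> /piece_neq0/set0Pn[i iB]; apply/negP => /eqP BB.
  have : incl A i \in incl A @: B1 by exact: imset_f.
  rewrite BB => /imsetP[j _ ij].
  by have := incl_mem (S := ~: A) j; rewrite -ij inE incl_mem.
have disj' (B1 : {set 'I_#|A|}) (B2 : {set 'I_#|~: A|}) : piece (ends M2) B2 -> incl A @: B1 != incl (~: A) @: B2.
  move=> /piece_neq0/set0Pn[i iB]; apply/negP => /eqP BB.
  have : incl (~: A) i \in incl (~: A) @: B2 by exact: imset_f.
  rewrite -BB => /imsetP[j _ ij].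
  by have := incl_mem (S := ~: A) i; rewrite ij inE incl_mem.
rewrite /patch_wt (reindex_onto up down) /=; last first.
  move=> P /andP[/subsetP PE _]; apply/setP => B; rewrite inE; apply/orP/idP.
    by move=> -[] /imsetP[B1]; rewrite inE => BP ->.
  move=> BP; have pB : piece (ends M) B by rewrite -mem_pieces; exact: PE.
  have [BA|BA] := piece_side pB; [left|right]; apply/imsetP.
    by exists [set i | incl A i \in B]; rewrite ?inE -subset_incl_image.
  by exists [set i | incl (~: A) i \in B]; rewrite ?inE -subset_incl_image.
have domE p : (up p \subset pieces (ends M)) && full (ends M) (up p) && (down (up p) == p) =
   ((p.1 \subset pieces (ends M1)) && full (ends M1) p.1) &&
   ((p.2 \subset pieces (ends M2)) && full (ends M2) p.2).
  rewrite full_up; case: p => p1 p2 /=.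
  apply/andP/andP => [[/andP[/subsetP upE /andP[-> ->]] _]|].
    rewrite !andbT; split; apply/subsetP => B BP; rewrite mem_pieces.
      by rewrite -piece1 -mem_pieces; apply: upE; rewrite inE mem_push BP.
    by rewrite -piece2 -mem_pieces; apply: upE; rewrite inE mem_push BP orbT.
  move=> [/andP[/subsetP s1 ->] /andP[/subsetP s2 ->]]; split; rewrite ?andbT.
    apply/subsetP => B; rewrite inE mem_pieces => /orP[] /imsetP[B' BP ->].
      by rewrite piece1 -mem_pieces; exact: s1.
    by rewrite piece2 -mem_pieces; exact: s2.
  apply/eqP; congr (_, _); apply/setP => B; rewrite !inE mem_push.
    apply/orP/idP => [[//|/imsetP[B' BP /eqP BB]]|]; last by left.
    by have := s2 B' BP; rewrite mem_pieces => /(disj' B); rewrite BB.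
  apply/orP/idP => [[/imsetP[B' BP /eqP BB]|//]|]; last by right.
  by have := s1 B' BP; rewrite mem_pieces => /(fun pB => disj _ B pB); rewrite eq_sym BB.
rewrite (eq_bigl _ _ domE) big_distrlr pair_big /=.
apply: eq_big => [//|[p1 p2] /= /andP[/andP[/subsetP s1 _] _]].
rewrite -exprD; congr (_ ^+ _).
rewrite /up /= cardsU !card_push (_ : _ :&: _ = set0) ?cards0 ?subn0 //.
apply/setP => B; rewrite in_setI in_set0; apply/andP => -[/imsetP[B1 BP ->] /imsetP[B2 _ /eqP BB]].
by have := s1 B1 BP; rewrite mem_pieces => /(fun pB => disj _ B2 pB); rewrite BB.
Qed.

End PasteWeights.

(** Inclusion and exclusion: a multigraph without loops or double edges is
    detected by the signed sum over all sets of its loops and double edges. The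
    edges of such a set form a patchwork, and the other edges are arbitrary. *)
Lemma simple_patch n m : \sum_(M : emap n m) simple_wt M =
  \sum_(S : {set 'I_n}) \sum_(A : {set 'I_m})
    (\sum_(M : emap #|S| #|A|) patch_wt M) * ((n ^ 2) ^ #|~: A|)%:R.
Proof.
transitivity (\sum_(M : emap n m) \sum_(P : {set {set 'I_m}} | P \subset pieces (ends M)) (-1) ^+ #|P| : rat).
  by apply: eq_bigr => M _; rewrite /simple_wt sum_subset_sign.
pose SE (M : emap n m) (A : {set 'I_m}) : {set 'I_n} := \bigcup_(e in A) ends M e.
transitivity (\sum_(S : {set 'I_n}) \sum_(A : {set 'I_m}) \sum_(M : emap n m)
   \sum_(P : {set {set 'I_m}} | [&& P \subset pieces (ends M), cover P == A & SE M A == S]) (-1) ^+ #|P| : rat).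
  rewrite exchange_big /=; under [RHS]eq_bigr => A _ do rewrite exchange_big /=.
  rewrite [RHS]exchange_big /=; apply: eq_bigr => M _.
  rewrite (partition_big (fun P => cover P) xpredT) //=; apply: eq_bigr => A _.
  rewrite (partition_big (fun P => SE M A) xpredT) //=; apply: eq_bigr => S _.
  by apply: eq_bigl => P; rewrite -andbA.
apply: eq_bigr => S _; apply: eq_bigr => A _.
transitivity (\sum_(M | sorted_by A S setT M) \sum_(P : {set {set 'I_m}} | [&& P \subset pieces (ends M), cover P == A & SE M A == S]) (-1) ^+ #|P| : rat).
  rewrite [RHS]big_mkcond; apply: eq_bigr => M _; case: ifP => // /negP onM.
  apply: big1 => P /and3P[_ _ /eqP SEM]; case: onM; apply/forallP => e.
  by case: ifP => eA; rewrite ?subsetT // -SEM; exact: bigcup_sup.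
have idT : id @: (setT : {set 'I_n}) = setT by exact: imset_id.
rewrite (paste_sum _ (@incl_inj _ S) (@inj_id 'I_n) _ (incl_image _) idT) mulr_suml.
apply: eq_bigr => M1 _.
transitivity (\sum_(M2 : {ffun 'I_#|~: A| -> 'I_n * 'I_n}) patch_wt M1); last first.
  by rewrite sumr_const card_ffun card_prod !card_ord mulr_natr mulnn.
apply: eq_bigr => M2 _; set M := paste _ _ _ _.
rewrite /patch_wt (reindex_onto (@push _ A) (@pull _ A)) /=; last first.
  by move=> P /and3P[_ /eqP cP _]; apply: pullK; rewrite cP.
have piece1 (B : {set 'I_#|A|}) : piece (ends M) (incl A @: B) = piece (ends M1) B.
  by apply: piece_imset; [exact: incl_inj | exact: incl_inj | exact: ends_paste].
apply: eq_big => [P|P _]; last by rewrite card_push.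
rewrite pushK eqxx andbT /full cover_push; congr (_ && (_ && _)).
- apply/subsetP/subsetP => sub B.
    by move=> BP; rewrite mem_pieces -piece1 -mem_pieces; apply: sub; rewrite mem_push.
  by case/imsetP => B' BP ->; rewrite mem_pieces piece1 -mem_pieces; exact: sub.
- by rewrite -[X in _ == X](incl_image A) (inj_eq (@imset_inj _ _ _ (@incl_inj _ A))).
have SEE : SE M A = incl S @: \bigcup_e ends M1 e.
  apply/setP => v; apply/bigcupP/imsetP => [[e /incl_surj[e1 ->]]|[v1 /bigcupP[e _ ve] ->]].
    by rewrite ends_paste => /imsetP[v1 ve ->]; exists v1 => //; apply/bigcupP; exists e1.
  by exists (incl A e); rewrite ?incl_mem // ends_paste imset_f.
rewrite SEE -[X in _ == X](incl_image S) (inj_eq (@imset_inj _ _ _ (@incl_inj _ S))).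
apply/eqP/spanningP => [cT v|sp].
  by have /setP/(_ v) := cT; rewrite inE => /bigcupP[e _ ve]; exists e.
by apply/setP => v; rewrite inE; apply/bigcupP; have [e ve] := sp v; exists e.
Qed.

Local Open Scope nat_scope.

(** * Numbers of vertices and edges *)

Section Totals.
Variables (n m : nat) (M : emap n m).
Let E := ends M.
Let comps := [set component E v | v : 'I_n].

Lemma fst_ends e : (M e).1 \in ends M e. Proof. by rewrite !inE eqxx. Qed.
Lemma snd_ends e : (M e).2 \in ends M e. Proof. by rewrite !inE eqxx orbT. Qed.

(** The components partition the vertices and, as the ends of an edge lie in
    one component, the edges. So the excess of a multigraph is the sum of the
    excesses of its components. *)
Let comps_vertices : \sum_(C in comps) #|C| = n.
Proof.
rewrite -[RHS](card_ord n) -sum1_card (partition_big (component E) (mem comps)) /=; last first.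
  by move=> v _; exact: imset_f.
apply: eq_bigr => C /imsetP[w _ ->]; rewrite -sum1_card; apply: eq_bigl => v.
apply/idP/eqP => [/comp_eq //|<-]; exact: mem_comp.
Qed.

Let comps_edges : \sum_(C in comps) #|inner E C| = m.
Proof.
rewrite -[RHS](card_ord m) -sum1_card.
rewrite (partition_big (fun e => component E (M e).1) (mem comps)) /=; last first.
  by move=> e _; exact: imset_f.
apply: eq_bigr => C /imsetP[w _ ->]; rewrite -sum1_card; apply: eq_bigl => e.
rewrite inE; apply/idP/eqP => [/subsetP sub|<-].
  by apply: comp_eq; apply: sub; exact: fst_ends.
by apply/subsetP => x; exact: (edge_comp (fst_ends e)).
Qed.

Lemma all_pos_excess : all_pos M -> 0 < n -> n < m.
Proof.
move=> /forallP pos n0; rewrite -[n in n < m]comps_vertices -[X in _ < X]comps_edges.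
have C0 : 0 < #|comps|.
  by rewrite card_gt0; apply/set0Pn; exists (component E (Ordinal n0)); exact: imset_f.
apply: (@leq_trans (\sum_(C in comps) (#|C| + 1))).
  by rewrite big_split /= sum1_card -addn1 leq_add2l.
apply: leq_sum => C /imsetP[v _ ->]; rewrite addn1; exact: pos.
Qed.

Lemma none_pos_excess : none_pos M -> m <= n.
Proof.
move=> /forallP neg; rewrite -[X in _ <= X]comps_vertices -[X in X <= _]comps_edges.
by apply: leq_sum => C /imsetP[v _ ->]; rewrite leqNgt; exact: neg.
Qed.

End Totals.

(** A component of a positive patchwork that only has vertices of degree 2 would
    be a single loop or a single double edge. So every vertex of degree 2 has a
    neighbour of higher degree. The vertices of higher degree number at most
    [2 l], because the sum of [deg v - 2] over all the vertices is twice the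
    excess [l]. The sum of their degrees is at most three times this sum, that is
    [6 l], and it bounds the number of the vertices of degree 2. *)
Section PatchBound.
Variables (n m l : nat) (M : emap n m) (P : {set {set 'I_m}}).
Hypotheses (Ppieces : P \subset pieces (ends M)) (Pfull : full (ends M) P).
Hypotheses (Mpos : all_pos M) (ml : m = n + l).
Let E := ends M.

(* A loop has two darts at its vertex, so it adds 2 to the degree. *)
Let dart (d : 'I_m * bool) : 'I_n := if d.2 then (M d.1).1 else (M d.1).2.
Let at_ (v : 'I_n) : {set 'I_m * bool} := [set d | dart d == v].
Let deg v := #|at_ v|.

Let dart_ends d : dart d \in E d.1.
Proof. by case: d => e [] /=; rewrite !inE eqxx ?orbT. Qed.

Let ends_dart e v : v \in E e -> exists b, dart (e, b) = v.
Proof. by rewrite !inE => /orP[] /eqP ->; [exists true | exists false]. Qed.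

Let sum_deg : \sum_v deg v = m.*2.
Proof.
have <- : #|{: 'I_m * bool}| = m.*2 by rewrite card_prod card_ord card_bool muln2.
rewrite -sum1_card (partition_big dart xpredT) //=; apply: eq_bigr => v _.
by rewrite /deg -sum1_card; apply: eq_bigl => d; rewrite inE.
Qed.

Let piece_at v : exists B e, [/\ piece E B, e \in B & v \in E e].
Proof.
have /andP[/eqP cT /spanningP sp] := Pfull.
have [e ve] := sp v; have : e \in cover P by rewrite cT inE.
case/bigcupP => B BP eB; exists B, e; split => //.
by rewrite -mem_pieces; apply: (subsetP Ppieces).
Qed.

Let deg_ge2 v : 2 <= deg v.
Proof.
have [B [e [/pieceP[e0 e0B [BE cE]] eB ve]]] := piece_at v.
(* The loop or double edge of the patchwork at [v] has two darts there. *)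
have [d1 [d2 [d12 d1v d2v]]] : exists d1 d2, [/\ d1 != d2, d1 \in at_ v & d2 \in at_ v].
  have := cards2 (M e).1 (M e).2; rewrite -/(ends M e) -/E BE // cE.
  case: eqP => [loop _|_ cB].
    exists (e, true), (e, false); rewrite !inE xpair_eqE andbF /dart /=.
    by move: ve; rewrite !inE loop orbb => /eqP ->; rewrite eqxx.
  have /cards2P[f [g [fg BE2]]] : #|B| == 2 by rewrite cB.
  have v_in h : h \in B -> exists b, dart (h, b) = v.
    by move=> hB; apply: ends_dart; rewrite BE // -(BE e).
  have [|b bE] := v_in f; first by rewrite BE2 !inE eqxx.
  have [|c cE'] := v_in g; first by rewrite BE2 !inE eqxx orbT.
  exists (f, b), (g, c); rewrite !inE bE cE' eqxx xpair_eqE.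
  by case: eqP fg => //.
apply: leq_trans (_ : #|[set d1; d2]| <= _); first by rewrite cards2 d12.
by apply: subset_leq_card; apply/subsetP => d; rewrite in_set2 => /orP[] /eqP ->.
Qed.

Let hi : {set 'I_n} := [set v | 2 < deg v].

Let low_neighbour v : v \notin hi -> exists2 e, v \in E e & E e :&: hi != set0.
Proof.
move=> vlow; have [B [e [pB eB ve]]] := piece_at v.
exists e => //; apply/negP => /eqP C0.
have /pieceP[e0 e0B [BE cE]] := pB.
have CE : E e = E e0 by exact: BE.
set C := E e in C0.
have degC w : w \in C -> deg w = 2.
  move=> wC; apply/eqP; rewrite eqn_leq deg_ge2 andbT leqNgt; apply/negP => wh.
  have : w \in C :&: hi by rewrite in_setI wC inE.
  by rewrite C0 inE.
(* If every vertex of the loop or double edge [B] has degree 2, then all the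
   darts at these vertices are in [B], so [B] is a component of excess 0. *)
pose DC := [set d | dart d \in C]; pose DB := [set d : 'I_m * bool | d.1 \in B].
have DBC : DB \subset DC.
  by apply/subsetP => d; rewrite [_ \in DB]in_set [_ \in DC]in_set => dB; rewrite /C CE -(BE d.1) // dart_ends.
have cDB : #|DB| = #|B| * 2.
  rewrite (_ : DB = setX B [set: bool]); first by rewrite cardsX cardsT card_bool.
  by apply/setP => d; rewrite !inE andbT.
have cDC : #|DC| = #|C| * 2.
  rewrite -sum1_card (partition_big dart (mem C)) => [|d]; last by rewrite [_ \in DC]in_set.
  rewrite -sum_nat_const; apply: eq_bigr => w wC; rewrite -(degC w wC) /deg -sum1_card.
  by apply: eq_bigl => d; rewrite [_ \in DC]in_set [_ \in at_ w]in_set andbC; case: eqP => // ->.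
have DE : DB = DC by apply/eqP; rewrite eqEcard DBC cDB cDC /C CE cE leqnn.
have touch f w : w \in E f -> w \in C -> f \in B.
  move=> /ends_dart[b bw] wC; have : (f, b) \in DC by rewrite [_ \in DC]in_set bw.
  by rewrite -DE [_ \in DB]in_set.
have compC : component E v \subset C.
  apply/subsetP => w; rewrite inE => vw.
  apply: (connect_closed_ind (Q := fun w => w \in C) vw) ve.
  move=> a b /existsP[f /andP[af bf]] aC.
  by rewrite /C CE -(BE f) //; exact: touch aC.
have := forallP Mpos v; rewrite /posat -/E ltnNge => /negP; apply.
apply: (@leq_trans #|B|).
  apply: subset_leq_card; apply/subsetP => f; rewrite inE => fC.
  apply: (touch f (M f).1); first exact: fst_ends.
  by apply: (subsetP compC); apply: (subsetP fC); exact: fst_ends.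
rewrite -cE -CE; apply: subset_leq_card; apply/subsetP => w wC.
exact: edge_comp ve wC.
Qed.

Lemma patch_bound : n <= 8 * l.
Proof.
pose D := [set d | dart d \in hi]; pose X := [set e | E e :&: hi != set0].
have cD : #|D| = \sum_(v in hi) deg v.
  rewrite -sum1_card (partition_big dart (mem hi)) => [|d]; last by rewrite [_ \in D]in_set.
  apply: eq_bigr => w wh; rewrite /deg -sum1_card.
  by apply: eq_bigl => d; rewrite [_ \in D]in_set [_ \in at_ w]in_set andbC; case: eqP => // ->.
have XD : #|X| <= #|D|.
  apply: leq_trans (leq_imset_card fst D); apply: subset_leq_card; apply/subsetP => e.
  rewrite inE => /set0Pn[w]; rewrite inE => /andP[/ends_dart[b bw] wh].
  by apply/imsetP; exists (e, b); rewrite // [_ \in D]in_set bw.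
(* Two low vertices cannot share an edge that also has a high end, so the
   choice of such an edge is injective. *)
have lowX : #|~: hi| <= #|X|.
  have /fin_all_exists[c cP] v : exists e, v \notin hi -> (v \in E e) && (E e :&: hi != set0).
    case: (boolP (v \in hi)) => [vh|/low_neighbour[e ve eh]]; last by exists e; rewrite ve eh.
    by have [B [e _]] := piece_at v; exists e.
  rewrite -(card_in_imset (f := c)); last first.
    move=> v w; rewrite !in_setC => vl wl cvw.
    have /andP[vE /set0Pn[x]] := cP v vl; have /andP[wE _] := cP w wl.
    rewrite in_setI => /andP[xE xh]; rewrite -cvw in wE.
    have vx : v != x by apply: contraNneq vl => ->.
    have wx : w != x by apply: contraNneq wl => ->.
    move: vE wE xE vx wx; rewrite !inE; move: (M (c v)).1 (M (c v)).2 => a b.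
    by do 3![case/orP => /eqP ->]; rewrite ?eqxx.
  apply: subset_leq_card; apply/subsetP => _ /imsetP[v vl ->]; rewrite in_setC in vl.
  by rewrite inE; have /andP[] := cP v vl.
have cLow : \sum_(v in ~: hi) deg v = #|~: hi| * 2.
  rewrite -sum_nat_const; apply: eq_bigr => v; rewrite !inE -leqNgt => h.
  by apply/eqP; rewrite eqn_leq h deg_ge2.
have cHi : #|hi| * 3 <= \sum_(v in hi) deg v.
  by rewrite -sum_nat_const; apply: leq_sum => v; rewrite inE.
have tot : \sum_(v in hi) deg v + #|~: hi| * 2 = (n + l).*2.
  have := sum_deg; rewrite (bigID (mem hi)) /= => sd.
  rewrite -cLow -ml -sd; congr (_ + _).
  by apply: eq_bigl => v; rewrite in_setC.
have cn : #|hi| + #|~: hi| = n by rewrite cardsC card_ord.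
lia.
Qed.

End PatchBound.

Local Open Scope ring_scope.

(** * Simple graphs as multigraphs *)

Section Simple.
Variables (n m : nat).
Implicit Types (M : emap n m) (G : {set {set 'I_n}}).

Lemma simpleP M : reflect (injective (ends M) /\ forall e, #|ends M e| = 2%N)
  (pieces (ends M) == set0).
Proof.
apply: (iffP eqP) => [M0|[inj two]].
  have nopiece B : ~ piece (ends M) B by rewrite -mem_pieces M0 in_set0.
  have two e : #|ends M e| = 2%N.
    rewrite /ends cards2; case: eqP => // loop; case: (nopiece [set e]).
    apply/pieceP; exists e; rewrite ?set11 //; split=> [f /set1P -> //|].
    by rewrite cards1 /ends cards2 loop eqxx.
  split=> // e f ef; apply/eqP; apply: contra_notT (nopiece [set e; f]) => neq.
  apply/pieceP; exists e; rewrite ?set21 //; split=> [g /set2P[] -> //|].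
  by rewrite two cards2 neq.
apply/setP => B; rewrite mem_pieces in_set0.
apply: contraTF isT => /pieceP[e eB [BE cE]].
have : #|B| = 1%N.
  apply/eqP/cards1P; exists e; apply/setP => f; rewrite in_set1.
  by apply/idP/eqP => [/BE/inj //|->].
by rewrite -cE two.
Qed.

Definition edges M : {set {set 'I_n}} := [set ends M e | e : 'I_m].

Lemma card_orientations (s : {ffun 'I_m -> {set 'I_n}}) : (forall e, #|s e| = 2%N) ->
  #|[set M | [forall e, ends M e == s e]]| = (2 ^ m)%N.
Proof.
move=> s2; pose F e := [pred p : 'I_n * 'I_n | [set p.1; p.2] == s e].
rewrite (_ : #|_| = #|family F|); last first.
  apply: eq_card => M; rewrite inE; apply/forallP/familyP => h e.
    by rewrite inE; exact: h.
  by have := h e; rewrite inE.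
have F2 e : #|F e| = 2%N.
  have /eqP/cards2P[a [b [ab sE]]] := s2 e.
  rewrite (_ : #|_| = #|[set (a, b); (b, a)]|).
    by rewrite cards2 xpair_eqE (negPf ab).
  apply: eq_card => -[x y]; rewrite !inE sE !xpair_eqE /=; apply/eqP/idP.
    move=> xy; have : a \in [set x; y] by rewrite xy set21.
    have : b \in [set x; y] by rewrite xy set22.
    rewrite !inE => /orP[] /eqP bE /orP[] /eqP aE; move: ab; rewrite aE bE ?eqxx ?orbT //.
  by case/orP => /andP[/eqP -> /eqP ->] //; rewrite setUC.
rewrite card_family foldrE big_map big_enum /= (eq_bigr (fun=> 2%N)) => [|e _]; last exact: F2.
by rewrite prod_nat_const card_ord.
Qed.

Lemma card_labellings G : #|G| = m ->
  #|[set s : {ffun 'I_m -> {set 'I_n}} | injectiveb s && ([set s e | e : 'I_m] == G)]| = m`!.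
Proof.
move=> Gm; transitivity (#|G| ^_ #|'I_m|)%N; last by rewrite Gm card_ord ffactnn.
rewrite -card_inj_ffuns_on.
apply: eq_card => s; rewrite [LHS]in_set [RHS]in_set andbC; case: injectiveP => inj; rewrite ?andbF ?andbT // ?andbT.
apply/eqP/ffun_onP => [<- e|sG]; first exact: imset_f.
apply/eqP; rewrite eqEcard card_imset // card_ord Gm leqnn andbT.
by apply/subsetP => _ /imsetP[e _ ->]; exact: sG.
Qed.

(** The map from multigraphs to sets of edges: a graph with [m] edges has [m!]
    labellings, and each of its edges has two orientations. *)
Lemma simple_graph_count (Q : pred (emap n m)) (Q' : pred {set {set 'I_n}}) :
  (forall M, pieces (ends M) == set0 -> Q M = Q' (edges M)) ->
  \sum_(M | Q M) simple_wt M = (2 ^ m * m`!)%:R *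
    #|[set G | [&& simple_graph G, Q' G & #|G| == m]]|%:R.
Proof.
move=> QQ.
pose ok G := [&& simple_graph G, Q' G & #|G| == m].
pose sig M : {ffun 'I_m -> {set 'I_n}} := [ffun e => ends M e].
have edgesE M : edges M = [set sig M e | e : 'I_m].
  by apply: eq_imset => e; rewrite ffunE.
have simpleE M : Q M && (pieces (ends M) == set0) = injectiveb (sig M) && ok (edges M).
  apply/andP/andP => [[QM s0]|[/injectiveP inj /and3P[/forallP sG QG _]]].
    have [inj two] := simpleP _ s0; split.
      by apply/injectiveP => e f; rewrite !ffunE; exact: inj.
    rewrite /ok -QQ // QM card_imset // card_ord eqxx !andbT.
    by apply/forallP => x; apply/implyP => /imsetP[e _ ->]; rewrite two.
  have s0 : pieces (ends M) == set0.
    apply/simpleP; split=> [e f ef|e]; first by apply: inj; rewrite !ffunE.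
    by apply/eqP; apply: (implyP (sG _)); exact: imset_f.
  by rewrite s0 QQ.
transitivity (#|[set M | injectiveb (sig M) && ok (edges M)]|%:R : rat).
  rewrite -sum1_card natr_sum [RHS]big_mkcond [LHS]big_mkcond; apply: eq_bigr => M _.
  by rewrite inE -simpleE /simple_wt; case: (Q M); case: (pieces _ == _).
rewrite -natrM; congr (_%:R).
transitivity (\sum_(G | ok G) \sum_(s : {ffun 'I_m -> {set 'I_n}} | injectiveb s && ([set s e | e : 'I_m] == G))
    2 ^ m)%N; last first.
  rewrite mulnC -sum_nat_const [RHS](eq_bigl ok) => [|G]; last by rewrite inE.
  apply: eq_bigr => G /and3P[_ _ /eqP Gm].
  by rewrite sum_nat_cond_const -(card_labellings Gm) mulnC.
rewrite -sum1_card (partition_big edges ok) => [|M]; last by rewrite inE => /andP[].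
apply: eq_bigr => G okG.
rewrite (partition_big sig (fun s => injectiveb s && ([set s e | e : 'I_m] == G))).
  apply: eq_bigr => s /andP[inj /eqP sG].
  rewrite -(card_orientations (s := s)) => [|e].
    rewrite -sum1_card; apply: eq_bigl => M; rewrite !inE.
    apply/andP/forallP => [[_ /eqP <- e]|sM]; first by rewrite ffunE.
    have sME : sig M = s by apply/ffunP => e; rewrite ffunE; apply/eqP.
    by rewrite edgesE sME inj sG okG !eqxx.
  have /and3P[/forallP two _ _] := okG; apply/eqP; apply: (implyP (two _)).
  by rewrite -sG imset_f.
by move=> M; rewrite inE -edgesE => /andP[/andP[-> _] ->].
Qed.

Lemma edges_positive M : pieces (ends M) == set0 -> all_pos M = sg_positive (edges M).
Proof.
move=> /simpleP[inj two]; apply: eq_forallb => v.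
have compE : sg_component (edges M) v = component (ends M) v.
  apply/setP => w; rewrite !inE; apply/idP/idP => vw.
    apply: (connect_closed_ind (Q := fun w => connect (adj (ends M)) v w) vw) => //.
    move=> a b /imsetP[e _ abE] va; apply: connect_trans va (connect1 _).
    by apply/existsP; exists e; rewrite -abE set21 set22.
  apply: (connect_closed_ind (Q := fun w => connect (fun a b => [set a; b] \in edges M) v w) vw) => //.
  move=> a b /existsP[e /andP[ae be]] va; apply: connect_trans va _.
  have [<-|ab] := eqVneq a b; first exact: connect0.
  apply: connect1; rewrite (_ : [set a; b] = ends M e) ?imset_f //.
  apply/eqP; rewrite eqEcard two cards2 ab leqnn andbT.
  by apply/subsetP => x /set2P[] ->.
rewrite /= compE /excess subr_gt0 ltz_nat /posat; congr (_ < _)%N.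
rewrite -(card_imset _ inj); apply: eq_card => x; rewrite [RHS]inE.
apply/imsetP/andP => [[e eC ->]|[/imsetP[e _ ->] sub]].
  by rewrite imset_f //; split=> //; rewrite inE in eC.
by exists e; rewrite // inE.
Qed.

Lemma simple_pos_sum : \sum_(M : emap n m | all_pos M) simple_wt M =
  (2 ^ m * m`!)%:R *
    #|[set G : {set {set 'I_n}} | [&& simple_graph G, sg_positive G & #|G| == m]]|%:R.
Proof. exact: simple_graph_count edges_positive. Qed.

Lemma simple_sum : \sum_(M : emap n m) simple_wt M = (2 ^ m * m`!)%:R * 'C('C(n, 2), m)%:R.
Proof.
rewrite (@simple_graph_count xpredT xpredT) //; congr (_ * _%:R).
rewrite -[n in 'C(n, 2)]card_ord -card_draws -cards_draws; apply: eq_card => G; rewrite !inE.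
congr (_ && _); apply/forallP/subsetP => [h e|h e].
  by rewrite inE; exact: (implyP (h e)).
by apply/implyP => /h; rewrite inE.
Qed.

End Simple.

(** * Patchworks as families of sets of edges *)

Section Patchwork.
Variables (n m : nat).
Implicit Types (M : emap n m) (B : {set 'I_m}) (Q : {set {set 'I_m}}) (P : {set mgraph n m}).

(** A patchwork is determined by its multigraph and the sets of labels of its
    elements: [subgraph M] and [labels] pass from sets of labels to subgraphs
    and back. *)
Definition subgraph M B : mgraph n m :=
  (\bigcup_(e in B) ends M e, [set ((M e, e) : medge n m) | e in B]).
Definition labels (X : mgraph n m) : {set 'I_m} := [set t.2 | t : medge n m in X.2].
Definition subgraphs M Q : {set mgraph n m} := [set subgraph M B | B in Q].
Definition graph_of M : mgraph n m := (setT, [set ((M e, e) : medge n m) | e : 'I_m]).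

Lemma labels_subgraph M B : labels (subgraph M B) = B.
Proof.
apply/setP => e; apply/imsetP/idP => [[t /imsetP[f fB ->] ->] //|eB].
by exists (M e, e) => //; apply: imset_f.
Qed.

Lemma subgraph_inj M : injective (subgraph M).
Proof. by move=> B B' /(congr1 labels); rewrite !labels_subgraph. Qed.

Lemma joins_ends (t : medge n m) v w : joins t v w = ([set t.1.1; t.1.2] == [set v; w]).
Proof.
case: t => -[a b] e; rewrite /joins /= !xpair_eqE; apply/idP/eqP.
  by case/orP => /andP[/eqP -> /eqP ->] //; rewrite setUC.
move=> ab; have /set2P ha : a \in [set v; w] by rewrite -ab set21.
have /set2P hb : b \in [set v; w] by rewrite -ab set22.
have /set2P hv : v \in [set a; b] by rewrite ab set21.
have /set2P hw : w \in [set a; b] by rewrite ab set22.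
by case: ha => ?; case: hb => ?; case: hv => ?; case: hw => ?; subst; rewrite ?eqxx ?orbT.
Qed.

Lemma MG_subgraphs M Q : full (ends M) Q -> MG (subgraphs M Q) = graph_of M.
Proof.
move=> /andP[/eqP cT /spanningP sp]; congr (_, _); apply/setP => x.
  rewrite inE; apply/bigcupP; have [e xe] := sp x.
  have : e \in cover Q by rewrite cT inE.
  case/bigcupP => B BQ eB; exists (subgraph M B); first exact: imset_f.
  by apply/bigcupP; exists e.
apply/bigcupP/imsetP => [[_ /imsetP[B BQ ->] /imsetP[e eB ->]]|[e _ ->]].
  by exists e.
have : e \in cover Q by rewrite cT inE.
case/bigcupP => B BQ eB; exists (subgraph M B); first exact: imset_f.
exact: imset_f.
Qed.

Lemma graph_of_inj M M' : graph_of M = graph_of M' -> M = M'.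
Proof.
case=> /setP MM; apply/ffunP => e; have := MM (M e, e).
by rewrite imset_f // => /esym/imsetP[f _ [-> <-]].
Qed.

Lemma multigraph_graph_of M : multigraph (graph_of M).
Proof.
rewrite /multigraph eqxx /=; apply/forallP => e; apply/cards1P; exists (M e, e).
apply/setP => t; rewrite !inE; apply/andP/eqP => [[/imsetP[f _ ->] /eqP <-] //|->].
by rewrite imset_f.
Qed.

Lemma multigraphP (H : mgraph n m) : multigraph H -> exists M, H = graph_of M.
Proof.
case: H => H1 H2 /andP[/= /eqP -> /forallP one].
have /fin_all_exists[M ME] e : exists p, [set t in H2 | t.2 == e] = [set (p, e)].
  have /cards1P[[p f] pE] := one e; exists p.
  have : (p, f) \in [set t in H2 | t.2 == e] by rewrite pE set11.
  by rewrite in_set /= => /andP[_ /eqP fe]; rewrite pE fe.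
exists (finfun M); congr (_, _); apply/setP => -[p e]; apply/idP/imsetP.
  move=> pe; exists e => //; rewrite ffunE.
  have : (p, e) \in [set t in H2 | t.2 == e] by rewrite inE pe eqxx.
  by rewrite ME => /set1P.
move=> [f _]; rewrite ffunE => -[-> ->].
have : (M f, f) \in [set t in H2 | t.2 == f] by rewrite ME set11.
by rewrite inE => /andP[].
Qed.

Lemma mg_positive_graph_of M : mg_positive (graph_of M) = all_pos M.
Proof.
rewrite /mg_positive /all_pos; apply: eq_forallb => v; rewrite inE /=.
have -> : mg_component (graph_of M) v = component (ends M) v.
  apply/setP => w; rewrite !inE; apply/idP/idP => vw.
    apply: (connect_closed_ind (Q := fun w => connect (adj (ends M)) v w) vw) => //.
    move=> a b /existsP[t /andP[/imsetP[e _ ->]]]; rewrite joins_ends => /eqP abE va.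
    apply: connect_trans va (connect1 _).
    by apply/existsP; exists e; rewrite /ends abE set21 set22.
  apply: (connect_closed_ind (Q := fun w => connect (fun a b => [exists t in (graph_of M).2, joins t a b]) v w) vw) => //.
  move=> a b /existsP[e /andP[ae be]] va; apply: connect_trans va _.
  have [<-|ab] := eqVneq a b; first exact: connect0.
  apply: connect1; apply/existsP; exists (M e, e); rewrite imset_f // joins_ends /=.
  apply/eqP; apply/esym/eqP; rewrite eqEcard.
  apply/andP; split; first by apply/subsetP => x /set2P[] ->.
  by rewrite [X in (_ <= X)%N]cards2 ab cards2; case: eqP.
rewrite /excess subr_gt0 ltz_nat /posat; congr (_ < _)%N.
set C := component _ _.
have gI : injective (fun e => ((M e, e) : medge n m)) by move=> e f [].
rewrite -(card_imset _ gI); apply: eq_card => t; rewrite [LHS]inE.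
apply/andP/imsetP => [[/imsetP[e _ ->] /andP[/= a b]]|[e eC ->]].
  exists e => //; rewrite inE; apply/subsetP => x /set2P[] -> //.
split; first exact: imset_f.
by rewrite inE in eC; rewrite !(subsetP eC) ?fst_ends ?snd_ends.
Qed.

Lemma piece_subgraph M B : piece (ends M) B ->
  is_loop (subgraph M B) || is_double_edge (subgraph M B).
Proof.
case/pieceP => e eB [BE cE].
have SE : \bigcup_(f in B) ends M f = ends M e.
  apply/setP => v; apply/bigcupP/idP => [[f /BE -> //]|ve]; by exists e.
have := cards2 (M e).1 (M e).2; rewrite -/(ends M e) cE; case: eqP => [loop cB|/eqP neq cB].
  have BE1 : B = [set e].
    have /cards1P[f fE] : #|B| == 1%N by rewrite cB.
    by move: eB; rewrite fE => /set1P ->.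
  apply/orP; left; apply/existsP; exists (M e).1; apply/existsP; exists e.
  apply/eqP; rewrite /subgraph SE BE1 imset_set1 {1}/ends -loop setUid; congr (_, [set (_, _)]).
  by rewrite [in LHS](surjective_pairing (M e)) -loop.
have /cards2P[f [g [fg BE2]]] : #|B| == 2%N by rewrite cB.
have [fB gB] : f \in B /\ g \in B by rewrite BE2 set21 set22.
apply/orP; right; apply/existsP; exists (M e).1; apply/existsP; exists (M e).2.
apply/existsP; exists (M f, f); apply/existsP; exists (M g, g).
rewrite neq !joins_ends /= -!/(ends M _) !BE // eqxx.
have -> : ((M f, f) : medge n m) != (M g, g) by rewrite xpair_eqE (negPf fg) andbF.
by rewrite /subgraph SE BE2 imsetU1 imset_set1 eqxx.
Qed.

Lemma subgraph_labels M (X : mgraph n m) :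
  is_loop X || is_double_edge X -> X.2 \subset (graph_of M).2 ->
  X = subgraph M (labels X) /\ piece (ends M) (labels X).
Proof.
move=> XLD /subsetP XM.
have inM t : t \in X.2 -> t = (M t.2, t.2).
  by move=> /XM/imsetP[e _ ->].
case/orP: XLD => [/existsP[v /existsP[e /eqP XE]]|].
  have Me : M e = (v, v).
    by have := inM (v, v, e); rewrite XE set11 /= => /(_ isT)[<-].
  have lX : labels X = [set e] by rewrite /labels XE /= imset_set1.
  have eE : ends M e = [set v] by rewrite /ends Me /= setUid.
  rewrite lX; split; first by rewrite XE /subgraph big_set1 imset_set1 eE Me.
  by apply/pieceP; exists e; rewrite ?set11 //; split=> [f /set1P -> //|]; rewrite eE !cards1.
case/existsP => v /existsP[w /existsP[s /existsP[t /and5P[vw st jsv jtv /eqP XE]]]].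
have sE : s = (M s.2, s.2) by apply: inM; rewrite XE set21.
have tE : t = (M t.2, t.2) by apply: inM; rewrite XE set22.
have lX : labels X = [set s.2; t.2] by rewrite /labels XE /= imsetU1 imset_set1.
have eE : ends M s.2 = [set v; w] by move: jsv; rewrite sE joins_ends => /eqP.
have fE : ends M t.2 = [set v; w] by move: jtv; rewrite tE joins_ends => /eqP.
have neq : s.2 != t.2 by apply: contraNneq st => ee; rewrite sE tE ee.
rewrite lX; split.
  rewrite XE /subgraph bigcup_setU !big_set1 eE fE setUid imsetU1 imset_set1.
  by rewrite -sE -tE.
apply/pieceP; exists s.2; rewrite ?set21 //; split=> [f /set2P[] -> //|].
  by rewrite eE.
by rewrite eE !cards2 vw neq.
Qed.

Definition patch_pair (q : emap n m * {set {set 'I_m}}) :=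
  [&& all_pos q.1, q.2 \subset pieces (ends q.1) & full (ends q.1) q.2].

(** That the edges of all the elements of a patchwork form a multigraph with
    vertices ['I_n] and labels ['I_m] is what [full] says of the family of
    their sets of labels. *)
Lemma patchwork_pairs : [set P | patchwork P && mg_positive (MG P)] =
  [set subgraphs q.1 q.2 | q in [set q | patch_pair q]].
Proof.
apply/setP => P; rewrite inE; apply/andP/imsetP.
  move=> [/andP[/multigraphP[M ME] /forallP LD] pos].
  have PX X : X \in P -> X = subgraph M (labels X) /\ piece (ends M) (labels X).
    move=> XP; apply: subgraph_labels; first exact: (implyP (LD X)).
    by rewrite -ME; exact: (bigcup_sup X).
  have PE : P = subgraphs M [set labels X | X in P].
    rewrite /subgraphs -imset_comp -[LHS]imset_id; apply: eq_in_imset => X XP /=.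
    by have [<-] := PX X XP.
  exists (M, [set labels X | X in P]) => //; rewrite inE; apply/and3P; split=> /=.
  - by rewrite -mg_positive_graph_of -ME.
  - apply/subsetP => _ /imsetP[X XP ->]; rewrite mem_pieces.
    by have [] := PX X XP.
  apply/andP; split.
    apply/eqP/setP => e; rewrite inE; apply/bigcupP.
    have : ((M e, e) : medge n m) \in (MG P).2 by rewrite ME imset_f.
    case/bigcupP => X XP eX; exists (labels X); first exact: imset_f.
    by apply/imsetP; exists (M e, e).
  apply/spanningP => v; have : v \in (MG P).1 by rewrite ME inE.
  case/bigcupP => X XP; have [-> _] := PX X XP.
  by case/bigcupP => e _ ve; exists e.
move=> [[M Q]]; rewrite inE => /and3P[/= pos Qp Qf] ->.
rewrite /patchwork MG_subgraphs // multigraph_graph_of mg_positive_graph_of; split=> //=.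
apply/forallP => X; apply/implyP => /imsetP[B BQ ->].
by apply: (@piece_subgraph M); rewrite -mem_pieces; exact: (subsetP Qp).
Qed.

Lemma sum_patchworks (R : nmodType) (F : nat -> R) :
  \sum_(P : {set mgraph n m} | patchwork P && mg_positive (MG P)) F #|P| =
  \sum_(M : emap n m | all_pos M)
    \sum_(Q : {set {set 'I_m}} | (Q \subset pieces (ends M)) && full (ends M) Q) F #|Q|.
Proof.
transitivity (\sum_(P in [set P : {set mgraph n m} | patchwork P && mg_positive (MG P)]) F #|P|).
  by apply: eq_bigl => P; rewrite inE.
rewrite patchwork_pairs big_imset /=; last first.
  move=> [M Q] [M' Q']; rewrite !inE => /and3P[/= _ _ f] /and3P[/= _ _ f'] QQ.
  have MM : M = M' by apply: graph_of_inj; rewrite -(MG_subgraphs f) -(MG_subgraphs f') QQ.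
  rewrite -MM in QQ *; congr (_, _).
  exact: (imset_inj (@subgraph_inj M) QQ).
rewrite pair_big_dep /=; apply: eq_big => [[M Q]|[M Q] _] /=.
  by rewrite inE.
by rewrite /subgraphs card_imset //; exact: subgraph_inj.
Qed.

End Patchwork.

(** * Formal power series *)

Section FpsRing.
Context {R : comNzRingType}.
Implicit Types (f g h : {fps R}) (p q : {poly R}).

Lemma fps_coefD f g n : (f + g) n = f n + g n. Proof. by []. Qed.
Lemma fps_coefN f n : (- f) n = - f n. Proof. by []. Qed.
Lemma fps_coefB f g n : (f - g) n = f n - g n. Proof. by []. Qed.
Lemma fps_coefZ c f n : (c *: f) n = c * f n. Proof. by []. Qed.
Lemma fps_coef1 n : (1 : {fps R}) n = (n == 0%N)%:R.
Proof. by case: n. Qed.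
Lemma fps_coefM f g n : (f * g) n = \sum_(i < n.+1) f i * g (n - i)%N.
Proof. by []. Qed.
Lemma fps_coefX n : (fpsX : {fps R}) n = (n == 1%N)%:R. Proof. by []. Qed.
Lemma fps_coefC (c : R) n : fpsC c n = if n is 0 then c else 0.
Proof. by []. Qed.
Lemma fps_coef_sum (I : Type) (r : seq I) (P : pred I) (F : I -> {fps R}) n :
  (\sum_(i <- r | P i) F i) n = \sum_(i <- r | P i) F i n.
Proof. exact: (big_morph (fun f : {fps R} => f n)). Qed.
Lemma fps_coefMn f k n : (f *+ k) n = f n *+ k.
Proof. by elim: k => [|k IH] //; rewrite !mulrS fps_coefD IH. Qed.

Lemma fps_coefM0 f g : (f * g) 0%N = f 0%N * g 0%N.
Proof. by rewrite fps_coefM big_ord_recl big_ord0 addr0. Qed.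

Lemma fps_coefE0 f k : (f ^+ k) 0%N = f 0%N ^+ k.
Proof. by elim: k => [|k IH] //; rewrite !exprS fps_coefM0 IH. Qed.

Fact fpsC_is_zmod_morphism : zmod_morphism (@fpsC R).
Proof. by move=> a b; apply/fpsP => -[|n] //=; rewrite subr0. Qed.
Fact fpsC_is_monoid_morphism : monoid_morphism (@fpsC R).
Proof.
split=> // a b; apply/fpsP => n; rewrite -[RHS]/(fps_mul (fpsC a) (fpsC b) n).
by rewrite fps_mulCl; case: n => //= n; rewrite mulr0.
Qed.
HB.instance Definition _ := GRing.isZmodMorphism.Build R {fps R} fpsC
  fpsC_is_zmod_morphism.
HB.instance Definition _ := GRing.isMonoidMorphism.Build R {fps R} fpsC
  fpsC_is_monoid_morphism.

Lemma fps_mulC_coef (c : R) f n : (fpsC c * f) n = c * f n.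
Proof. exact: fps_mulCl. Qed.

Lemma fps_scaleE (c : R) f : c *: f = fpsC c * f.
Proof. by apply/fpsP => n; rewrite fps_mulC_coef. Qed.

Lemma fps_mulX_coef f n : (fpsX * f) n = if n is n'.+1 then f n' else 0.
Proof.
rewrite fps_coefM; case: n => [|n].
  by rewrite big_ord_recl big_ord0 fps_coefX mul0r addr0.
rewrite big_ord_recl fps_coefX mul0r add0r big_ord_recl fps_coefX mul1r.
rewrite big1 ?addr0; first by rewrite subSS subn0.
by move=> i _; rewrite fps_coefX /= mul0r.
Qed.

Lemma fps_mulXn_coef f k n :
  (fpsX ^+ k * f) n = if (k <= n)%N then f (n - k)%N else 0.
Proof.
elim: k n => [|k IH] n; first by rewrite mul1r subn0.
by rewrite exprS -mulrA fps_mulX_coef; case: n => [|n] //; rewrite IH.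
Qed.

Lemma fps_Xn_coef k n : ((fpsX : {fps R}) ^+ k) n = (n == k)%:R.
Proof.
rewrite -[_ ^+ k]mulr1 fps_mulXn_coef fps_coef1.
by case: (ltngtP k n) => [kn|//|->]; rewrite ?subnn // subn_eq0 leqNgt kn.
Qed.

Lemma fps_cX0 (c : R) : (fpsX * fpsC c : {fps R}) 0%N = 0.
Proof. by rewrite fps_mulX_coef. Qed.

Lemma sum_ord_widen (V : nmodType) (F : nat -> V) a b : (a <= b)%N ->
  (forall i, (a <= i < b)%N -> F i = 0) -> \sum_(i < a) F i = \sum_(i < b) F i.
Proof.
move=> ab F0; rewrite (big_ord_widen b F ab) big_mkcond /=.
apply: eq_bigr => i _; case: ifP => // /negbT; rewrite -leqNgt => ai.
by rewrite F0 // ai ltn_ord.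
Qed.

Lemma fps_comp_coef f g N n : g 0%N = 0 -> (n < N)%N ->
  (f \oF g) n = \sum_(i < N) f i * (g ^+ i) n.
Proof.
move=> g0 nN; apply: (sum_ord_widen (F := fun i => f i * (g ^+ i) n)) => // i.
by case/andP=> ni _; rewrite fps_expr_low ?mulr0.
Qed.

Lemma fps_comp_coef0 f g : (f \oF g) 0%N = f 0%N.
Proof. by rewrite /= big_ord_recl big_ord0 addr0 expr0 mulr1. Qed.

Lemma fps_comp_poly p g : g 0%N = 0 ->
  fps_of_poly p \oF g = (map_poly fpsC p).[g].
Proof.
move=> g0; apply/fpsP => n.
rewrite (@horner_coef_wide _ (maxn (size p) n.+1)); last first.
  by rewrite (leq_trans (size_poly _ _)) // leq_maxl.
rewrite fps_coef_sum (fps_comp_coef _ g0 (leq_maxr (size p) n.+1)).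
by apply: eq_bigr => i _; rewrite coef_map fps_mulC_coef.
Qed.

Lemma fps_of_polyM p q : fps_of_poly (p * q) = fps_of_poly p * fps_of_poly q.
Proof. by apply/fpsP => n; rewrite /= coefM. Qed.
Lemma fps_of_polyD p q : fps_of_poly (p + q) = fps_of_poly p + fps_of_poly q.
Proof. by apply/fpsP => n; rewrite /= coefD. Qed.
Lemma fps_of_polyC (c : R) : fps_of_poly c%:P = fpsC c.
Proof. by apply/fpsP => -[|n]; rewrite /= coefC. Qed.
Lemma fps_of_polyX : fps_of_poly ('X : {poly R}) = fpsX.
Proof. by apply/fpsP => n; rewrite /= coefX. Qed.

Lemma fps_comp_eqN N f f' g n : (forall i, (i < N)%N -> f i = f' i) ->
  (n < N)%N -> (f \oF g) n = (f' \oF g) n.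
Proof.
move=> ff nN; apply: eq_bigr => i _; rewrite ff //.
by rewrite (leq_trans (ltn_ord i)).
Qed.

Lemma fps_mul_eqN N f f' g g' n : (forall i, (i < N)%N -> f i = f' i) ->
  (forall i, (i < N)%N -> g i = g' i) -> (n < N)%N -> (f * g) n = (f' * g') n.
Proof.
move=> ff gg nN; apply: eq_bigr => i _; rewrite ff ?gg //.
  by rewrite (leq_ltn_trans _ nN) ?leq_subr.
by rewrite (leq_trans (ltn_ord i)).
Qed.

Lemma fps_truncE N f i : (i < N)%N -> fps_of_poly (fps_trunc N f) i = f i.
Proof. by move=> iN; rewrite /= coef_poly iN. Qed.

Lemma fps_compD f f' g : (f + f') \oF g = (f \oF g) + (f' \oF g).
Proof.
apply/fpsP => n; rewrite fps_coefD /= -big_split /=.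
by apply: eq_bigr => i _; rewrite mulrDl.
Qed.
Lemma fps_compN f g : (- f) \oF g = - (f \oF g).
Proof. by apply/fpsP => n /=; rewrite -sumrN; apply: eq_bigr => i _; rewrite mulNr. Qed.
Lemma fps_compB f f' g : (f - f') \oF g = (f \oF g) - (f' \oF g).
Proof. by rewrite fps_compD fps_compN. Qed.
Lemma fps_comp0 g : 0 \oF g = 0.
Proof. by rewrite -(subrr 0) fps_compB !subrr. Qed.
Lemma fps_compC (c : R) g : fpsC c \oF g = fpsC c.
Proof.
apply/fpsP => n; rewrite /= big_ord_recl expr0 fps_coef1 big1 ?addr0.
  by case: n => [|n] /=; rewrite ?mulr1 ?mulr0.
by move=> i _ /=; rewrite mul0r.
Qed.
Lemma fps_comp1 g : 1 \oF g = 1. Proof. exact: fps_compC. Qed.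
Lemma fps_compX g : g 0%N = 0 -> fpsX \oF g = g.
Proof.
move=> g0; apply/fpsP => n; rewrite (fps_comp_coef _ g0 (leqnSn n.+1)).
rewrite big_ord_recl fps_coefX mul0r add0r big_ord_recl fps_coefX mul1r big1 ?addr0 //.
by move=> i _; rewrite fps_coefX mul0r.
Qed.
Lemma fps_comp_idr f : f \oF fpsX = f.
Proof.
apply/fpsP => n /=; rewrite (bigD1 ord_max) //= big1 ?addr0 ?fps_Xn_coef ?eqxx ?mulr1 //.
by move=> i; rewrite -val_eqE /= eq_sym => /negPf ni; rewrite fps_Xn_coef ni mulr0.
Qed.

(** A coefficient of a composition only depends on a truncation of the outer
    series, and for polynomials composition is evaluation, which is a ring
    morphism. *)
Lemma fps_compM f f' g : g 0%N = 0 -> (f * f') \oF g = (f \oF g) * (f' \oF g).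
Proof.
move=> g0; apply/fpsP => n.
pose p := fps_trunc n.+1 f; pose p' := fps_trunc n.+1 f'.
rewrite (@fps_comp_eqN n.+1 _ (fps_of_poly (p * p'))) //; last first.
  move=> i iN; rewrite fps_of_polyM.
  by apply: (@fps_mul_eqN n.+1) => // j jN; rewrite fps_truncE.
rewrite fps_comp_poly // rmorphM hornerM -!fps_comp_poly //.
by apply: (@fps_mul_eqN n.+1) => // j jN; apply: (@fps_comp_eqN n.+1) => // i iN;
  rewrite fps_truncE.
Qed.

Lemma fps_compE f g k : g 0%N = 0 -> (f ^+ k) \oF g = (f \oF g) ^+ k.
Proof.
by move=> g0; elim: k => [|k IH]; rewrite ?fps_comp1 // !exprS fps_compM // IH.
Qed.
Lemma fps_compZ (c : R) f g : (c *: f) \oF g = c *: (f \oF g).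
Proof.
by apply/fpsP => n /=; rewrite mulr_sumr; apply: eq_bigr => i _; rewrite mulrA.
Qed.
Lemma fps_comp_sum (I : Type) (r : seq I) (P : pred I) (F : I -> {fps R}) g :
  (\sum_(i <- r | P i) F i) \oF g = \sum_(i <- r | P i) (F i \oF g).
Proof.
apply: (big_morph (fun f => f \oF g)); last exact: fps_comp0.
by move=> ? ?; rewrite fps_compD.
Qed.

(** For a truncated [f], this is the multiplicativity of the composition with
    [h]. *)
Lemma fps_compA f g h : g 0%N = 0 -> h 0%N = 0 ->
  (f \oF g) \oF h = f \oF (g \oF h).
Proof.
move=> g0 h0; apply/fpsP => n.
have gh0 : (g \oF h) 0%N = 0 by rewrite fps_comp_coef0.
rewrite (@fps_comp_eqN n.+1 _ (\sum_(i < n.+1) f i *: g ^+ i)) //; last first.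
  by move=> i iN; rewrite fps_coef_sum; apply: fps_comp_coef.
rewrite fps_comp_sum fps_coef_sum; apply: eq_bigr => i _.
by rewrite fps_compZ fps_compE.
Qed.

End FpsRing.

Section FpsMap.
Context {R S : comNzRingType} (h : {rmorphism R -> S}).

Fact fps_map_is_zmod_morphism : zmod_morphism (fps_map h).
Proof. by move=> f g; apply/fpsP => n /=; rewrite rmorphB. Qed.
Fact fps_map_is_monoid_morphism : monoid_morphism (fps_map h).
Proof.
split=> [|f g]; apply/fpsP => n /=; first by case: n => [|n]; rewrite /= ?rmorph1 ?rmorph0.
by rewrite rmorph_sum; apply: eq_bigr => i _; rewrite rmorphM.
Qed.
HB.instance Definition _ := GRing.isZmodMorphism.Build {fps R} {fps S} (fps_map h)
  fps_map_is_zmod_morphism.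
HB.instance Definition _ := GRing.isMonoidMorphism.Build {fps R} {fps S} (fps_map h)
  fps_map_is_monoid_morphism.

Lemma fps_map_comp f g : fps_map h (f \oF g) = fps_map h f \oF fps_map h g.
Proof.
apply/fpsP => n /=; rewrite rmorph_sum; apply: eq_bigr => i _.
by rewrite rmorphM -rmorphXn.
Qed.

Lemma fps_mapX : fps_map h fpsX = fpsX.
Proof. by apply/fpsP => n /=; rewrite rmorph_nat. Qed.

Lemma fps_mapC c : fps_map h (fpsC c) = fpsC (h c).
Proof. by apply/fpsP => -[|n] //=; rewrite rmorph0. Qed.

End FpsMap.

Section FpsUnit.
Context {R : comUnitRingType}.
Implicit Types f g : {fps R}.

Lemma fps_unitE f : (f \is a GRing.unit) = (f 0%N \is a GRing.unit).
Proof. by []. Qed.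

Lemma fps_unit1 f : f 0%N = 1 -> f \is a GRing.unit.
Proof. by move=> f1; rewrite fps_unitE f1 unitr1. Qed.

Lemma fps_inv_coef0 f : f 0%N = 1 -> f^-1 0%N = 1.
Proof.
move=> f1; have /fpsP/(_ 0%N) := mulVr (fps_unit1 f1).
by rewrite fps_coefM0 f1 mulr1.
Qed.

End FpsUnit.

(** * Derivations *)

Section Deriv.
Context {R : comNzRingType}.
Implicit Types (f g h : {fps R}).

Definition fps_deriv f : {fps R} := Fps (fun n => f n.+1 *+ n.+1).

Lemma fps_derivE f n : fps_deriv f n = f n.+1 *+ n.+1. Proof. by []. Qed.

Lemma fps_derivD f g : fps_deriv (f + g) = fps_deriv f + fps_deriv g.
Proof. by apply/fpsP => n /=; rewrite mulrnDl. Qed.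
Lemma fps_derivN f : fps_deriv (- f) = - fps_deriv f.
Proof. by apply/fpsP => n /=; rewrite mulNrn. Qed.
Lemma fps_deriv_sum (I : Type) (r : seq I) (P : pred I) (F : I -> {fps R}) :
  fps_deriv (\sum_(i <- r | P i) F i) = \sum_(i <- r | P i) fps_deriv (F i).
Proof.
apply: (big_morph fps_deriv fps_derivD).
by apply/fpsP => n /=; rewrite mul0rn.
Qed.
Lemma fps_derivC (c : R) : fps_deriv (fpsC c) = 0.
Proof. by apply/fpsP => n /=; rewrite mul0rn. Qed.
Lemma fps_derivX : fps_deriv fpsX = 1.
Proof. by apply/fpsP => -[|n] /=; rewrite ?mulr1n // mul0rn. Qed.
Lemma fps_derivZ (c : R) f : fps_deriv (c *: f) = c *: fps_deriv f.
Proof. by apply/fpsP => n /=; rewrite mulrnAr. Qed.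

Lemma fps_derivM f g :
  fps_deriv (f * g) = fps_deriv f * g + f * fps_deriv g.
Proof.
apply/fpsP => n; rewrite fps_derivE.
rewrite [(f * g) _](@fps_mul_trunc _ n.+2) // -coef_deriv derivM coefD.
have tE h j : (j <= n)%N -> (fps_trunc n.+2 h)`_j = h j.
  by move=> jn; rewrite coef_poly ltnS (leqW jn).
have dE h j : (j <= n)%N -> (fps_trunc n.+2 h)^`()`_j = fps_deriv h j.
  by move=> jn; rewrite coef_deriv coef_poly !ltnS jn.
rewrite fps_coefD !coefM; congr (_ + _); apply: eq_bigr => i _;
  by rewrite tE ?dE ?leq_subr // -ltnS.
Qed.

Lemma fps_deriv_expr f n :
  fps_deriv (f ^+ n.+1) = n.+1%:R * (f ^+ n * fps_deriv f).
Proof.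
elim: n => [|n IH]; first by rewrite !mul1r.
by rewrite exprS fps_derivM IH !exprS; ring.
Qed.

Lemma fps_deriv_comp f g : g 0%N = 0 ->
  fps_deriv (f \oF g) = (fps_deriv f \oF g) * fps_deriv g.
Proof.
move=> g0; apply/fpsP => n; rewrite fps_derivE.
have -> : (f \oF g) n.+1 = (\sum_(i < n.+2) f i *: g ^+ i) n.+1.
  by rewrite fps_coef_sum; apply: fps_comp_coef.
rewrite -fps_derivE fps_deriv_sum big_ord_recl fps_derivZ.
rewrite (_ : fps_deriv 1 = 0) ?scaler0 ?add0r; last exact: fps_derivC.
rewrite (@fps_mul_eqN _ n.+1 _ (\sum_(i < n.+1) fps_deriv f i *: g ^+ i) _ (fps_deriv g)) //.
  rewrite mulr_suml !fps_coef_sum; apply: eq_bigr => i _.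
  rewrite fps_derivZ fps_deriv_expr -scalerAl !fps_coefZ fps_derivE lift0.
  by rewrite mulr_natl fps_coefMn mulrnAl mulrnAr.
by move=> i iN; rewrite fps_coef_sum; apply: fps_comp_coef.
Qed.

End Deriv.

(** * Exponentials and powers *)

(** Over any ring with a morphism [io] from the rationals, so that the results
    apply to series in one variable and to iterated series. *)
Section Exp.
Context {R : comNzRingType} (io : {rmorphism rat -> R}).
Implicit Types (F G : {fps R}).

Lemma mulrSn_inj n (a b : R) : a *+ n.+1 = b *+ n.+1 -> a = b.
Proof.
move=> ab; have E (c : R) : c = io n.+1%:R^-1 * (c *+ n.+1).
  rewrite -[c *+ _]mulr_natl mulrA -(rmorph_nat io) -rmorphM mulVf ?pnatr_eq0 //.
  by rewrite rmorph1 mul1r.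
by rewrite (E a) (E b) ab.
Qed.

(** A linear differential equation of order 1 determines each coefficient from
    the previous ones. *)
Lemma fps_ode_uniq c F G : fps_deriv F = c * F -> fps_deriv G = c * G ->
  F 0%N = G 0%N -> F = G.
Proof.
move=> dF dG FG0; apply/fpsP => n.
elim/ltn_ind: n => -[|n] IH //; apply: (@mulrSn_inj n).
rewrite -!fps_derivE dF dG; apply: (@fps_mul_eqN _ n.+1) => // i; exact: IH.
Qed.

Definition exps F : {fps R} := fps_map io fps_exp \oF F.

Lemma exps_coef0 F : exps F 0%N = 1.
Proof. by rewrite /exps fps_comp_coef0 /= invr1 rmorph1. Qed.

Lemma exps0 : exps 0 = 1.
Proof.
apply/fpsP => n; rewrite /exps /= big_ord_recl invr1 rmorph1 mul1r big1 ?addr0 //.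
by move=> i _; rewrite expr0n mulr0.
Qed.

Lemma fps_deriv_fexp : fps_deriv (fps_map io fps_exp) = fps_map io fps_exp.
Proof.
apply/fpsP => n; rewrite fps_derivE /= -rmorphMn; congr (io _).
rewrite factS natrM invfM -mulr_natl mulrA divff ?mul1r //.
by rewrite pnatr_eq0.
Qed.

Lemma fps_deriv_exps F : F 0%N = 0 -> fps_deriv (exps F) = fps_deriv F * exps F.
Proof. by move=> F0; rewrite /exps fps_deriv_comp // fps_deriv_fexp mulrC. Qed.

Lemma expsD F G : F 0%N = 0 -> G 0%N = 0 -> exps (F + G) = exps F * exps G.
Proof.
move=> F0 G0; apply: (@fps_ode_uniq (fps_deriv F + fps_deriv G)).
- by rewrite fps_deriv_exps ?fps_coefD ?F0 ?G0 ?addr0 // fps_derivD.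
- by rewrite fps_derivM !fps_deriv_exps //; ring.
- by rewrite fps_coefM0 !exps_coef0 mulr1.
Qed.

Lemma expsMn F n : F 0%N = 0 -> exps (F *+ n) = exps F ^+ n.
Proof.
move=> F0; elim: n => [|n IH]; first by rewrite exps0.
by rewrite mulrS expsD ?IH ?exprS // fps_coefMn F0 mul0rn.
Qed.

Lemma expsNr F : F 0%N = 0 -> exps (- F) * exps F = 1.
Proof. by move=> F0; rewrite -expsD ?addNr ?exps0 // fps_coefN F0 oppr0. Qed.

Lemma fps_comp_cX (f : {fps R}) c n : (f \oF (fpsX * fpsC c)) n = f n * c ^+ n.
Proof.
rewrite /= (bigD1 ord_max) //= big1 ?addr0 => [|i].
  by rewrite exprMn -rmorphXn fps_mulXn_coef leqnn subnn.
rewrite -val_eqE /= exprMn -rmorphXn fps_mulXn_coef => ni.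
have ltin := ltn_ord i; have -> : (i <= n)%N by rewrite -ltnS.
have : (0 < n - i)%N by move: ni ltin; lia.
by rewrite fps_coefC; case: (n - i)%N => // m _; rewrite mulr0.
Qed.

Lemma exps_cX c n : exps (fpsX * fpsC c) n = io (n`!%:R)^-1 * c ^+ n.
Proof. by rewrite /exps fps_comp_cX. Qed.

Lemma exps_comp F G : F 0%N = 0 -> G 0%N = 0 -> exps F \oF G = exps (F \oF G).
Proof. by move=> F0 G0; rewrite /exps fps_compA. Qed.

Definition pows F (a : rat) : {fps R} := fps_map io (fps_binom a) \oF (F - 1).

Lemma pows_coef0 F a : pows F a 0%N = 1.
Proof. by rewrite /pows fps_comp_coef0 /= big_ord0 mul1r invr1 rmorph1. Qed.

End Exp.

Lemma expFE F : expF F = exps (@fpsC rat) F. Proof. by []. Qed.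
Lemma exp_idE (F : {fps rat}) : fps_exp \oF F = exps idfun F. Proof. by []. Qed.
Lemma powFE F a : powF F a = pows (@fpsC rat) F a. Proof. by []. Qed.
Lemma pows_idE (F : {fps rat}) a : fps_binom a \oF (F - 1) = pows idfun F a.
Proof. by []. Qed.

Section Binom.

(** This equation determines the binomial series up to a constant, and
    [fps_binomD] follows from it. *)
Lemma fps_deriv_binom a :
  fps_deriv (fps_binom a) * (1 + fpsX) = a *: fps_binom a.
Proof.
apply/fpsP => n; rewrite mulrDr mulr1 fps_coefD mulrC fps_mulX_coef fps_coefZ.
have E m : fps_deriv (fps_binom a) m = (a - m%:R) * fps_binom a m.
  rewrite fps_derivE /= big_ord_recr /= factS natrM -[LHS]mulr_natr.
  have n0 : m.+1%:R != 0 :> rat by rewrite pnatr_eq0.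
  have f0 : m`!%:R != 0 :> rat by rewrite pnatr_eq0 -lt0n fact_gt0.
  by move: m.+1%:R m`!%:R n0 f0 => u v u0 v0; field; rewrite u0 v0.
rewrite E; case: n => [|n]; first by rewrite subr0 addr0.
by rewrite fps_derivE -mulr_natr; ring.
Qed.

Lemma fps_binomD a b : fps_binom (a + b) = fps_binom a * fps_binom b.
Proof.
have U : (1 + fpsX : {fps rat}) \is a GRing.unit.
  by apply: fps_unit1; rewrite fps_coefD fps_coefX addr0.
have E c : fps_deriv (fps_binom c) = (c *: (1 + fpsX)^-1) * fps_binom c.
  by rewrite -scalerAl mulrC scalerAl -fps_deriv_binom mulrK.
apply: (@fps_ode_uniq _ idfun ((a + b) *: (1 + fpsX)^-1)); first exact: E.
  by rewrite fps_derivM !E !fps_scaleE rmorphD /=; ring.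
by rewrite fps_coefM0 /= !big_ord0 !mul1r.
Qed.

Lemma fps_binom0 : fps_binom 0 = 1.
Proof.
apply/fpsP => -[|n] /=; first by rewrite big_ord0 mul1r.
by rewrite big_ord_recl subrr !mul0r.
Qed.

Lemma fps_binom1 : fps_binom 1 = 1 + fpsX.
Proof.
apply/fpsP => -[|[|n]]; rewrite fps_coefD fps_coefX fps_coef1 /=.
- by rewrite big_ord0 mul1r addr0.
- by rewrite big_ord1 subr0 mul1r add0r.
- by rewrite !big_ord_recl /= subrr mul0r mulr0 mul0r addr0.
Qed.

End Binom.

Section Pow.
Context {R : comUnitRingType} (io : {rmorphism rat -> R}).
Implicit Types (F G : {fps R}).
Local Notation pows := (pows io).

Lemma sub1_coef0 F : F 0%N = 1 -> (F - 1) 0%N = 0.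
Proof. by move=> F1; rewrite fps_coefB F1 subrr. Qed.

Lemma powsD F a b : F 0%N = 1 -> pows F (a + b) = pows F a * pows F b.
Proof.
move=> F1; rewrite /pows fps_binomD rmorphM fps_compM //; exact: sub1_coef0.
Qed.

Lemma pows0 F : pows F 0 = 1.
Proof. by rewrite /pows fps_binom0 rmorph1 fps_comp1. Qed.

Lemma pows1 F : F 0%N = 1 -> pows F 1 = F.
Proof.
move=> F1; rewrite /pows fps_binom1 rmorphD rmorph1 /= fps_mapX fps_compD fps_comp1.
by rewrite fps_compX ?sub1_coef0 // addrC subrK.
Qed.

Lemma pows_nat F n : F 0%N = 1 -> pows F n%:R = F ^+ n.
Proof.
move=> F1; elim: n => [|n IH]; first by rewrite pows0.
by rewrite -natr1 powsD // IH pows1 // exprSr.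
Qed.

Lemma powsN F a : F 0%N = 1 -> pows F (- a) = (pows F a)^-1.
Proof.
move=> F1; have U : pows F a \is a GRing.unit by rewrite fps_unit1 ?pows_coef0.
by apply: (mulrI U); rewrite divrr // -powsD // subrr pows0.
Qed.

(** Square roots with constant coefficient 1 are unique, because the sum of
    two of them is invertible. *)
Lemma fps_sqr_inj F G : F 0%N = 1 -> G 0%N = 1 -> F ^+ 2 = G ^+ 2 -> F = G.
Proof.
move=> F1 G1 FG; have U : F + G \is a GRing.unit.
  rewrite fps_unitE fps_coefD F1 G1 -(rmorph1 io) -rmorphD.
  by apply: rmorph_unit; rewrite unitfE.
by apply: subr0_eq; apply: (mulIr U); rewrite mul0r -subr_sqr FG subrr.
Qed.

Lemma pows_sqr F a : F 0%N = 1 -> pows F a ^+ 2 = pows F (a *+ 2).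
Proof. by move=> F1; rewrite mulr2n powsD // expr2. Qed.

End Pow.

(* From here on, these series are handled by their equations and their constant
   coefficients. *)
#[global] Opaque exps pows.

(** * The tree function *)

Notation exp1 := (exps idfun).

Lemma factr_neq0 n : n`!%:R != 0 :> rat.
Proof. by rewrite pnatr_eq0 -lt0n fact_gt0. Qed.

Lemma exE : ex = exp1 fpsX.
Proof. by apply/fpsP => n; rewrite -[fpsX]mulr1 exps_cX expr1n mulr1. Qed.

Lemma ex_coef0 : ex 0%N = 1. Proof. by rewrite exE exps_coef0. Qed.

Lemma exXn c : ex ^+ c = exp1 (fpsX * fpsC c%:R).
Proof. by rewrite exE -expsMn ?fps_coefX // rmorph_nat mulr_natr. Qed.

Lemma exXn_coef c n : (ex ^+ c) n = c%:R ^+ n / n`!%:R.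
Proof. by rewrite exXn exps_cX mulrC. Qed.

Lemma binom_fact n i : (i <= n)%N ->
  'C(n, i)%:R / n`!%:R = (i`!%:R)^-1 * ((n - i)`!%:R)^-1 :> rat.
Proof.
move=> ni; rewrite -(bin_fact ni) !natrM.
have := factr_neq0 i; have := factr_neq0 (n - i).
have : 'C(n, i)%:R != 0 :> rat by rewrite pnatr_eq0 -lt0n bin_gt0.
by move=> c0 a0 b0; field; rewrite a0 b0 c0.
Qed.

(** The [s]-th finite difference kills polynomials of degree less than [s]:
    it is the coefficient of degree [k] in [(e^x - 1)^s]. *)
Lemma finite_difference s k : (k < s)%N ->
  \sum_(i < s.+1) (-1) ^+ (s - i) * 'C(s, i)%:R * i%:R ^+ k = 0 :> rat.
Proof.
move=> ks; have : ((ex - 1) ^+ s) k = 0.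
  by apply: fps_expr_low => //; rewrite fps_coefB ex_coef0 subrr.
rewrite addrC exprDn fps_coef_sum => E.
apply: (mulIf (x := (k`!%:R)^-1)); first by rewrite invr_eq0 factr_neq0.
rewrite mul0r -[RHS]E mulr_suml; apply: eq_bigr => i _.
have -> : (-1 : {fps rat}) ^+ (s - i) = fpsC ((-1) ^+ (s - i)).
  by rewrite rmorphXn rmorphN1.
by rewrite fps_coefMn fps_mulC_coef exXn_coef -mulr_natr; ring.
Qed.

(** The inverse of the tree function for the composition. *)
Definition tree_inv : {fps rat} := fpsX * exp1 (- fpsX).

Lemma tree_inv0 : tree_inv 0%N = 0.
Proof. by rewrite /tree_inv fps_mulX_coef. Qed.

Lemma tree_inv_exprE i n : (tree_inv ^+ i) n =
  if (i <= n)%N then (- i%:R) ^+ (n - i) / (n - i)`!%:R else 0.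
Proof.
rewrite exprMn -expsMn ?fps_coefN ?fps_coefX ?oppr0 // fps_mulXn_coef.
rewrite (_ : - fpsX *+ i = fpsX * fpsC (- i%:R)) ?exps_cX //.
  by case: ifP => // _; rewrite mulrC.
by rewrite rmorphN rmorph_nat mulNrn mulrN mulr_natr.
Qed.

Lemma treegf0 : treegf 0%N = 0. Proof. by []. Qed.

(** The coefficient of degree [s + 1] is, up to a factor, an [(s + 1)]-th finite
    difference of the power [i^s]. *)
Lemma treegf_tree_inv : treegf \oF tree_inv = fpsX.
Proof.
apply/fpsP => s; rewrite fps_coefX.
rewrite (_ : (_ \oF _) s = \sum_(i < s.+1) treegf i * (tree_inv ^+ i) s) //.
rewrite big_ord_recl treegf0 mul0r add0r.
case: s => [|s]; first by rewrite big_ord0.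
have FD := finite_difference (leqnn s.+1).
have E : \sum_(i < s.+1) (-1) ^+ (s.+1 - lift ord0 i) *
    'C(s.+1, lift ord0 i)%:R * (lift ord0 i)%:R ^+ s = (s.+1)`!%:R * \sum_(i < s.+1) treegf (lift ord0 i) * (tree_inv ^+ lift ord0 i) s.+1.
  rewrite mulr_sumr; apply: eq_bigr => i _; rewrite lift0 tree_inv_exprE ltn_ord.
  have := binom_fact (ltn_ord i).
  move/(congr1 (fun a => (s.+1)`!%:R * a)); rewrite mulrC divfK ?factr_neq0 // => ->.
  rewrite /= natrX -(mulN1r i.+1%:R) exprMn subSS.
  have -> : i.+1%:R ^+ s = i.+1%:R ^+ (s - i) * i.+1%:R ^+ i :> rat.
    by rewrite -exprD subnK // -ltnS.
  by ring.
move: FD; rewrite [X in X = _ -> _]big_ord_recl E bin0 subn0 mulr1 addrC => /eqP.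
case: s {E} => [|s]; first by rewrite expr0 mulr1 mul1r expr1 subr_eq0 => /eqP.
by rewrite expr0n mulr0 addr0 mulf_eq0 (negPf (factr_neq0 _)) => /eqP.
Qed.

Lemma fps_comp_eq0 (R : comNzRingType) (f g : {fps R}) :
  g 0%N = 0 -> (forall n, (g ^+ n) n = 1) -> f \oF g = 0 -> f = 0.
Proof.
move=> g0 g1 /fpsP fg; apply/fpsP => n; elim/ltn_ind: n => n IH.
move: (fg n); rewrite /= big_ord_recr /= g1 mulr1 big1 ?add0r // => i _.
by rewrite IH // mul0r.
Qed.

(** A left inverse is a right inverse, because composition with [tree_inv] is
    injective. *)
Lemma tree_inv_treegf : tree_inv \oF treegf = fpsX.
Proof.
apply: subr0_eq; apply: (@fps_comp_eq0 _ _ tree_inv tree_inv0) => [n|].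
  by rewrite tree_inv_exprE leqnn subnn invr1 mulr1.
rewrite fps_compB fps_compA ?treegf0 ?tree_inv0 // treegf_tree_inv.
by rewrite fps_comp_idr fps_compX ?tree_inv0 // subrr.
Qed.

(** * Series in two variables *)

Notation fps2 := {fps {fps rat}}.
Notation exp2 := (exps (@fpsC rat)).
Notation onehalf := (2^-1 : rat).

Lemma liftz_comp f g : liftz (f \oF g) = liftz f \oF liftz g.
Proof. exact: (fps_map_comp (@fpsC rat)). Qed.
Lemma liftzM f g : liftz (f * g) = liftz f * liftz g.
Proof. exact: (rmorphM (fps_map (@fpsC rat))). Qed.
Lemma liftzN f : liftz (- f) = - liftz f.
Proof. exact: (rmorphN (fps_map (@fpsC rat))). Qed.
Lemma liftzX : liftz fpsX = fpsX.
Proof. exact: (fps_mapX (@fpsC rat)). Qed.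

Lemma exp2_liftz (F : {fps rat}) : F 0%N = 0 -> exp2 (liftz F) = liftz (exp1 F).
Proof. by move=> F0; rewrite -exp_idE liftz_comp. Qed.

Lemma fps_scale_fpsC (R : comNzRingType) (c : R) (f : {fps R}) :
  fpsC (c *: f) = fpsC (fpsC c) * fpsC f.
Proof. by rewrite fps_scaleE rmorphM. Qed.

Lemma odd_dfactS m : odd_dfact m.+1 = (2 * m).+1%:R * odd_dfact m.
Proof.
have E : (2 * m.+1)%N = (2 * m).+2 by rewrite mulnS.
rewrite /odd_dfact E !factS expnS !natrM.
rewrite (_ : (2 * m).+2%:R = 2%:R * m.+1%:R :> rat); last by rewrite -natrM mulnS.
have := factr_neq0 m; have : (2 ^ m)%:R != 0 :> rat by rewrite pnatr_eq0 expn_eq0.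
have : m.+1%:R != 0 :> rat by rewrite pnatr_eq0.
move: m.+1%:R (2 ^ m)%:R m`!%:R (2 * m).+1%:R ((2 * m)`!%:R) => u v w x y.
by move=> u0 v0 w0; field; rewrite u0 v0 w0.
Qed.

Lemma odd_dfact0 : odd_dfact 0 = 1.
Proof. by rewrite /odd_dfact muln0 mulr1. Qed.

Implicit Types (f : {fps rat}).

(** * The Gaussian functional *)

(** The moment functional of the Gaussian law of variance [w]: as the [2m]-th
    moment is [(2m-1)!! w^m], the series [gauss0 F] in [w] is the expectation
    of [F(x)]. *)
Definition gauss0 (F : {fps rat}) : {fps rat} :=
  Fps (fun m => odd_dfact m * F (2 * m)%N).

Lemma gauss0E F m : gauss0 F m = odd_dfact m * F (2 * m)%N. Proof. by []. Qed.

Definition gauss : fps2 -> fps2 := fps_map gauss0.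

Lemma gaussE F n : gauss F n = gauss0 (F n). Proof. by []. Qed.

Lemma gauss0D (F G : {fps rat}) : gauss0 (F + G) = gauss0 F + gauss0 G.
Proof. by apply/fpsP => m /=; rewrite mulrDr. Qed.
Lemma gauss0_0 : gauss0 0 = 0.
Proof. by apply/fpsP => m /=; rewrite mulr0. Qed.
Lemma gauss0M (c : rat) (F : {fps rat}) : gauss0 (fpsC c * F) = fpsC c * gauss0 F.
Proof. by apply/fpsP => m; rewrite fps_mulC_coef !gauss0E fps_mulC_coef mulrCA. Qed.
Lemma gauss0_sum (I : Type) (r : seq I) (P : pred I) (F : I -> {fps rat}) :
  gauss0 (\sum_(i <- r | P i) F i) = \sum_(i <- r | P i) gauss0 (F i).
Proof. exact: (big_morph gauss0 gauss0D gauss0_0). Qed.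
Lemma gauss_sum (I : Type) (r : seq I) (P : pred I) (F : I -> fps2) :
  gauss (\sum_(i <- r | P i) F i) = \sum_(i <- r | P i) gauss (F i).
Proof.
apply: (big_morph gauss) => [f g|]; apply/fpsP => n /=; first exact: gauss0D.
exact: gauss0_0.
Qed.

Lemma gaussM f F : gauss (liftz f * F) = liftz f * gauss F.
Proof.
apply/fpsP => n; rewrite /= gauss0_sum; apply: eq_bigr => i _.
exact: gauss0M.
Qed.

(** Stein's identity, that is, integration by parts against the Gaussian
    density. *)
Lemma gauss0_stein F : gauss0 (fpsX * F) = fpsX * gauss0 (fps_deriv F).
Proof.
apply/fpsP => -[|m]; rewrite fps_mulX_coef !gauss0E fps_mulX_coef ?mulr0 //.
rewrite odd_dfactS mulnS add2n fps_derivE -[_ *+ _]mulr_natl; ring.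
Qed.

(** The Laplace transform of the Gaussian law. *)
Lemma gauss0_ex c : gauss0 (ex ^+ c) = exp1 (fpsX * fpsC (onehalf * c%:R ^+ 2)).
Proof.
apply/fpsP => m; rewrite exps_cX gauss0E exXn_coef /odd_dfact exprMn -exprM !natrM natrX.
have h : onehalf ^+ m = (2%:R ^+ m)^-1 by rewrite exprVn.
rewrite h; have := factr_neq0 m; have := factr_neq0 (2 * m).
have : 2%:R ^+ m != 0 :> rat by rewrite expf_neq0.
by move=> ? ? ?; field; do !(apply/andP; split).
Qed.

(** The exponents [- t^2 w / 2] and [- c t w]. When series in two variables
    carry the Gaussian functional, the outer variable is [t], and the inner one
    is [x] below [gauss] and [w] above it. *)
Definition gauss_tail : fps2 := - (fpsX ^+ 2 * fpsC (onehalf *: fpsX)).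
Definition drift (c : nat) : fps2 := fpsX * fpsC (- (c%:R *: fpsX)).

Lemma gauss_tail0 : gauss_tail 0%N = 0.
Proof. by rewrite /gauss_tail fps_coefN fps_mulXn_coef oppr0. Qed.
Lemma drift0 c : drift c 0%N = 0.
Proof. by rewrite /drift fps_mulX_coef. Qed.

Lemma fps_mulC_coef2 (c : {fps rat}) (F : fps2) n : (fpsC c * F) n = c * F n.
Proof. exact: fps_mulC_coef. Qed.

(** The expectation of [e^{(c - t) x}], in the form
    [e^{w (c - t)^2 / 2 - t^2 w / 2} = e^{w c^2 / 2} e^{- c t w}]. By
    [gauss0_stein], both sides solve the same differential equation in [t]. *)
Lemma gauss_shift c :
  exp2 gauss_tail * gauss (fpsC (ex ^+ c) * exp2 (fpsX * fpsC (- fpsX)))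
  = fpsC (exp1 (fpsX * fpsC (onehalf * c%:R ^+ 2))) * exp2 (drift c).
Proof.
set V := gauss _.
have dV : fps_deriv V = - (fpsC fpsX * (c%:R - fpsX) * V).
  apply/fpsP => n; rewrite fps_coefN -mulrA fps_mulC_coef2 mulrBl fps_coefB.
  rewrite mulr_natl fps_coefMn fps_mulX_coef fps_derivE.
  have VE m : V m = gauss0 (ex ^+ c * (fpsC (m`!%:R)^-1 * (- fpsX) ^+ m)).
    by rewrite /V gaussE fps_mulC_coef2 exps_cX.
  have dex : fps_deriv (ex ^+ c) = c%:R * ex ^+ c.
    rewrite exXn fps_deriv_exps ?fps_cX0 // mulrC fps_derivM fps_derivX mul1r.
    by rewrite fps_derivC mulr0 addr0 rmorph_nat mulrC.
  have -> : V n.+1 *+ n.+1 = - gauss0 (fpsX * (ex ^+ c * (fpsC (n`!%:R)^-1 * (- fpsX) ^+ n))).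
    have gN F : gauss0 (- F) = - gauss0 F.
      by rewrite -mulN1r -(rmorphN1 (@fpsC rat)) gauss0M rmorphN1 mulN1r.
    rewrite -gN -[LHS]mulr_natl -(rmorph_nat (@fpsC rat)) VE -gauss0M; congr gauss0.
    rewrite factS natrM invfM rmorphM exprS.
    have E : fpsC n.+1%:R * fpsC n.+1%:R^-1 = 1 :> {fps rat}.
      by rewrite -rmorphM divff ?pnatr_eq0.
    by rewrite -[RHS]mul1r -[X in _ = X * _]E; ring.
  rewrite gauss0_stein; congr (- (_ * _)).
  rewrite !fps_derivM dex fps_derivC mul0r add0r.
  case: n => [|n].
    rewrite subr0 expr0 (_ : fps_deriv 1 = 0); last exact: (fps_derivC 1).
    rewrite !mulr0 addr0 VE expr0 -mulrA -(rmorph_nat (@fpsC rat)) gauss0M.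
    by rewrite rmorph_nat mulr_natl.
  rewrite fps_deriv_expr fps_derivN fps_derivX gauss0D; congr (_ + _).
    by rewrite -mulrA -(rmorph_nat (@fpsC rat)) gauss0M -VE rmorph_nat mulr_natl.
  rewrite VE -[RHS]mulN1r -(rmorphN1 (@fpsC rat)) -gauss0M; congr gauss0.
  rewrite (rmorphN1 (@fpsC rat)) factS natrM invfM !rmorphM /=.
  have E : fpsC n.+1%:R^-1 * n.+1%:R = 1 :> {fps rat}.
    by rewrite -(rmorph_nat (@fpsC rat)) -rmorphM mulVf ?pnatr_eq0.
  by rewrite -[RHS]mul1r -[X in _ = X * _]E; ring.
have dtail : fps_deriv gauss_tail = - (fpsC fpsX * fpsX).
  rewrite /gauss_tail fps_derivN fps_derivM fps_derivC mulr0 addr0.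
  rewrite (fps_deriv_expr _ 1) fps_derivX mulr1 expr1 fps_scale_fpsC.
  have E : 2%:R * fpsC (fpsC onehalf) = 1 :> fps2.
    rewrite -(rmorph_nat (@fpsC {fps rat})) -(rmorph_nat (@fpsC rat)) -!rmorphM.
    by rewrite divff // !rmorph1.
  by congr (- _); rewrite -[RHS]mul1r -[X in _ = X * _]E; ring.
have ddrift : fps_deriv (drift c) = - (fpsC fpsX * c%:R).
  rewrite /drift fps_derivM fps_derivC mulr0 addr0 fps_derivX mul1r rmorphN /=.
  by rewrite fps_scale_fpsC !rmorph_nat mulrC.
have V0 : V 0%N = exp1 (fpsX * fpsC (onehalf * c%:R ^+ 2)).
  by rewrite /V gaussE fps_mulC_coef2 exps_coef0 mulr1 gauss0_ex.
move: V (exp1 _) dV V0 => V v dV V0.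
apply: (@fps_ode_uniq _ (@fpsC rat) (- (fpsC fpsX * c%:R))).
- by rewrite fps_derivM fps_deriv_exps ?gauss_tail0 // dV dtail; ring.
- by rewrite fps_derivM fps_derivC mul0r add0r fps_deriv_exps ?drift0 // ddrift mulrCA.
- rewrite 2!fps_coefM0 V0 fps_coefC [X in X * _ = _]exps_coef0 mul1r.
  by rewrite [X in _ = _ * X]exps_coef0 mulr1.
Qed.

Lemma fps_coefM2 (F G : fps2) n m : (F * G) n m =
  \sum_(i < n.+1) \sum_(j < m.+1) F i j * G (n - i)%N (m - j)%N.
Proof. by rewrite fps_coefM fps_coef_sum. Qed.

Lemma fps_mulCXn_coef (c : rat) (f : {fps rat}) d m :
  (fpsC c * fpsX ^+ d * f) m = if (d <= m)%N then c * f (m - d)%N else 0.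
Proof. by rewrite -mulrA fps_mulC_coef fps_mulXn_coef; case: ifP; rewrite ?mulr0. Qed.

(** * Series graded by excess *)

(** The series [\sum_k a_k(z w) w^k]: when [z] counts vertices and [w] edges,
    [a_k] is the part of excess [k]. *)
Definition by_excess (a : nat -> {fps rat}) : fps2 :=
  Fps (fun n => Fps (fun m => if (n <= m)%N then a (m - n)%N n else 0)).

(** The series [f(z w)], all of excess 0. *)
Definition excess0 (f : {fps rat}) : fps2 := liftz f \oF (fpsX * fpsC fpsX).

Lemma excess0_coef f n : excess0 f n = fpsC (f n) * fpsX ^+ n.
Proof. exact: fps_comp_cX. Qed.

Lemma by_excessE a n m :
  by_excess a n m = if (n <= m)%N then a (m - n)%N n else 0.
Proof. by []. Qed.

Lemma excess0_mul f a :
  excess0 f * by_excess a = by_excess (fun k => f * a k).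
Proof.
apply/fpsP => n; apply/fpsP => m; rewrite by_excessE fps_coefM fps_coef_sum.
case: ifP => nm.
  apply: eq_bigr => i _; rewrite excess0_coef fps_mulCXn_coef by_excessE.
  have ni : (i <= n)%N by rewrite -ltnS.
  rewrite (leq_trans ni nm) leq_sub2r //.
  by rewrite (_ : (m - i - (n - i) = m - n)%N) //; lia.
apply: big1 => i _; rewrite excess0_coef fps_mulCXn_coef by_excessE.
have ni : (i <= n)%N by rewrite -ltnS.
case: ifP => // im; case: ifP => [h|_]; last by rewrite mulr0.
by move: nm h; have := ltn_ord i; lia.
Qed.

(** * Substitution of [t e^{-t w}] for [z] *)

Definition graded_tree_inv : fps2 := fpsX * exp2 (fpsX * fpsC (- fpsX)).

Lemma graded_tree_inv0 : graded_tree_inv 0%N = 0.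
Proof. by rewrite /graded_tree_inv fps_mulX_coef. Qed.

Lemma graded_tree_inv_expr j :
  graded_tree_inv ^+ j = fpsX ^+ j * exp2 (drift j).
Proof.
have E : drift j = (fpsX * fpsC (- fpsX)) *+ j.
  by rewrite /drift -mulrnAr -rmorphMn /= mulNrn scaler_nat.
rewrite E expsMn ?exprMn //; exact: fps_cX0.
Qed.

Lemma graded_tree_inv_coef j n : (graded_tree_inv ^+ j) n =
  fpsC ((tree_inv ^+ j) n) * fpsX ^+ (n - j).
Proof.
rewrite graded_tree_inv_expr fps_mulXn_coef tree_inv_exprE.
case: ifP => jn; last by rewrite rmorph0 mul0r.
rewrite /drift exps_cX fps_scaleE -mulNr -rmorphN exprMn -rmorphXn mulrA -rmorphM /=.
by rewrite [X in fpsC X * _]mulrC.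
Qed.

Lemma comp_graded_coef F n m : (F \oF graded_tree_inv) n m =
  \sum_(j < n.+1) if (n - j <= m)%N
    then (tree_inv ^+ j) n * F j (m - (n - j))%N else 0.
Proof.
rewrite fps_coef_sum; apply: eq_bigr => j _.
by rewrite graded_tree_inv_coef mulrC fps_mulCXn_coef.
Qed.

Lemma by_excess_comp a :
  by_excess a \oF graded_tree_inv = by_excess (fun k => a k \oF tree_inv).
Proof.
apply/fpsP => n; apply/fpsP => m; rewrite by_excessE comp_graded_coef.
case: ifP => nm.
  apply: eq_bigr => j _; have ltj := ltn_ord j.
  rewrite (_ : (n - j <= m)%N); last by lia.
  rewrite by_excessE (_ : (j <= m - (n - j))%N); last by lia.
  by rewrite mulrC (_ : (m - (n - j) - j = m - n)%N) //; lia.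
apply: big1 => j _; case: ifP => // h; rewrite by_excessE; case: ifP => [h'|_].
  by have := ltn_ord j; lia.
by rewrite mulr0.
Qed.

(** * Uniqueness of the factorisation by the sign of the excess *)

(** Multigraphs without component of positive excess have at most as many edges
    as vertices; those all of whose components have positive excess have more
    edges than vertices, except the empty one. *)
Definition subdiagonal (F : fps2) := forall n m, (n < m)%N -> F n m = 0.
Definition superdiagonal (F : fps2) :=
  forall n m, (m <= n)%N -> F n m = ((n == 0%N) && (m == 0%N))%:R.

Lemma subdiagonalM F G : subdiagonal F -> subdiagonal G -> subdiagonal (F * G).
Proof.
move=> sF sG n m nm; rewrite fps_coefM2 big1 // => i _; rewrite big1 // => j _.
case: (ltnP i j) => [/sF ->|ji]; first by rewrite mul0r.
by rewrite sG ?mulr0 //; have := ltn_ord j; have := ltn_ord i; lia.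
Qed.

Lemma subdiagonalX F k : subdiagonal F -> subdiagonal (F ^+ k).
Proof.
move=> sF; elim: k => [|k IH]; last by rewrite exprS; apply: subdiagonalM.
by move=> [|n] [|m].
Qed.

Lemma subdiagonal_exp F : subdiagonal F -> F 0%N = 0 -> subdiagonal (exp2 F).
Proof.
move=> sF F0 n m nm; rewrite -expFE /expF fps_coef_sum big1 // => i _.
by rewrite fps_mulC_coef subdiagonalX ?mulr0.
Qed.

Lemma subdiagonal_excess0 f : subdiagonal (excess0 f).
Proof.
move=> n m nm; rewrite excess0_coef fps_mulC_coef fps_Xn_coef gtn_eqF ?mulr0 //.
Qed.

Lemma subdiagonal_comp F : subdiagonal F -> subdiagonal (F \oF graded_tree_inv).
Proof.
move=> sF n m nm; rewrite comp_graded_coef big1 // => j _; case: ifP => // h.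
by rewrite sF ?mulr0 //; have := ltn_ord j; lia.
Qed.

(** As in a Birkhoff factorisation, the factors are determined by their
    supports: the coefficients of degree [(n, m)] of the two sides differ from
    [N n m + P n m] by terms of lower degree only, and one of these two
    numbers vanishes. *)
Lemma factorisation_uniq N P N' P' : subdiagonal N -> subdiagonal N' ->
  N 0%N 0%N = 1 -> N' 0%N 0%N = 1 -> superdiagonal P -> superdiagonal P' ->
  N * P = N' * P' -> P = P'.
Proof.
move=> sN sN' N1 N1' sP sP' E.
suff H s n m : (n + m)%N = s -> N n m = N' n m /\ P n m = P' n m.
  by apply/fpsP => n; apply/fpsP => m; case: (H _ n m erefl).
elim/ltn_ind: s n m => s IH n m nms.
have [/andP[/eqP n0 /eqP m0]|nm0] := boolP ((n == 0%N) && (m == 0%N)).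
  by rewrite n0 m0 N1 N1' sP // sP'.
have PP : P 0%N 0%N = 1 by rewrite sP.
have PP' : P' 0%N 0%N = 1 by rewrite sP'.
have split2 (F G : fps2) : F 0%N 0%N = 1 -> G 0%N 0%N = 1 -> (F * G) n m = F n m + G n m +
   \sum_(p : 'I_n.+1 * 'I_m.+1 | (p != (ord_max, ord_max)) && (p != (ord0, ord0)))
      F p.1 p.2 * G (n - p.1)%N (m - p.2)%N.
  move=> F1 G1; rewrite fps_coefM2 pair_big /= (bigD1 (ord_max, ord_max)) //=.
  rewrite !subnn G1 mulr1 -addrA; congr (_ + _).
  rewrite (bigD1 (ord0, ord0)) //=; first by rewrite F1 mul1r !subn0.
  by rewrite xpair_eqE -!val_eqE /= ![0%N == _]eq_sym.
have := congr1 (fun F : fps2 => F n m) E; rewrite /= !split2 //.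
set S := \sum_(p | _) _; set S' := \sum_(p | _) _.
have -> : S = S'.
  apply: eq_bigr => -[i j] /= /andP[]; rewrite !xpair_eqE -!val_eqE /= => h1 h2.
  have := ltn_ord i; have := ltn_ord j => ltj lti.
  case: (IH (i + j)%N _ i j erefl) => [|-> _]; first by lia.
  by case: (IH (n - i + (m - j))%N _ (n - i)%N (m - j)%N erefl) => [|_ ->]; first by lia.
move/addIr; case: (leqP m n) => mn.
  by rewrite sP // sP' // (negPf nm0) !addr0.
by rewrite sN // sN' // !add0r.
Qed.

(** * The Gaussian expectation of the series of graphs *)

(** The series [e^{w c^2 / 2}], the expectation of [e^{c x}]. *)
Definition gauss_exp (c : nat) : {fps rat} :=
  exp1 (fpsX * fpsC (onehalf * c%:R ^+ 2)).

(** The series [\sum_n z^n / (n - i)! e^{w n^2 / 2}]. *)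
Definition kernel (i : nat) : fps2 :=
  Fps (fun n => if (i <= n)%N then fpsC ((n - i)`!%:R)^-1 * gauss_exp n else 0).

Lemma kernelE i n : kernel i n =
  if (i <= n)%N then fpsC ((n - i)`!%:R)^-1 * gauss_exp n else 0.
Proof. by []. Qed.

Lemma sum_ord_shift (V : nmodType) (F : nat -> V) i n :
  (forall j, (n < j)%N -> F j = 0) ->
  \sum_(j < n.+1) (if (i <= j)%N then F j else 0) = \sum_(j < n.+1) F (i + j)%N.
Proof.
move=> F0; pose G j := if (i <= j)%N then F j else 0.
rewrite (sum_ord_widen (F := G) (b := (i + n.+1)%N)) ?leq_addl //; last first.
  by move=> j /andP[nj _]; rewrite /G F0 //; case: ifP.
rewrite big_split_ord /= big1 ?add0r => [|j _].
  by apply: eq_bigr => j _; rewrite /G leq_addr.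
by rewrite /G leqNgt ltn_ord.
Qed.

Lemma liftzC c : liftz (fpsC c) = fpsC (fpsC c).
Proof. exact: (fps_mapC (@fpsC rat)). Qed.
Lemma liftzXn (f : {fps rat}) k : liftz (f ^+ k) = liftz f ^+ k.
Proof. exact: (rmorphXn (fps_map (@fpsC rat))). Qed.

Lemma exp2_split : exp2 (fpsX * fpsC (ex - 1 - fpsX)) =
  exp2 (fpsX * fpsC ex) * exp2 (fpsX * fpsC (- fpsX)) * liftz (exp1 (- fpsX)).
Proof.
rewrite -exp2_liftz; last by rewrite fps_coefN fps_coefX oppr0.
rewrite -expsD ?fps_cX0 //.
rewrite -expsD; last 2 first.
- by rewrite fps_coefD !fps_cX0 addr0.
- by rewrite liftzN liftzX fps_coefN fps_coefX oppr0.
have -> // : fpsX * fpsC (ex - 1 - fpsX) = 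
  fpsX * fpsC ex + fpsX * fpsC (- fpsX) + liftz (- fpsX) :> fps2.
rewrite liftzN liftzX !rmorphB rmorphN rmorph1 /=; ring.
Qed.

(** The left side is the expectation of [z^i e^{i x} e^{z e^x}] at
    [z = t e^{- t w}], and on the right [x] has been translated by [t w]. The
    coefficient of [t^n] only involves finitely many terms of the expansion of
    [e^{t e^x}], and for each of them the translation is [gauss_shift]. *)
Lemma kernel_comp i : kernel i \oF graded_tree_inv =
  exp2 (fpsX + gauss_tail) *
  (fpsX ^+ i * gauss (fpsC (ex ^+ i) * exp2 (fpsX * fpsC (ex - 1 - fpsX)))).
Proof.
pose u j := fpsX ^+ j * (fpsC (gauss_exp j) * exp2 (drift j)).
rewrite expsD ?gauss_tail0 ?fps_coefX // exp2_split.
have EX : exp2 fpsX = liftz (exp1 fpsX) by rewrite -liftzX exp2_liftz ?fps_coefX.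
set A := exp2 (fpsX * fpsC ex); set D := exp2 (fpsX * fpsC (- fpsX)).
rewrite (_ : gauss _ = liftz (exp1 (- fpsX)) * gauss (fpsC (ex ^+ i) * A * D)); last first.
  by rewrite -gaussM; congr gauss; ring.
rewrite EX (_ : _ * _ = exp2 gauss_tail * (fpsX ^+ i * gauss (fpsC (ex ^+ i) * A * D))); last first.
  have E : liftz (exp1 fpsX) * liftz (exp1 (- fpsX)) = 1.
    rewrite -liftzM mulrC (expsNr idfun) ?fps_coefX // .
    exact: (rmorph1 (fps_map (@fpsC rat))).
  by rewrite -[RHS]mul1r -[X in _ = X * _]E; ring.
apply/fpsP => n.
(* The truncation of [A] at degree [n] in [t]. *)
pose A' : fps2 := \sum_(j < n.+1) liftz (fpsC (j`!%:R)^-1 * fpsX ^+ j) * fpsC (ex ^+ j).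
transitivity ((exp2 gauss_tail * (fpsX ^+ i * gauss (fpsC (ex ^+ i) * A' * D))) n); last first.
  apply: (@fps_mul_eqN _ n.+1); [by [] | move=> k1 k1n | by []].
  apply: (@fps_mul_eqN _ n.+1); [by [] | move=> k2 k2n | by []].
  rewrite !gaussE; congr gauss0.
  apply: (@fps_mul_eqN _ n.+1); [move=> k3 k3n | by [] | by []].
  apply: (@fps_mul_eqN _ n.+1); [by [] | move=> k4 k4n | by []].
  rewrite /A /A' exps_cX fps_coef_sum (bigD1 (Ordinal k4n)) // big1 ?addr0.
    rewrite liftzM liftzC liftzXn liftzX -!mulrA fps_mulC_coef2 fps_mulXn_coef leqnn subnn fps_coefC; exact: addr0.
  move=> j; rewrite -val_eqE => jn; rewrite /= in jn.
  rewrite liftzM liftzC liftzXn liftzX -!mulrA fps_mulC_coef2 fps_mulXn_coef.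
  case: ifP => le; last by rewrite mulr0.
  rewrite fps_coefC; have : (0 < k4 - j)%N by lia.
  by case: (k4 - j)%N => // ?; rewrite ?mulr0.
rewrite /A' mulr_sumr mulr_suml gauss_sum !mulr_sumr fps_coef_sum.
transitivity (\sum_(j < n.+1)
   (if (i <= j)%N then (fpsC (fpsC ((j - i)`!%:R)^-1) * u j) n else 0)).
  apply: eq_bigr => j _; rewrite kernelE; case: ifP => _; last by rewrite mul0r.
  rewrite fps_mulC_coef2 /u graded_tree_inv_expr -mulrA; congr (_ * _).
  by rewrite [in RHS]mulrCA fps_mulC_coef2.
rewrite (sum_ord_shift (F := fun j => (fpsC (fpsC ((j - i)`!%:R)^-1) * u j) n)); last first.
  by move=> j nj; rewrite fps_mulC_coef2 /u fps_mulXn_coef leqNgt nj mulr0.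
apply: eq_bigr => j _; congr (fpscoef _ n).
rewrite addKn /u -gauss_shift -/D.
have -> : fpsC (ex ^+ i) * (liftz (fpsC (j`!%:R)^-1 * fpsX ^+ j) * fpsC (ex ^+ j)) * D =
   liftz (fpsC (j`!%:R)^-1 * fpsX ^+ j) * (fpsC (ex ^+ (i + j)) * D).
  by rewrite exprD rmorphM /=; ring.
rewrite gaussM liftzM liftzC liftzXn liftzX exprD; ring.
Qed.

(** * Patchworks of excess 0 *)

Definition inner_deriv : fps2 -> fps2 := fps_map fps_deriv.

Lemma inner_derivM F G :
  inner_deriv (F * G) = inner_deriv F * G + F * inner_deriv G.
Proof.
apply/fpsP => n; rewrite fps_coefD !fps_coefM /= fps_deriv_sum -big_split /=.
by apply: eq_bigr => i _; rewrite fps_derivM.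
Qed.

Lemma add1X_expr_coef N m : ((1 + fpsX : {fps rat}) ^+ N) m = 'C(N, m)%:R.
Proof.
rewrite exprDn fps_coef_sum; case: (leqP m N) => mN.
  rewrite (bigD1 (Ordinal (mN : (m < N.+1)%N))) //= big1 => [|i].
    by rewrite expr1n mul1r fps_coefMn fps_Xn_coef eqxx addr0.
  rewrite -val_eqE /= => im; rewrite expr1n mul1r fps_coefMn fps_Xn_coef eq_sym.
  by rewrite (negPf im) mul0rn.
rewrite bin_small // big1 // => i _; rewrite expr1n mul1r fps_coefMn fps_Xn_coef.
by rewrite gtn_eqF ?mul0rn // (leq_ltn_trans _ mN) // -ltnS.
Qed.

Lemma deriv_add1X_expr N : (1 + fpsX) * fps_deriv ((1 + fpsX : {fps rat}) ^+ N)
  = fpsC N%:R * (1 + fpsX) ^+ N.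
Proof.
case: N => [|N]; first by rewrite expr0 (fps_derivC 1) rmorph0 mulr0 mul0r.
rewrite fps_deriv_expr fps_derivD fps_derivX (fps_derivC 1) add0r mulr1 exprS.
by rewrite rmorph_nat; ring.
Qed.

Lemma bin2_half n : 'C(n, 2)%:R = onehalf * (n%:R ^+ 2 - n%:R) :> rat.
Proof.
have := bin_ffact n 2; rewrite ffactnS ffactn1 => /(congr1 (fun k => k%:R : rat)).
rewrite natrM [in RHS]natrM -[(2`!)%N]/2%N => E.
have -> : n%:R ^+ 2 - n%:R = n%:R * n.-1%:R :> rat.
  by case: n {E} => [|n] /=; [rewrite mul0r expr0n subrr | rewrite -natr1; ring].
by rewrite -E; field.
Qed.

(** [S] is the series of graphs and [H] that of patchworks. Dividing the
    coefficient of [z^n] of [S] by [e^{w n^2 / 2}] removes the arbitrary edges: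
    the result [G] is the series of patchworks with additional isolated
    vertices, [H e^z]. *)
Section Excess0.
Variables (S H : fps2).
Hypothesis SE : forall n m, S n m = 'C('C(n, 2), m)%:R / n`!%:R.
Hypothesis SH : forall n, S n = \sum_(i < n.+1) H i * kernel i n.

Let E n : {fps rat} := exp1 (- (fpsX * fpsC (onehalf * n%:R ^+ 2))).
Let G : fps2 := Fps (fun n => S n * E n).

Let GH : G = H * exp2 fpsX.
Proof.
apply/fpsP => n; rewrite -[LHS]/(S n * E n) SH mulr_suml fps_coefM.
apply: eq_bigr => i _; rewrite kernelE -ltnS ltn_ord -!mulrA; congr (_ * _).
rewrite (_ : fpsX = fpsX * fpsC 1); last by rewrite mulr1.
rewrite exps_cX expr1n mulr1 -[RHS]mulr1 -/(gauss_exp n); congr (_ * _).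
by rewrite mulrC expsNr // fps_mulX_coef.
Qed.

Let S_expr n : S n = fpsC (n`!%:R)^-1 * (1 + fpsX) ^+ 'C(n, 2).
Proof. by apply/fpsP => m; rewrite SE fps_mulC_coef add1X_expr_coef mulrC. Qed.

Let H0 n : H n 0%N = (n == 0%N)%:R.
Proof.
pose h : {fps rat} := Fps (fun n => H n 0%N).
suff h1 : h = 1 by rewrite -fps_coef1 -h1.
have U : ex \is a GRing.unit by apply: fps_unit1; exact: ex_coef0.
apply: (mulIr U); rewrite mul1r; apply/fpsP => k.
have := congr1 (fun f : {fps rat} => f 0%N) (SH k).
rewrite S_expr fps_mulC_coef add1X_expr_coef bin0 mulr1 fps_coef_sum => hk.
rewrite -[ex k]/((k`!%:R)^-1) hk fps_coefM; apply: eq_bigr => i _.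
rewrite kernelE -ltnS ltn_ord !fps_coefM0 (_ : gauss_exp k 0%N = 1).
  by rewrite mulr1 fps_coefC.
exact: exps_coef0.
Qed.

(** The logarithmic derivative of [(1 + w)^{n (n - 1) / 2} e^{- w n^2 / 2}], with
    [n] and [n (n - 1)] turned into the operators [z d/dz] and
    [z^2 d^2/dz^2]. *)
Let pdeG : fpsC (1 + fpsX) * inner_deriv G =
  - (fpsC (fpsC onehalf * (1 + fpsX)) * (fpsX * fps_deriv G)) -
    fpsC (fpsC onehalf * fpsX) * (fpsX ^+ 2 * fps_deriv (fps_deriv G)).
Proof.
apply/fpsP => n.
have XG : (fpsX * fps_deriv G) n = n%:R * G n.
  by rewrite fps_mulX_coef; case: n => [|n]; rewrite ?mul0r // fps_derivE mulr_natl.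
have XXG : (fpsX ^+ 2 * fps_deriv (fps_deriv G)) n = (n%:R ^+ 2 - n%:R) * G n.
  rewrite fps_mulXn_coef; case: n {XG} => [|[|n]].
  - by rewrite expr0n subrr mul0r.
  - by rewrite expr1n subrr mul0r.
  by rewrite subSS subSS subn0 !fps_derivE -mulrnA -[LHS]mulr_natl natrM; ring.
rewrite fps_coefB fps_coefN !fps_mulC_coef2 XG XXG.
have dE : fps_deriv (E n) = - fpsC (onehalf * n%:R ^+ 2) * E n.
  rewrite fps_deriv_exps; last by rewrite fps_coefN fps_mulX_coef oppr0.
  by rewrite fps_derivN fps_derivM fps_derivX fps_derivC mulr0 addr0 mul1r.
have -> : inner_deriv G n = fps_deriv (S n * E n) by [].
have -> : G n = S n * E n by [].
have dS : (1 + fpsX) * fps_deriv (S n) = fpsC 'C(n, 2)%:R * S n.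
  rewrite S_expr fps_derivM fps_derivC mul0r add0r mulrCA deriv_add1X_expr.
  by rewrite mulrCA.
rewrite fps_derivM mulrDr mulrA dS dE bin2_half.
rewrite !rmorphM rmorphB rmorphXn !rmorph_nat /=; ring.
Qed.

(** The relation [pdeG], after the factor [e^z] is cancelled. *)
Let pdeH : fpsC (1 + fpsX) * inner_deriv H =
  - (fpsC (fpsC onehalf * (1 + fpsX)) * (fpsX * (fps_deriv H + H))) -
    fpsC (fpsC onehalf * fpsX) *
      (fpsX ^+ 2 * (fps_deriv (fps_deriv H) + 2%:R * fps_deriv H + H)).
Proof.
have U : exp2 fpsX \is a GRing.unit by apply: fps_unit1; exact: exps_coef0.
have dU : fps_deriv (exp2 fpsX) = exp2 fpsX.
  by rewrite fps_deriv_exps ?fps_coefX // fps_derivX mul1r.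
have iU : inner_deriv (exp2 fpsX) = 0.
  apply/fpsP => n; rewrite (_ : fpsX = fpsX * fpsC 1); last by rewrite mulr1.
  by rewrite /inner_deriv /= exps_cX expr1n mulr1 fps_derivC.
apply: (mulIr U); move: pdeG; rewrite GH; move: (exp2 fpsX) dU iU => e dU iU.
rewrite inner_derivM iU mulr0 addr0 !fps_derivM dU !fps_derivD !fps_derivM dU.
by rewrite mulrA => ->; ring.
Qed.

Let P n : {fps rat} := n%:R * H n + (if n is n'.+1 then H n' else 0).
Let Q n : {fps rat} := (n * n.-1)%:R * H n +
  (if n is n'.+1 then (2 * n')%:R * H n' else 0) + (if n is n'.+2 then H n' else 0).

Let pdeH_row n : (1 + fpsX) * fps_deriv (H n) =
  - (fpsC onehalf * (1 + fpsX) * P n) - fpsC onehalf * fpsX * Q n.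
Proof.
have PE : (fpsX * (fps_deriv H + H)) n = P n.
  rewrite fps_mulX_coef /P; case: n => [|n]; first by rewrite mul0r addr0.
  by rewrite fps_coefD fps_derivE mulr_natl.
have QE : (fpsX ^+ 2 * (fps_deriv (fps_deriv H) + 2%:R * fps_deriv H + H)) n = Q n.
  rewrite fps_mulXn_coef /Q; case: n {PE} => [|[|n]].
  - by rewrite muln0 mul0r !addr0.
  - by rewrite !muln0 !mul0r !addr0.
  rewrite subSS subSS subn0 !fps_coefD !fps_derivE mulr_natl fps_coefMn fps_derivE.
  by rewrite -!mulrnA !mulr_natl [(n.+2 * _)%N]mulnC [(2 * _)%N]mulnC.
have /fpsP/(_ n) := pdeH; rewrite fps_coefB fps_coefN !fps_mulC_coef2 PE QE.
by move=> <-.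
Qed.

Let natr_coef k (f : {fps rat}) m : (k%:R * f) m = k%:R * f m.
Proof. by rewrite -(rmorph_nat (@fpsC rat)) fps_mulC_coef. Qed.

Let row_coef n m : m.+1%:R * H n m.+1 + m%:R * H n m =
  - onehalf * (P n m + (if m is m'.+1 then P n m' + Q n m' else 0)).
Proof.
have /fpsP/(_ m) := pdeH_row n.
rewrite mulrDl mul1r fps_coefD fps_coefB fps_coefN -!mulrA !fps_mulC_coef mulrDl.
rewrite mul1r fps_coefD !fps_mulX_coef fps_derivE !mulr_natl.
by case: m => [|m] rowE; rewrite ?fps_derivE ?mulr_natl in rowE; rewrite rowE; ring.
Qed.

(** Every vertex of a patchwork has degree at least 2, so that [n <= m]; here it is
    the equation that propagates the vanishing from each column to the next
    one. *)
Lemma patch_no_deficit n m : (m < n)%N -> H n m = 0.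
Proof.
elim/ltn_ind: m n => -[|m] IH n mn; first by rewrite H0 gtn_eqF.
have {}IH k l : (l < k)%N -> (l <= m)%N -> H k l = 0 by move=> *; apply: IH.
have V l : (l <= m)%N -> P n l = 0.
  move=> lm; rewrite /P fps_coefD natr_coef IH ?mulr0 ?add0r //; last by lia.
  by case: n mn => [|n] mn //; rewrite IH //; lia.
have W l : (l < m)%N -> Q n l = 0.
  move=> lm; rewrite /Q !fps_coefD natr_coef IH ?mulr0 ?add0r; [|lia|lia].
  case: n mn {V} => [|[|n]] mn; rewrite ?addr0 //.
  by rewrite natr_coef !IH ?mulr0 ?addr0 //; lia.
have := row_coef n m; rewrite V // (IH n m) //; last by lia.
rewrite (_ : (if m is _.+1 then _ else _) = 0) ?mulr0 ?addr0 ?mulr0; last first.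
  by case: (m) V W => // l V W; rewrite V ?W ?addr0.
by move/eqP; rewrite mulf_eq0 pnatr_eq0 => /eqP.
Qed.

(** The generating function of the patchworks of excess 0, whose components
    are isolated loops and isolated double edges. *)
Definition patch0 : {fps rat} :=
  exp1 (- (onehalf *: fpsX) - 4^-1 *: fpsX ^+ 2).

(** On the diagonal, the terms of [row_coef] that do not vanish give the
    differential equation [2 d' = - (1 + z) d]. *)
Lemma patch_diagonal n : H n n = patch0 n.
Proof.
pose d : {fps rat} := Fps (fun n => H n n).
suff -> : patch0 = d by [].
apply: (@fps_ode_uniq _ idfun (- (onehalf *: (1 + fpsX)))).
- rewrite fps_deriv_exps; last by rewrite fps_coefB fps_coefN !fps_coefZ fps_coefX fps_Xn_coef !mulr0 subr0.
  rewrite fps_derivD !fps_derivN !fps_derivZ fps_derivX (fps_deriv_expr _ 1) fps_derivX.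
  rewrite mulr1 expr1 -(rmorph_nat (@fpsC rat)) -fps_scaleE scalerA.
  by rewrite (_ : 4^-1 * 2%:R = onehalf) ?scalerDr ?opprD //; field.
- apply/fpsP => k; rewrite fps_derivE mulNr -scalerAl fps_coefN fps_coefZ mulrDl mul1r.
  rewrite fps_coefD fps_mulX_coef -[d k.+1]/(H k.+1 k.+1) -[LHS]mulr_natl.
  have := row_coef k.+1 k; rewrite (@patch_no_deficit k.+1 k) // mulr0 addr0 => ->.
  rewrite -mulNr; congr (_ * _); rewrite /P fps_coefD natr_coef patch_no_deficit //.
  rewrite mulr0 add0r; congr (_ + _); case: k => // k.
  have z1 : H k.+2 k = 0 by apply: patch_no_deficit; lia.
  have z2 : H k.+1 k = 0 by apply: patch_no_deficit; lia.
  rewrite fps_coefD natr_coef z1 z2 mulr0 !add0r.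
  by rewrite /Q !fps_coefD !natr_coef z1 z2 !mulr0 !add0r.
- by rewrite exps_coef0 -[d _]/(H _ _) H0.
Qed.

End Excess0.

(** * The coefficients of the Gaussian expectation *)

Definition of_excess (F : fps2) (k : nat) : {fps rat} := Fps (fun n => F n (n + k)%N).

Lemma by_excessK (F : fps2) : (forall n m, (m < n)%N -> F n m = 0) ->
  by_excess (of_excess F) = F.
Proof.
move=> F0; apply/fpsP => n; apply/fpsP => m; rewrite by_excessE.
by case: ifP => nm; rewrite /= ?subnKC // F0 // ltnNge nm.
Qed.

Lemma of_excessK a k : of_excess (by_excess a) k = a k.
Proof. by apply/fpsP => n; rewrite /= leq_addr addKn. Qed.

Lemma superdiagonal_eq0 F : superdiagonal F -> forall n m, (m < n)%N -> F n m = 0.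
Proof. by move=> sF n m mn; rewrite sF ?(ltnW mn) //; case: n mn. Qed.

Lemma superdiagonal_by_excess a : a 0%N = 1 -> superdiagonal (by_excess a).
Proof.
move=> a0 n m mn; rewrite by_excessE; case: ifP => [nm|].
  have -> : n = m by apply/eqP; rewrite eqn_leq nm mn.
  by rewrite subnn a0 fps_coef1 andbb.
by case: n mn => [|n] mn //; case: m mn.
Qed.

Lemma coefxE j (F : fps2) n : coefx j F n = F n j. Proof. by []. Qed.

Lemma coefxM_liftz j f (F : fps2) : coefx j (liftz f * F) = f * coefx j F.
Proof.
apply/fpsP => n; rewrite coefxE fps_coefM fps_coef_sum.
by apply: eq_bigr => i _; rewrite fps_mulC_coef.
Qed.

(** The series [(e^x - 1 - x) / (x^2 / 2)]. *)
Definition ex_rest : {fps rat} := 2 *: fps_divXn 2 (ex - 1 - fpsX).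

Lemma ex_rest_coef0 : ex_rest 0%N = 1.
Proof.
rewrite /ex_rest fps_coefZ.
have -> : fps_divXn 2 (ex - 1 - fpsX) 0 = 2^-1 - 0 - 0 :> rat by [].
by rewrite !subr0 divff.
Qed.

Lemma ex_restE : ex - 1 - fpsX = fpsX ^+ 2 * (fpsC onehalf * ex_rest).
Proof.
apply/fpsP => n; rewrite fps_mulXn_coef.
case: n => [|[|n]]; rewrite ?fps_mulC_coef.
- have -> : (ex - 1 - fpsX) 0%N = 1^-1 - 1 - 0 :> rat by [].
  by rewrite invr1 subr0 subrr.
- have -> : (ex - 1 - fpsX) 1%N = 1^-1 - 0 - 1 :> rat by [].
  by rewrite invr1 subr0 subrr.
rewrite subSS subSS subn0 /ex_rest fps_coefZ mulrA mulVf // mul1r.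
by rewrite -[RHS]/((ex - 1 - fpsX) (n + 2)%N) addn2.
Qed.

(** The coefficient of [c^N] in [(1 - c)^{- a - 1/2}]: the moments of the Gaussian
    law turn the exponential series in [x^2 / 2] into this power. *)
Definition neg_half_binom (a N : nat) : rat := fps_binom (- (a%:R + 1 / 2)) N * (-1) ^+ N.

Lemma odd_dfact_binom a N :
  odd_dfact (a + N) * (onehalf ^+ N / N`!%:R) = odd_dfact a * neg_half_binom a N.
Proof.
rewrite /neg_half_binom /=; elim: N => [|N IH].
  by rewrite addn0 big_ord0 invr1 !mulr1.
rewrite big_ord_recr addnS odd_dfactS factS natrM invfM !exprS.
have N0 : N.+1%:R != 0 :> rat by rewrite pnatr_eq0.
have f0 := factr_neq0 N.
rewrite (_ : (2 * (a + N)).+1%:R = 2 * (a%:R + 1 / 2 + N%:R)); last first.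
  by rewrite -natr1 natrM natrD; field.
set p := \prod_(_ < _) _ in IH *; set h := onehalf ^+ N in IH *.
transitivity ((a%:R + 1 / 2 + N%:R) / N.+1%:R * (odd_dfact (a + N) * (h / N`!%:R))).
  by move: N.+1%:R N`!%:R N0 f0 => u v u0 v0; field; rewrite u0 v0.
by rewrite IH /=; move: N.+1%:R N`!%:R N0 f0 => u v u0 v0; field; rewrite u0 v0.
Qed.

(** The coefficient of [t^n] in
    [\sum_i H_i(w) t^i E(e^{i x} e^{t (e^x - 1 - x)})]. *)
Definition gauss_row (H : fps2) (n : nat) : {fps rat} := \sum_(i < n.+1)
  H i * gauss0 (ex ^+ i * (fpsC ((n - i)`!%:R)^-1 * (ex - 1 - fpsX) ^+ (n - i))).

Lemma gauss_row_term i N m :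
  gauss0 (ex ^+ i * (fpsC (N`!%:R)^-1 * (ex - 1 - fpsX) ^+ N)) m =
  if (N <= m)%N then odd_dfact (m - N) * neg_half_binom (m - N) N *
      (ex ^+ i * ex_rest ^+ N) (2 * (m - N))%N
  else 0.
Proof.
rewrite gauss0E ex_restE exprMn -exprM exprMn.
rewrite (_ : _ * _ = fpsX ^+ (2 * N) * (fpsC (onehalf ^+ N / N`!%:R) * (ex ^+ i * ex_rest ^+ N))); last first.
  by rewrite mulrC rmorphM rmorphXn /=; ring.
rewrite fps_mulXn_coef (_ : (2 * N <= 2 * m)%N = (N <= m)%N) ?leq_mul2l //.
case: ifP => // Nm; last by rewrite mulr0.
rewrite fps_mulC_coef -mulnBr mulrA -[in RHS]odd_dfact_binom subnK //.
Qed.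

Lemma sum_ord_window (V : nmodType) (f : nat -> V) i K M : (i + K <= M)%N ->
  (forall j, (j < i)%N -> f j = 0) -> (forall j, (i + K <= j < M)%N -> f j = 0) ->
  \sum_(j < M) f j = \sum_(l < K) f (i + l)%N.
Proof.
move=> KM f0 f1; rewrite -(sum_ord_widen KM f1) big_split_ord /= big1 ?add0r //.
by move=> j _; rewrite f0.
Qed.

(** Besides the series [S] of graphs and [H] of patchworks, their factors: [POS]
    and [PPOS] count those all of whose components have positive excess, [NP]
    and [NPP] those without such a component. *)
Section GaussRows.
Variables (S H POS NP PPOS NPP : fps2).
Hypothesis SE : forall n m, S n m = 'C('C(n, 2), m)%:R / n`!%:R.
Hypothesis SH : forall n, S n = \sum_(i < n.+1) H i * kernel i n.
Hypotheses (SP : S = NP * POS) (HP : H = NPP * PPOS).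
Hypotheses (sNP : subdiagonal NP) (sNPP : subdiagonal NPP).
Hypotheses (NP1 : NP 0%N 0%N = 1) (NPP1 : NPP 0%N 0%N = 1).
Hypotheses (sPOS : superdiagonal POS) (sPPOS : superdiagonal PPOS).

Let H0 := patch_no_deficit SE SH.

(** Multiplication by a series of excess 0 acts on each excess separately, so
    [H] divided by its part of excess 0 still has no part of negative excess, and
    its part of excess 0 is 1: by uniqueness of the factorisation it is
    [PPOS]. *)
Lemma patch_of_excess l : of_excess H l = patch0 * of_excess PPOS l.
Proof.
have U : patch0 \is a GRing.unit by apply: fps_unit1; exact: exps_coef0.
have HE : of_excess H 0 = patch0.
  by apply/fpsP => n; rewrite /of_excess /= addn0 (patch_diagonal SE SH).
have E : PPOS = by_excess (fun k => patch0^-1 * of_excess H k).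
  apply: (@factorisation_uniq NPP PPOS (excess0 patch0)) => //.
  - exact: subdiagonal_excess0.
  - by rewrite excess0_coef fps_mulC_coef exps_coef0 mul1r.
  - by apply: superdiagonal_by_excess; rewrite HE mulVr.
  rewrite -HP excess0_mul -{1}(by_excessK H0); congr by_excess.
  by apply/boolp.funext => k; rewrite mulrA divrr ?mul1r.
by rewrite E of_excessK mulrA divrr ?mul1r.
Qed.

Lemma S_comp : S \oF graded_tree_inv =
  exp2 (fpsX + gauss_tail) * Fps (gauss_row H).
Proof.
apply/fpsP => n.
pose U i := fpsX ^+ i * gauss (fpsC (ex ^+ i) * exp2 (fpsX * fpsC (ex - 1 - fpsX))).
have UE i k : U i k = if (i <= k)%N then
   gauss0 (ex ^+ i * (fpsC ((k - i)`!%:R)^-1 * (ex - 1 - fpsX) ^+ (k - i))) else 0.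
  by rewrite /U fps_mulXn_coef; case: ifP => // _; rewrite gaussE fps_mulC_coef2 exps_cX.
rewrite (@fps_comp_eqN _ n.+1 _ (\sum_(i < n.+1) fpsC (H i) * kernel i)) //; last first.
  move=> k kn; rewrite SH fps_coef_sum.
  rewrite (sum_ord_widen (F := fun i => H i * kernel i k) kn) => [|i /andP[ki _]].
    by apply: eq_bigr => i _; rewrite fps_mulC_coef2.
  by rewrite kernelE leqNgt ki mulr0.
rewrite fps_comp_sum.
transitivity ((exp2 (fpsX + gauss_tail) * \sum_(i < n.+1) fpsC (H i) * U i) n).
  congr (fpscoef _ n); rewrite mulr_sumr; apply: eq_bigr => i _.
  rewrite fps_compM ?graded_tree_inv0 // fps_compC kernel_comp mulrCA; congr (_ * _).
apply: (@fps_mul_eqN _ n.+1); [by [] | move=> k kn | by []].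
rewrite -[RHS]/(gauss_row H k) fps_coef_sum /gauss_row.
pose F i := H i * U i k.
transitivity (\sum_(i < n.+1) F i).
  by apply: eq_bigr => i _; rewrite fps_mulC_coef2.
rewrite -(sum_ord_widen (F := F) kn) => [|i /andP[ki _]].
  by apply: eq_bigr => i _; rewrite /F UE -ltnS ltn_ord.
by rewrite /F UE leqNgt ki mulr0.
Qed.

(** With [x^2] of the size of [w], the double zero of [e^x - 1 - x] makes each
    factor [t (e^x - 1 - x)] bring at least one edge with its vertex. Only
    finitely many excesses [l] of [H] contribute to a given excess [k], and the
    rest of the excess is half the degree in [x] that remains, [2 (k - l)]. *)
Lemma gauss_rowE n k : gauss_row H n (n + k)%N =
  \sum_(l < k.+1) odd_dfact (k - l) * \sum_(i < n.+1) (of_excess H l i *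
     neg_half_binom (k - l) (n - i) * (ex ^+ i * ex_rest ^+ (n - i)) (2 * (k - l))%N).
Proof.
rewrite /gauss_row fps_coef_sum.
under [RHS]eq_bigr => l _ do rewrite mulr_sumr.
rewrite [RHS]exchange_big; apply: eq_bigr => i _.
have ni : (i <= n)%N by rewrite -ltnS.
pose f j := H i j * (if (n - i <= n + k - j)%N then
   odd_dfact (n + k - j - (n - i)) * neg_half_binom (n + k - j - (n - i)) (n - i) *
   (ex ^+ i * ex_rest ^+ (n - i)) (2 * (n + k - j - (n - i)))%N else 0).
transitivity (\sum_(j < (n + k).+1) f j).
  by rewrite fps_coefM; apply: eq_bigr => j _; rewrite gauss_row_term.
rewrite (@sum_ord_window _ f i k.+1); first last.
- by move=> j ?; rewrite /f ifF ?mulr0 //; lia.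
- by move=> j ji; rewrite /f H0 ?mul0r.
- by lia.
apply: eq_bigr => l _; have := ltn_ord l => lk; rewrite /f ifT; last by lia.
by rewrite (_ : n + k - (i + l) - (n - i) = k - l)%N; [ring | lia].
Qed.

Lemma gauss_row_low n m : (m < n)%N -> gauss_row H n m = 0.
Proof.
move=> mn; rewrite /gauss_row fps_coef_sum big1 // => i _.
rewrite fps_coefM big1 // => j _; rewrite gauss_row_term.
have := ltn_ord i; have := ltn_ord j => ltj lti.
case: ifP => h; last by rewrite mulr0.
by rewrite H0 ?mul0r //; lia.
Qed.

End GaussRows.

(** * Positive graphs as a function of T *)

Notation pow1 := (pows idfun).
Notation pow2 := (pows (@fpsC rat)).

Lemma sub1X0 (R : comNzRingType) : (1 - fpsX : {fps R}) 0%N = 1.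
Proof. by rewrite fps_coefB fps_coefX subr0. Qed.

Lemma sub1X_coef0 (R : comNzRingType) (c : R) : (1 - fpsX * fpsC c) 0%N = 1.
Proof. by rewrite fps_coefB fps_cX0 subr0. Qed.

Lemma pow1_sub1X_coef a N : pow1 (1 - fpsX) a N = fps_binom a N * (-1) ^+ N.
Proof.
rewrite -pows_idE (_ : 1 - fpsX - 1 = fpsX * fpsC (-1)) ?fps_comp_cX //.
by rewrite rmorphN1 mulrN1 addrC addKr.
Qed.

Lemma pow2_sub1X_coef a (c : {fps rat}) N :
  pow2 (1 - fpsX * fpsC c) a N = fpsC (fps_binom a N * (-1) ^+ N) * c ^+ N.
Proof.
rewrite -powFE /powF (_ : 1 - _ - 1 = fpsX * fpsC (- c)); last first.
  by rewrite rmorphN mulrN addrC addKr.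
rewrite fps_comp_cX -[- c]mulN1r exprMn mulrA; congr (_ * _).
by rewrite (rmorphM (@fpsC rat)) (rmorphXn (@fpsC rat)) (rmorphN1 (@fpsC rat)).
Qed.

Lemma liftzB f g : liftz (f - g) = liftz f - liftz g.
Proof. exact: (rmorphB (fps_map (@fpsC rat))). Qed.

Lemma liftz_comp_ex_coef f i :
  (liftz f \oF (fpsX * liftx ex)) i = fpsC (f i) * ex ^+ i.
Proof. exact: fps_comp_cX. Qed.

Definition excess_term (pt : {fps rat}) (a : nat) : fps2 :=
  (liftz pt \oF (fpsX * liftx ex)) * loops_double_edges fpsX *
  liftz (pow1 (1 - fpsX) (1 / 2)) *
  pow2 (1 - fpsX * fpsC ex_rest) (- (a%:R + 1 / 2)).

(** The generating function of the positive graphs of excess [k], as a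
    function of [T(z)]. *)
Definition positive_gf (pt : nat -> {fps rat}) (k : nat) : {fps rat} :=
  \sum_(l < k.+1) odd_dfact (k - l) *:
     coefx (2 * (k - l)) (excess_term (pt l) (k - l)).

(** The isolated loops and double edges that [loops_double_edges] removes from
    the graph reappear as patchworks of excess 0. *)
Lemma loops_double_edges_patch0 :
  liftz patch0 * loops_double_edges fpsX = liftz patch0 \oF (fpsX * liftx ex).
Proof.
pose p : {fps rat} := - (onehalf *: fpsX) - 4^-1 *: fpsX ^+ 2.
have p0 : p 0%N = 0.
  by rewrite fps_coefB fps_coefN !fps_coefZ fps_coefX fps_Xn_coef !mulr0 subr0.
have lp0 : liftz p 0%N = 0.
  by rewrite -[LHS]/(fpsC (p 0%N)) p0; exact: (rmorph0 (@fpsC rat)).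
have -> : liftz patch0 = exp2 (liftz p) by rewrite exp2_liftz.
have e2xE : e2x = ex ^+ 2.
  by rewrite exXn /e2x exp_idE fps_scaleE mulrC.
have lpE : liftz p = - (fpsX * fpsC (fpsC onehalf)) - fpsX ^+ 2 * fpsC (fpsC 4^-1).
  rewrite /p !fps_scaleE.
  rewrite liftzB liftzN liftzM liftzC liftzX liftzM liftzC liftzXn liftzX.
  by rewrite mulrC [fpsC (fpsC 4^-1) * _]mulrC.
set q := - (fpsX * liftx (onehalf *: (ex - 1))) - fpsX ^+ 2 * liftx (4^-1 *: (e2x - 1)).
have q0 : q 0%N = 0.
  rewrite fps_coefB fps_coefN fps_coefM0 fps_coefX mul0r fps_mulXn_coef.
  by rewrite oppr0 subr0.
have -> : loops_double_edges fpsX = exp2 q by [].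
have X0 : (fpsX * liftx ex : fps2) 0%N = 0 by exact: fps_cX0.
rewrite -(expsD _ lp0 q0) (exps_comp _ lp0 X0).
suff -> : liftz p + q = liftz p \oF (fpsX * liftx ex) by [].
rewrite lpE.
have XX (c : {fps rat}) : fpsX ^+ 2 * fpsC c \oF (fpsX * liftx ex) = (fpsX * liftx ex) ^+ 2 * fpsC c.
  by rewrite (fps_compM _ _ X0) (fps_compE _ _ X0) (fps_compX X0) fps_compC.
rewrite fps_compB fps_compN XX (fps_compM _ _ X0) fps_compC (fps_compX X0).
rewrite /q e2xE /liftx !fps_scaleE !rmorphM !rmorphB rmorph1 rmorphXn /=.
ring.
Qed.

Section PositiveSeries.
Variables (S H POS NP PPOS NPP : fps2).
Hypothesis SE : forall n m, S n m = 'C('C(n, 2), m)%:R / n`!%:R.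
Hypothesis SH : forall n, S n = \sum_(i < n.+1) H i * kernel i n.
Hypotheses (SP : S = NP * POS) (HP : H = NPP * PPOS).
Hypotheses (sNP : subdiagonal NP) (sNPP : subdiagonal NPP).
Hypotheses (NP1 : NP 0%N 0%N = 1) (NPP1 : NPP 0%N 0%N = 1).
Hypotheses (sPOS : superdiagonal POS) (sPPOS : superdiagonal PPOS).

(** The generating function of the graphs whose components all have excess 0
    is [eps(T(z))]: the inverse square root accounts for the cycles of all
    lengths, and [patch0] removes those of length 1 and 2. *)
Let eps : {fps rat} := pow1 (1 - fpsX) (- (1 / 2)) * patch0.

Let eps0 : eps 0%N = 1.
Proof. by rewrite /eps fps_coefM0 pows_coef0 exps_coef0 mulr1. Qed.

Lemma excess_termE l a : liftz eps * excess_term (of_excess PPOS l) a =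
  (liftz (of_excess H l) \oF (fpsX * liftx ex)) *
    pow2 (1 - fpsX * fpsC ex_rest) (- (a%:R + 1 / 2)).
Proof.
have sq : liftz (pow1 (1 - fpsX) (- (1 / 2))) * liftz (pow1 (1 - fpsX) (1 / 2)) = 1.
  rewrite -liftzM -(powsD idfun _ _ (sub1X0 _)) addNr pows0.
  exact: (rmorph1 (fps_map (@fpsC rat))).
rewrite (patch_of_excess SE SH HP sNPP NPP1 sPPOS) liftzM fps_compM ?fps_cX0 //.
rewrite -loops_double_edges_patch0 /excess_term /eps liftzM.
by rewrite -[RHS]mul1r -[X in _ = X * _]sq; ring.
Qed.

(** The sum over [i] in [gauss_rowE] is the product of two series in [T], the
    part of excess [l] of [H] at [T e^x] and the power
    [(1 - T (e^x - 1 - x) / (x^2 / 2))^{- (k - l) - 1/2}]. *)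
Lemma eps_positive_gf k :
  eps * positive_gf (of_excess PPOS) k = of_excess (Fps (gauss_row H)) k.
Proof.
apply/fpsP => n; rewrite -[RHS]/(gauss_row H n (n + k)%N).
rewrite (gauss_rowE SE SH) /positive_gf mulr_sumr fps_coef_sum.
apply: eq_bigr => l _; rewrite -scalerAr fps_coefZ; congr (_ * _).
rewrite -coefxM_liftz excess_termE coefxE fps_coefM fps_coef_sum.
apply: eq_bigr => i _; rewrite [X in X * _]liftz_comp_ex_coef [X in _ * X]pow2_sub1X_coef.
rewrite -/(neg_half_binom (k - l) (n - i)) mulrACA.
by rewrite -(rmorphM (@fpsC rat)) fps_mulC_coef.
Qed.

Lemma positive_gf0 : positive_gf (of_excess PPOS) 0 = 1.
Proof.
have U : eps \is a GRing.unit by apply: fps_unit1.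
apply: (mulrI U); rewrite eps_positive_gf mulr1; apply/fpsP => n.
rewrite -[LHS]/(gauss_row H n (n + 0)%N) (gauss_rowE SE SH) big_ord1 subnn.
rewrite odd_dfact0 mul1r muln0 /eps mulrC fps_coefM; apply: eq_bigr => i _.
rewrite pow1_sub1X_coef -[of_excess H _ i]/(H i (i + 0)%N) addn0 (patch_diagonal SE SH).
rewrite fps_coefM0 !fps_coefE0 ex_coef0 ex_rest_coef0 !expr1n !mulr1.
by rewrite /neg_half_binom add0r.
Qed.

(** After the substitution, both [NP * POS] and
    [(exp2 (fpsX + gauss_tail) * excess0 eps) * positive_gf] factor the same
    series, with the same supports. *)
Theorem positive_gf_comp k :
  of_excess POS k \oF tree_inv = positive_gf (of_excess PPOS) k.
Proof.
have POSE : POS = by_excess (of_excess POS).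
  by rewrite by_excessK //; apply: superdiagonal_eq0.
have Z0 := graded_tree_inv0.
suff E : POS \oF graded_tree_inv = by_excess (positive_gf (of_excess PPOS)).
  move: E; rewrite POSE by_excess_comp => /(congr1 (fun F => of_excess F k)).
  by rewrite !of_excessK.
have head0 : (fpsX + gauss_tail) 0%N = 0.
  by rewrite fps_coefD gauss_tail0 fps_coefX addr0.
have subhead : subdiagonal (fpsX + gauss_tail).
  move=> n m nm; have m0 : (m == 0%N) = false by case: m nm.
  have X1 j : (fpsX : fps2) j m = 0.
    rewrite fps_coefX; case: (j == 1)%N => //.
    by rewrite -[LHS]/((1 : {fps rat}) m) fps_coef1 m0.
  have tail0 (c : rat) : (fpsX ^+ 2 * fpsC (c *: fpsX) : fps2) n m = 0.
    rewrite fps_mulXn_coef; case: ifP => n2; last by [].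
    rewrite fps_coefC; case: (n - 2)%N (subnKC n2) => [|?] nE; last by [].
    by rewrite fps_coefZ fps_coefX; case: eqP => m1; [lia | rewrite mulr0].
  by rewrite fps_coefD X1 add0r -[LHS]/(- _) tail0 oppr0.
have SZ : S \oF graded_tree_inv =
    exp2 (fpsX + gauss_tail) * excess0 eps * by_excess (positive_gf (of_excess PPOS)).
  have E : excess0 eps * by_excess (positive_gf (of_excess PPOS)) = Fps (gauss_row H).
    rewrite excess0_mul -[RHS]by_excessK; last exact: (gauss_row_low SE SH).
    by congr by_excess; apply/boolp.funext => j; rewrite eps_positive_gf.
  exact: etrans (S_comp SH) (etrans (congr1 (GRing.mul _) (esym E)) (mulrA _ _ _)).
apply: (@factorisation_uniq (NP \oF graded_tree_inv) _
          (exp2 (fpsX + gauss_tail) * excess0 eps)).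
- exact: subdiagonal_comp.
- by apply: subdiagonalM (subdiagonal_excess0 eps); exact: subdiagonal_exp.
- by rewrite fps_comp_coef0.
- rewrite fps_coefM0 [X in X * _]exps_coef0 mul1r excess0_coef expr0 mulr1.
  by rewrite fps_coefC eps0.
- rewrite POSE by_excess_comp; apply: superdiagonal_by_excess.
  rewrite (_ : of_excess POS 0 = 1) ?fps_comp1 //.
  apply/fpsP => n; rewrite /of_excess /= addn0 sPOS // andbb.
  by rewrite -fps_coef1.
- exact: superdiagonal_by_excess positive_gf0.
- by rewrite -SZ SP fps_compM.
Qed.

End PositiveSeries.

(** * The two expressions *)

Lemma pows_comp (R : comNzRingType) (io : {rmorphism rat -> R}) (F g : {fps R}) a :
  F 0%N = 1 -> g 0%N = 0 -> pows io F a \oF g = pows io (F \oF g) a.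
Proof.
move=> F1 g0; rewrite -[pows io F a]/(fps_map io (fps_binom a) \oF (F - 1)).
rewrite fps_compA // ?fps_compB ?fps_comp1 //.
by rewrite fps_coefB F1 subrr.
Qed.

Lemma pow2_liftz (f : {fps rat}) a : f 0%N = 1 -> pow2 (liftz f) a = liftz (pow1 f a).
Proof.
move=> f1; rewrite -pows_idE liftz_comp -powFE /powF liftzB.
by rewrite (_ : liftz 1 = 1) //; exact: (rmorph1 (fps_map (@fpsC rat))).
Qed.

Lemma coefx_comp j (F : fps2) (g : {fps rat}) :
  coefx j (F \oF liftz g) = coefx j F \oF g.
Proof.
apply/fpsP => n; rewrite coefxE fps_coef_sum; apply: eq_bigr => i _.
by rewrite -liftzXn mulrC fps_mulC_coef mulrC.
Qed.

Lemma coefx_mulX k l (F : fps2) : (l <= k)%N ->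
  coefx (2 * k) (liftx (fpsX ^+ (2 * l)) * F) = coefx (2 * (k - l)) F.
Proof.
move=> lk; apply/fpsP => n; rewrite !coefxE fps_mulC_coef2 fps_mulXn_coef.
by rewrite leq_mul2l lk orbT mulnBr.
Qed.

Lemma half_odd_double a : (a%:R + 1 / 2) *+ 2 = (2 * a).+1%:R :> rat.
Proof. by rewrite -[LHS]mulr_natr -[((2 * a).+1)%N]addn1 natrD natrM; field. Qed.

Lemma pow2_half_sqrV (F : fps2) a : F 0%N = 1 ->
  pow2 F (a%:R + 1 / 2) ^+ 2 = F ^+ (2 * a).+1.
Proof.
by move=> F1; rewrite (pows_sqr _ _ F1) half_odd_double (pows_nat _ _ F1).
Qed.

Lemma pow2_half_sqr (F : fps2) a : F 0%N = 1 ->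
  pow2 F (- (a%:R + 1 / 2)) ^+ 2 = (F ^+ (2 * a).+1)^-1.
Proof.
move=> F1; rewrite (pows_sqr _ _ F1) mulNrn (powsN _ _ F1) half_odd_double.
by rewrite (pows_nat _ _ F1).
Qed.

(** The series [(e^x - 1 - x - x^2 / 2) / (x^2 / 2)]. *)
Definition ex_rest' : {fps rat} :=
  2 *: fps_divXn 2 (ex - 1 - fpsX - 2^-1 *: fpsX ^+ 2).

Lemma ex_rest'E : ex_rest' = ex_rest - 1.
Proof.
apply/fpsP => n; rewrite fps_coefB.
have -> : ex_rest n = 2 * (ex - 1 - fpsX) (n + 2)%N by [].
have -> : ex_rest' n = 2 * ((ex - 1 - fpsX) (n + 2)%N - 2^-1 * (fpsX ^+ 2) (n + 2)%N) by [].
rewrite fps_Xn_coef fps_coef1 mulrBr mulrA divff // mul1r.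
by rewrite addn2.
Qed.

Definition skeleton_base : fps2 := 1 - fpsX / (1 - fpsX) * liftx ex_rest'.

Lemma skeleton_base0 : skeleton_base 0%N = 1.
Proof. by rewrite /skeleton_base fps_coefB !fps_coefM0 fps_coefX !mul0r subr0. Qed.

Lemma skeleton_baseE : (1 - fpsX) * skeleton_base = 1 - fpsX * fpsC ex_rest.
Proof.
have U : (1 - fpsX : fps2) \is a GRing.unit by apply: fps_unit1; exact: sub1X0.
rewrite /skeleton_base mulrBr mulr1 mulrA mulrCA divrr // mulr1 ex_rest'E.
by rewrite /liftx rmorphB rmorph1 /=; ring.
Qed.

(** Both sides have constant coefficient 1, and their squares are equal by
    [skeleton_baseE]. *)
Lemma skeleton_power a : liftz (pow1 (1 - fpsX) (1 / 2)) *
    pow2 (1 - fpsX * fpsC ex_rest) (- (a%:R + 1 / 2)) =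
  ((1 - fpsX) ^+ a * pow2 skeleton_base (a%:R + 1 / 2))^-1.
Proof.
have c1 := sub1X_coef0 ex_rest.
have U : (1 - fpsX) ^+ a * pow2 skeleton_base (a%:R + 1 / 2) \is a GRing.unit.
  by apply: fps_unit1; rewrite fps_coefM0 pows_coef0 mulr1 fps_coefE0 sub1X0 expr1n.
rewrite -pow2_liftz // liftzB liftzX (_ : liftz 1 = 1); last first.
  exact: (rmorph1 (fps_map (@fpsC rat))).
set Y := pow2 skeleton_base _ in U *; set Z := pow2 _ (- _); set W := pow2 _ _.
have Y2 : Y ^+ 2 = skeleton_base ^+ (2 * a).+1 by exact: pow2_half_sqrV skeleton_base0.
have Z2 : Z ^+ 2 = ((1 - fpsX * fpsC ex_rest) ^+ (2 * a).+1)^-1 by exact: pow2_half_sqr.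
have W2 : W ^+ 2 = 1 - fpsX.
  have half2 : 1 / 2 *+ 2 = 1 :> rat by rewrite -[LHS]mulr_natr; field.
  by rewrite /W (pows_sqr _ _ (sub1X0 _)) half2 (pows1 _ (sub1X0 _)).
have Y0 : Y 0%N = 1 by exact: pows_coef0.
have Z0 : Z 0%N = 1 by exact: pows_coef0.
have W0 : W 0%N = 1 by exact: pows_coef0.
clearbody Y Z W.
apply: (mulrI U); rewrite [RHS]divrr //.
apply: (fps_sqr_inj (@fpsC rat)); rewrite ?fps_coef1 //.
  by rewrite !fps_coefM0 Y0 Z0 W0 fps_coefE0 sub1X0 expr1n !mulr1.
rewrite expr1n !exprMn -exprM Y2 Z2 W2 -skeleton_baseE [(a * 2)%N]mulnC.
have Ub : (1 - fpsX) * skeleton_base \is a GRing.unit.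
  by apply: fps_unit1; rewrite fps_coefM0 skeleton_base0 sub1X0 mulr1.
have E : (1 - fpsX) ^+ (2 * a) * skeleton_base ^+ (2 * a).+1 * (1 - fpsX) =
   ((1 - fpsX) * skeleton_base) ^+ (2 * a).+1 by rewrite exprMn !exprS; ring.
move: (1 - fpsX) skeleton_base Ub E => u v Ub E.
rewrite mulrA E divrr; [exact: erefl | exact: unitrX].
Qed.

Lemma SKserE k : SKser k = (1 - fpsX) ^+ (3 * k) * positive_gf PatchposN1 k.
Proof.
rewrite /SKser /positive_gf; congr (_ * _); apply: eq_bigr => l _.
congr (_ *: coefx _ _).
rewrite powFE -/ex_rest' -/skeleton_base /excess_term -!mulrA; congr (_ * (_ * _)).
by rewrite skeleton_power.
Qed.

Lemma liftz_treegf0 : liftz treegf 0%N = 0.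
Proof. exact: (rmorph0 (@fpsC rat)). Qed.

(** Both sides are half-integral powers of one series, with constant coefficient
    1, so it is enough to compare their squares. *)
Lemma Bser_power k l : (l <= k)%N -> powF Bser (- l%:R + 1 / 2) * Bser ^+ k =
  pow2 (1 - liftz treegf * liftx ex_rest) (- ((k - l)%:R + 1 / 2)).
Proof.
move=> lk; rewrite powFE /Bser -/ex_rest.
have : (1 - liftz treegf * liftx ex_rest) 0%N = 1.
  by rewrite fps_coefB fps_coefM0 liftz_treegf0 mul0r subr0.
move: (1 - _) => F F1.
have UF : F \is a GRing.unit by exact: fps_unit1.
have V1 : F^-1 0%N = 1 by exact: fps_inv_coef0.
apply: (fps_sqr_inj (@fpsC rat)); [|exact: pows_coef0|].
  by rewrite fps_coefM0 pows_coef0 fps_coefE0 V1 expr1n mulr1.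
rewrite pow2_half_sqr // exprMn (pows_sqr _ _ V1) -exprM.
have -> : (- l%:R + 1 / 2) *+ 2 = - (2 * l)%:R + 1 :> rat.
  by rewrite -[LHS]mulr_natr natrM; field.
rewrite (powsD _ _ _ V1) (powsN _ _ V1) (pows_nat _ _ V1) (pows1 _ V1).
rewrite -!exprVn invrK -[RHS]mulr1 -[in RHS](expr1n _ (2 * l)) -(divrr UF) exprMn.
rewrite (_ : (k * 2 = (2 * (k - l)) + 2 * l)%N); last by lia.
by rewrite exprS exprD; ring.
Qed.

Lemma fps_compM4 (R : comNzRingType) (a b c d g : {fps R}) : g 0%N = 0 ->
  (a * b * c * d) \oF g = (a \oF g) * (b \oF g) * (c \oF g) * (d \oF g).
Proof. by move=> g0; rewrite !fps_compM. Qed.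

Lemma loops_double_edges_comp (F : fps2) : F 0%N = 0 ->
  loops_double_edges fpsX \oF F = loops_double_edges F.
Proof.
move=> F0; rewrite /loops_double_edges !expFE.
move: (2^-1 *: _) (4^-1 *: _) => a b.
have q0 : (- (fpsX * liftx a) - fpsX ^+ 2 * liftx b : fps2) 0%N = 0.
  by rewrite fps_coefB fps_coefN fps_coefM0 fps_coefX mul0r fps_mulXn_coef oppr0 subr0.
rewrite (exps_comp _ q0 F0).
by rewrite fps_compB fps_compN !(fps_compM _ _ F0) !fps_compC (fps_compX F0).
Qed.

Lemma pows_compE (R : comNzRingType) (io : {rmorphism rat -> R}) (F g G : {fps R}) a :
  F 0%N = 1 -> g 0%N = 0 -> F \oF g = G -> pows io F a \oF g = pows io G a.
Proof. by move=> F1 g0 <-; exact: pows_comp. Qed.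

Lemma excess_term_comp k l :
  excess_term (PatchposN1 l) (k - l) \oF liftz treegf =
  Patch_at l (liftz treegf) * loops_double_edges (liftz treegf) *
    powF (1 - liftz treegf) (1 / 2) *
    pow2 (1 - liftz treegf * liftx ex_rest) (- ((k - l)%:R + 1 / 2)).
Proof.
have T0 := liftz_treegf0.
have E1 : (liftz (PatchposN1 l) \oF (fpsX * liftx ex)) \oF liftz treegf =
    Patch_at l (liftz treegf).
  rewrite (fps_compA _ (fps_cX0 _) T0) /Patch_at.
  by rewrite (fps_compM _ _ T0) (fps_compX T0) fps_compC.
have E3 : liftz (pow1 (1 - fpsX) (1 / 2)) \oF liftz treegf = powF (1 - liftz treegf) (1 / 2).
  rewrite -(pow2_liftz _ (sub1X0 _)) powFE liftzB liftzX.
  rewrite (_ : liftz 1 = 1); last exact: (rmorph1 (fps_map (@fpsC rat))).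
  have X1 : (1 - fpsX) \oF liftz treegf = 1 - liftz treegf.
    by rewrite fps_compB fps_comp1 (fps_compX T0).
  exact: (pows_compE (@fpsC rat) _ (sub1X0 _) T0 X1).
have E4 : pow2 (1 - fpsX * fpsC ex_rest) (- ((k - l)%:R + 1 / 2)) \oF liftz treegf =
    pow2 (1 - liftz treegf * liftx ex_rest) (- ((k - l)%:R + 1 / 2)).
  have X1 : (1 - fpsX * fpsC ex_rest) \oF liftz treegf = 1 - liftz treegf * liftx ex_rest.
    by rewrite fps_compB fps_comp1 (fps_compM _ _ T0) fps_compC (fps_compX T0).
  exact: (pows_compE (@fpsC rat) _ (sub1X_coef0 _) T0 X1).
apply: etrans (fps_compM4 _ _ _ _ T0) _.
apply: (f_equal2 *%R _ E4); apply: (f_equal2 *%R _ E3).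
exact: (f_equal2 *%R E1 (loops_double_edges_comp T0)).
Qed.

Lemma Cser_positive_gf k :
  \sum_(l < k.+1) odd_dfact (k - l) *: coefx (2 * k) (Cser l * Bser ^+ k) =
  positive_gf PatchposN1 k \oF treegf.
Proof.
rewrite /positive_gf fps_comp_sum; apply: eq_bigr => l _.
have lk : (l <= k)%N by rewrite -ltnS.
have shuffle (x a p d q r : fps2) : x * a * p * d * q * r = x * (a * d * p * (q * r)).
  by ring.
rewrite fps_compZ -coefx_comp excess_term_comp.
apply: congr1; apply: etrans (congr1 (coefx _) (shuffle _ _ _ _ _ _)) _.
apply: etrans (coefx_mulX _ lk) _.
exact: congr1 (congr1 (GRing.mul _) (Bser_power lk)).
Qed.

(** * Polynomiality *)

Definition is_poly (f : {fps rat}) := exists p : {poly rat}, fps_of_poly p = f.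

Lemma is_polyC c : is_poly (fpsC c).
Proof. by exists c%:P; rewrite fps_of_polyC. Qed.
Lemma is_polyX : is_poly fpsX.
Proof. by exists 'X; rewrite fps_of_polyX. Qed.
Lemma is_polyD f g : is_poly f -> is_poly g -> is_poly (f + g).
Proof. by move=> [p <-] [q <-]; exists (p + q); rewrite fps_of_polyD. Qed.
Lemma is_polyM f g : is_poly f -> is_poly g -> is_poly (f * g).
Proof. by move=> [p <-] [q <-]; exists (p * q); rewrite fps_of_polyM. Qed.
Lemma is_polyZ c f : is_poly f -> is_poly (c *: f).
Proof. by move=> pf; rewrite fps_scaleE; apply: is_polyM => //; exact: is_polyC. Qed.
Lemma is_polyN f : is_poly f -> is_poly (- f).
Proof. by rewrite -scaleN1r; exact: is_polyZ. Qed.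
Lemma is_polyXn f k : is_poly f -> is_poly (f ^+ k).
Proof.
move=> pf; elim: k => [|k IH]; first exact: is_polyC.
by rewrite exprS; exact: is_polyM.
Qed.
Lemma is_poly_sum (I : finType) (F : I -> {fps rat}) :
  (forall i, is_poly (F i)) -> is_poly (\sum_i F i).
Proof.
move=> pF; apply: big_ind => //; last exact: is_polyD.
by rewrite -(rmorph0 (@fpsC rat)); exact: is_polyC.
Qed.
Lemma is_poly_bound N (f : {fps rat}) : (forall n, (N <= n)%N -> f n = 0) -> is_poly f.
Proof.
move=> f0; exists (fps_trunc N f); apply/fpsP => n; rewrite /= coef_poly.
by case: ltnP => // /f0.
Qed.
Lemma is_poly1X : is_poly (1 - fpsX).
Proof. exact: is_polyD (is_polyC 1) (is_polyN is_polyX). Qed.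

(** The coefficient of [x^j] is a polynomial in [T] up to a denominator
    [(1 - T)^j]. *)
Definition xpoly (F : fps2) := forall j, is_poly ((1 - fpsX) ^+ j * coefx j F).

Lemma coefxM j (F G : fps2) :
  coefx j (F * G) = \sum_(i < j.+1) coefx i F * coefx (j - i) G.
Proof.
apply/fpsP => n; rewrite coefxE fps_coefM2 exchange_big fps_coef_sum.
exact: eq_bigr.
Qed.

(** The denominators [(1 - T)^i] and [(1 - T)^{j - i}] multiply to
    [(1 - T)^j]. *)
Lemma xpolyM F G : xpoly F -> xpoly G -> xpoly (F * G).
Proof.
move=> pF pG j; rewrite coefxM mulr_sumr; apply: is_poly_sum => i.
have -> : (1 - fpsX : {fps rat}) ^+ j = (1 - fpsX) ^+ i * (1 - fpsX) ^+ (j - i).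
  by rewrite -exprD subnKC // -ltnS.
by rewrite mulrACA; exact: is_polyM.
Qed.

Lemma xpoly_coefx F : (forall j, is_poly (coefx j F)) -> xpoly F.
Proof. by move=> pF j; apply: is_polyM => //; apply: is_polyXn is_poly1X. Qed.

Lemma xpolyXn F k : xpoly F -> xpoly (F ^+ k).
Proof.
move=> pF; elim: k => [|k IH]; last by rewrite exprS; exact: xpolyM.
apply: xpoly_coefx => j; apply: (@is_poly_bound 1) => n n0.
by rewrite coefxE expr0 fps_coef1; case: n n0.
Qed.

(** Only the first [j + 1] powers of [F] contribute to the coefficient of
    [x^j] in a series in [F]. *)
Lemma xpoly_comp f (F : fps2) : F 0%N = 0 -> (forall n, F n 0%N = 0) -> xpoly F ->
  xpoly (liftz f \oF F).
Proof.
move=> F0 Fx0 pF j.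
have low i n : (j < i)%N -> (F ^+ i) n j = 0.
  elim: i j n => // i IH j' n; rewrite ltnS => ji.
  rewrite exprS fps_coefM2 big1 // => a _; rewrite big1 // => b _.
  case: b => -[|b] /= bj; first by rewrite Fx0 mul0r.
  by rewrite IH ?mulr0 //; lia.
have -> : coefx j (liftz f \oF F) = \sum_(i < j.+1) f i *: coefx j (F ^+ i).
  apply/fpsP => n; rewrite coefxE fps_coef_sum fps_coef_sum.
  pose u i := f i * (F ^+ i) n j.
  transitivity (\sum_(i < n.+1) u i); first by apply: eq_bigr => i _; rewrite fps_mulC_coef.
  transitivity (\sum_(i < j.+1) u i); last by apply: eq_bigr.
  rewrite (sum_ord_widen (F := u) (leq_maxl n.+1 j.+1)); last first.
    by move=> i /andP[ni _]; rewrite /u fps_expr_low ?mulr0.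
  rewrite -(sum_ord_widen (F := u) (leq_maxr n.+1 j.+1)) //.
  by move=> i /andP[ji _]; rewrite /u low ?mulr0.
rewrite mulr_sumr; apply: is_poly_sum => i; rewrite -scalerAr.
by apply: is_polyZ; apply: xpolyXn.
Qed.

Lemma coefxB j (F G : fps2) : coefx j (F - G) = coefx j F - coefx j G.
Proof. by apply/fpsP. Qed.
Lemma coefxN j (F : fps2) : coefx j (- F) = - coefx j F.
Proof. by apply/fpsP. Qed.
Lemma xpoly_Xn_liftx d c : xpoly (fpsX ^+ d * liftx c).
Proof.
apply: xpoly_coefx => j; apply: (@is_poly_bound d.+1) => n dn.
rewrite coefxE fps_mulXn_coef (ltnW dn) fps_coefC.
by case: (n - d)%N (subn_gt0 d n) => //; rewrite dn ltnn.
Qed.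

Lemma xpolyN F : xpoly F -> xpoly (- F).
Proof. by move=> pF j; rewrite coefxN mulrN; exact: is_polyN. Qed.
Lemma xpolyB F G : xpoly F -> xpoly G -> xpoly (F - G).
Proof. by move=> pF pG j; rewrite coefxB mulrBr; apply: is_polyD => //; exact: is_polyN. Qed.

Lemma Xn_liftx_x0 d (c : {fps rat}) n : c 0%N = 0 ->
  (fpsX ^+ d * liftx c : fps2) n 0%N = 0.
Proof.
move=> c0; rewrite fps_mulXn_coef; case: ifP => // _; rewrite fps_coefC.
by case: (n - d)%N.
Qed.

Lemma xpoly_loops : xpoly (loops_double_edges fpsX).
Proof.
rewrite /loops_double_edges; set a := 2^-1 *: _; set b := 4^-1 *: _.
have a0 : a 0%N = 0 by rewrite /a fps_coefZ fps_coefB ex_coef0 subrr mulr0.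
have b0 : b 0%N = 0.
  have e0 : e2x 0%N = 1 by exact: fps_comp_coef0.
  by rewrite /b fps_coefZ fps_coefB e0 subrr mulr0.
move: a b a0 b0 => a b a0 b0.
apply: xpoly_comp.
- by rewrite fps_coefB fps_coefN fps_coefM0 fps_coefX mul0r fps_mulXn_coef oppr0 subr0.
- move=> n; rewrite -[LHS]/(- (fpsX ^+ 1 * liftx a : fps2) n 0%N - (fpsX ^+ 2 * liftx b : fps2) n 0%N).
  by rewrite (Xn_liftx_x0 1 n a0) (Xn_liftx_x0 2 n b0) oppr0 subr0.
- apply: xpolyB (xpoly_Xn_liftx 2 b); apply: xpolyN; exact: (xpoly_Xn_liftx 1 a).
Qed.

Lemma xpoly_Patch_at l : is_poly (PatchposN1 l) -> xpoly (Patch_at l fpsX).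
Proof.
move=> [p pE]; apply: xpoly_coefx => j; apply: (@is_poly_bound (size p)) => n np.
rewrite coefxE /Patch_at liftz_comp_ex_coef -pE fps_mulC_coef /=.
by rewrite nth_default // mul0r.
Qed.

Lemma liftz1X_inv a : liftz ((1 - fpsX) ^- a) = ((1 - fpsX) ^+ a)^-1.
Proof.
have U : (1 - fpsX : {fps rat}) ^+ a \is a GRing.unit.
  by apply: unitrX; apply: fps_unit1; exact: sub1X0.
have E : liftz (1 - fpsX) = 1 - fpsX.
  by rewrite liftzB liftzX; congr (_ - _); exact: (rmorph1 (fps_map (@fpsC rat))).
by rewrite -E -liftzXn; exact: (rmorphV (fps_map (@fpsC rat)) U).
Qed.

(** The base is 1 minus [T / (1 - T)] times a series in [x] without constant
    term, so that each denominator comes with a factor [x]. *)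
Lemma xpoly_skeleton_base b : xpoly (pow2 skeleton_base b).
Proof.
have c0 : ex_rest' 0%N = 0 by rewrite ex_rest'E fps_coefB ex_rest_coef0 subrr.
have FE : skeleton_base - 1 = - (liftz (fpsX * (1 - fpsX)^-1) * liftx ex_rest').
  rewrite /skeleton_base addrC addKr liftzM liftzX.
  by rewrite (liftz1X_inv 1).
rewrite -powFE; apply: xpoly_comp.
- by rewrite fps_coefB skeleton_base0 subrr.
- move=> n; rewrite FE mulrC fps_coefN fps_mulC_coef2.
  by rewrite -[LHS]/(- ((_ * _ : {fps rat}) 0%N)) fps_coefM0 c0 mul0r oppr0.
move=> j; rewrite FE; apply: xpolyN => {}j.
rewrite coefxM_liftz (_ : coefx j (liftx ex_rest') = fpsC (ex_rest' j)); last first.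
  by apply/fpsP => -[|n].
case: j => [|j]; first by rewrite c0 rmorph0 !mulr0 -(rmorph0 (@fpsC rat)); exact: is_polyC.
have U : (1 - fpsX : {fps rat}) \is a GRing.unit by apply: fps_unit1; exact: sub1X0.
have -> : (1 - fpsX) ^+ j.+1 * (fpsX * (1 - fpsX)^-1 * fpsC (ex_rest' j.+1)) =
    fpsX * (1 - fpsX) ^+ j * fpsC (ex_rest' j.+1).
  move: (fpsC _) U; move: (1 - fpsX) => u c U.
  by rewrite exprS -[RHS]mul1r -(divrr U); ring.
apply: is_polyM; last exact: is_polyC.
apply: is_polyM; [exact: is_polyX | exact: is_polyXn is_poly1X].
Qed.

(** With [a = k - l], the term of index [l] has the explicit denominator
    [(1 - T)^a], and the extraction of [[x^{2 a}]] brings at most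
    [(1 - T)^{2 a}]: the total exponent is [3 a <= 3 k]. *)
Lemma is_poly_SKser k : (forall l, is_poly (PatchposN1 l)) -> is_poly (SKser k).
Proof.
move=> pP; rewrite SKserE /positive_gf mulr_sumr; apply: is_poly_sum => l.
have lk : (l <= k)%N by rewrite -ltnS.
rewrite -scalerAr; apply: is_polyZ; set a := (k - l)%N.
pose G := Patch_at l fpsX * loops_double_edges fpsX * pow2 skeleton_base (- (a%:R + 1 / 2)).
have pG : xpoly G.
  apply: xpolyM; last exact: xpoly_skeleton_base.
  by apply: xpolyM; [exact: xpoly_Patch_at | exact: xpoly_loops].
have U : ((1 - fpsX) ^+ a : {fps rat}) \is a GRing.unit.
  by apply: unitrX; apply: fps_unit1; exact: sub1X0.
have U2 : ((1 - fpsX) ^+ a : fps2) \is a GRing.unit.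
  by apply: unitrX; apply: fps_unit1; exact: sub1X0.
have V : pow2 skeleton_base (a%:R + 1 / 2) \is a GRing.unit.
  by apply: fps_unit1; exact: pows_coef0.
have -> : excess_term (PatchposN1 l) a = liftz ((1 - fpsX) ^- a) * G.
  rewrite /excess_term -/(Patch_at l fpsX) -mulrA skeleton_power invrM // liftz1X_inv /G.
  rewrite (powsN _ _ skeleton_base0).
  move: (Patch_at _ _) (loops_double_edges _) (pow2 _ _)^-1 (_ ^- a) => p q r s.
  by ring.
rewrite coefxM_liftz.
have -> : (1 - fpsX : {fps rat}) ^+ (3 * k) =
    (1 - fpsX) ^+ (3 * l) * (1 - fpsX) ^+ (2 * a) * (1 - fpsX) ^+ a.
  by rewrite -!exprD /a; congr (_ ^+ _); lia.
rewrite mulrA mulrK // -mulrA; apply: is_polyM; last exact: pG.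
exact: is_polyXn is_poly1X.
Qed.

(** * The generating functions of graphs and patchworks *)

Definition normalise (n m : nat) : rat := ((2 ^ m * m`!)%:R * n`!%:R)^-1.

Definition mg_gf (a : nat -> nat -> rat) : fps2 :=
  Fps (fun n => Fps (fun m => a n m * normalise n m)).

Lemma mg_gfE a n m : mg_gf a n m = a n m * normalise n m. Proof. by []. Qed.

Lemma normaliseE n m i j : (i <= n)%N -> (j <= m)%N ->
  'C(n, i)%:R * 'C(m, j)%:R * normalise n m =
  normalise i j * normalise (n - i) (m - j).
Proof.
move=> ni mj; rewrite /normalise !natrM !invfM.
have := binom_fact ni; have := binom_fact mj.
have -> : (2 ^ m)%:R^-1 = (2 ^ j)%:R^-1 * (2 ^ (m - j))%:R^-1 :> rat.
  by rewrite -invfM -natrM -expnD subnKC.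
move=> E1 E2.
transitivity ((2 ^ j)%:R^-1 * (2 ^ (m - j))%:R^-1 * ('C(m, j)%:R / m`!%:R) * ('C(n, i)%:R / n`!%:R) : rat).
  by ring.
by rewrite E1 E2; ring.
Qed.

Lemma sum_set2_card n m (G : nat -> nat -> rat) :
  \sum_(S : {set 'I_n}) \sum_(A : {set 'I_m}) G #|S| #|A| =
  \sum_(i < n.+1) \sum_(j < m.+1) 'C(n, i)%:R * 'C(m, j)%:R * G i j.
Proof.
rewrite (sum_set_card n (fun i => \sum_(A : {set 'I_m}) G i #|A|)).
apply: eq_bigr => i _; rewrite (sum_set_card m (G i)) -[LHS]mulr_natl mulr_sumr.
by apply: eq_bigr => j _; rewrite -[G i j *+ _]mulr_natl mulrA.
Qed.

Lemma cardsC_sub k (S : {set 'I_k}) : #|~: S| = (k - #|S|)%N.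
Proof. by rewrite cardsCs setCK card_ord. Qed.

(** The product of series that are exponential both in the vertices and in the
    edges. *)
Lemma mg_gf_split a b c : (forall n m, a n m =
    \sum_(S : {set 'I_n}) \sum_(A : {set 'I_m}) b #|S| #|A| * c #|~: S| #|~: A|) ->
  mg_gf a = mg_gf b * mg_gf c.
Proof.
move=> aE; apply/fpsP => n; apply/fpsP => m; rewrite fps_coefM2 mg_gfE aE.
under eq_bigr => S _ do under eq_bigr => A _ do rewrite !cardsC_sub.
rewrite (sum_set2_card _ _ (fun i j => b i j * c (n - i)%N (m - j)%N)) mulr_suml.
apply: eq_bigr => i _; rewrite mulr_suml; apply: eq_bigr => j _.
have [ni mj] : (i <= n)%N /\ (j <= m)%N by split; rewrite -ltnS.
by rewrite !mg_gfE mulrAC (normaliseE ni mj); ring.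
Qed.

Notation total om := (fun n m => \sum_(M : emap n m) om n m M).

Definition SGF : fps2 := mg_gf (total simple_wt).
Definition HGF : fps2 := mg_gf (total patch_wt).

Lemma norm_fact n m : (2 ^ m * m`!)%:R * normalise n m = (n`!%:R)^-1.
Proof.
rewrite /normalise invfM mulrA divff ?mul1r // pnatr_eq0 muln_eq0 expn_eq0.
by rewrite -(negbK (m`! == 0%N)) -lt0n fact_gt0.
Qed.

Lemma SGFE n m : SGF n m = 'C('C(n, 2), m)%:R / n`!%:R.
Proof. by rewrite mg_gfE simple_sum mulrAC norm_fact mulrC. Qed.

(** The coefficient [n^{2 j} / (2^j j!)] of [e^{w n^2 / 2}] counts the choices of
    the [j] edges outside the patchwork. *)
Lemma SGF_kernel n : SGF n = \sum_(i < n.+1) HGF i * kernel i n.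
Proof.
apply/fpsP => m; rewrite mg_gfE simple_patch fps_coef_sum.
pose pw i j : rat := \sum_(M : emap i j) patch_wt M.
under eq_bigr => S _ do under eq_bigr => A _ do rewrite cardsC_sub.
rewrite (sum_set2_card _ _ (fun i j => pw i j * ((n ^ 2) ^ (m - j))%:R)) mulr_suml.
apply: eq_bigr => i _; rewrite mulr_suml fps_coefM; apply: eq_bigr => j _.
have [ni mj] : (i <= n)%N /\ (j <= m)%N by split; rewrite -ltnS.
rewrite kernelE ni fps_mulC_coef /gauss_exp exps_cX mg_gfE mulrAC normaliseE //.
have -> : (onehalf * n%:R ^+ 2) ^+ (m - j) = (2%:R ^+ (m - j))^-1 * (n%:R ^+ 2) ^+ (m - j).
  by rewrite exprMn exprVn.
have -> : normalise (n - i) (m - j) =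
    (2%:R ^+ (m - j))^-1 * ((m - j)`!%:R)^-1 * ((n - i)`!%:R)^-1.
  by rewrite /normalise natrM !invfM natrX.
by rewrite !natrX -/(pw i j) /=; ring.
Qed.

Lemma sum_emap00 (Q : pred (emap 0 0)) (F : emap 0 0 -> rat) :
  (forall M, Q M) -> (forall M, F M = 1) -> \sum_(M | Q M) F M = 1.
Proof.
move=> QT F1; pose M0 : emap 0 0 := [ffun e : 'I_0 => match notF (ltn_ord e) with end].
rewrite (big_pred1 M0) // => M; rewrite QT; apply/esym/eqP/ffunP.
by case.
Qed.

Lemma ends00_pieces (M : emap 0 0) : pieces (ends M) = set0.
Proof.
apply/setP => B; rewrite mem_pieces in_set0; apply: contraTF isT.
by case/pieceP => -[].
Qed.

Lemma simple_wt00 (M : emap 0 0) : simple_wt M = 1.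
Proof. by rewrite /simple_wt ends00_pieces eqxx. Qed.

Lemma patch_wt00 (M : emap 0 0) : patch_wt M = 1.
Proof.
rewrite /patch_wt (big_pred1 set0) ?cards0 // => P.
rewrite ends00_pieces subset0 /=; case: eqP => [-> /=|//].
apply/andP; split; first by apply/eqP/setP => -[].
by apply/spanningP => -[].
Qed.

Section Supports.
Variable om : forall n m, emap n m -> rat.
Hypothesis om00 : forall M : emap 0 0, om M = 1.

Lemma neg_subdiagonal : subdiagonal (mg_gf (neg_sum om)).
Proof.
move=> n m nm; rewrite mg_gfE /neg_sum big1 ?mul0r // => M /none_pos_excess.
by rewrite leqNgt nm.
Qed.

Lemma normalise00 : normalise 0 0 = 1.
Proof. by rewrite /normalise !mul1n mulr1 invr1. Qed.

Lemma neg_coef0 : mg_gf (neg_sum om) 0%N 0%N = 1.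
Proof.
rewrite mg_gfE normalise00 mulr1; apply: sum_emap00 => // M.
by apply/forallP => -[].
Qed.

Lemma pos_superdiagonal : superdiagonal (mg_gf (pos_sum om)).
Proof.
move=> n m mn; rewrite mg_gfE; case: n mn => [|n] mn.
  have -> : m = 0%N by case: m mn.
  rewrite normalise00 mulr1; apply: sum_emap00 => // M; by apply/forallP => -[].
rewrite /pos_sum big1 ?mul0r // => M /all_pos_excess/(_ isT).
by rewrite ltnNge mn.
Qed.

End Supports.

Lemma SGF_split : SGF = mg_gf (neg_sum simple_wt) * mg_gf (pos_sum simple_wt).
Proof.
by rewrite mulrC; apply: mg_gf_split => n m; apply: split_sum; exact: simple_wt_paste.
Qed.

Lemma HGF_split : HGF = mg_gf (neg_sum patch_wt) * mg_gf (pos_sum patch_wt).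
Proof.
by rewrite mulrC; apply: mg_gf_split => n m; apply: split_sum; exact: patch_wt_paste.
Qed.

Lemma SGpos_of_excess k : SGpos k = of_excess (mg_gf (pos_sum simple_wt)) k.
Proof.
apply/fpsP => n; rewrite -[RHS]/(mg_gf _ n (n + k)%N) mg_gfE /pos_sum simple_pos_sum.
rewrite mulrAC norm_fact mulrC /=; congr (_%:R / _); apply: eq_card => G; rewrite !inE.
do 2!congr (_ && _); rewrite /excess; apply/eqP/eqP; lia.
Qed.

Lemma PatchposN1_of_excess l : PatchposN1 l = of_excess (mg_gf (pos_sum patch_wt)) l.
Proof.
apply/fpsP => n; rewrite -[RHS]/(mg_gf _ n (n + l)%N) mg_gfE /pos_sum /patch_wt /=.
rewrite -(sum_patchworks n (n + l) (fun k => (-1) ^+ k : rat)) mulr_suml.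
rewrite -horner_evalE raddf_sum; apply: eq_bigr => P _.
by rewrite /= horner_evalE hornerZ hornerXn mulrC.
Qed.

Lemma Patchpos_bound l n : (8 * l < n)%N -> Patchpos l n = 0.
Proof.
move=> ln; rewrite /= (sum_patchworks n (n + l) (fun k => normalise n (n + l) *: 'X^k : {poly rat})).
apply: big1 => M pM; apply: big1 => P /andP[PM Pf].
by have := patch_bound PM Pf pM erefl; rewrite leqNgt ln.
Qed.

Theorem proposition6 (k : nat) :
  [/\ forall l : nat, exists p : {poly {poly rat}}, fps_of_poly p = Patchpos l,
      exists2 SK : {poly rat},
        fps_of_poly SK = SKser k
        & SGpos k = (map_poly fpsC SK).[treegf] / (1 - treegf) ^+ (3 * k)
    & SGpos k = \sum_(l < k.+1)
        odd_dfact (k - l) *: coefx (2 * k) (Cser l * Bser ^+ k)].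
Proof.
have patch_poly l : is_poly (PatchposN1 l).
  apply: (@is_poly_bound (8 * l).+1) => n ln.
  by rewrite -[LHS]/((Patchpos l n).[-1]) Patchpos_bound ?horner0.
have patchE : PatchposN1 = of_excess (mg_gf (pos_sum patch_wt)).
  by apply/boolp.funext => l; exact: PatchposN1_of_excess.
have SGE : SGpos k = positive_gf PatchposN1 k \oF treegf.
  rewrite -[LHS]fps_comp_idr -tree_inv_treegf -(fps_compA _ tree_inv0 treegf0).
  congr (_ \oF _); rewrite SGpos_of_excess patchE.
  apply: (positive_gf_comp SGFE SGF_kernel SGF_split HGF_split).
  - exact: neg_subdiagonal.
  - exact: neg_subdiagonal.
  - exact: neg_coef0 simple_wt00.
  - exact: neg_coef0 patch_wt00.
  - exact: pos_superdiagonal simple_wt00.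
  - exact: pos_superdiagonal patch_wt00.
split.
- move=> l; exists (fps_trunc (8 * l).+1 (Patchpos l)); apply/fpsP => n.
  rewrite -[LHS]/((fps_trunc (8 * l).+1 (Patchpos l))`_n) coef_poly.
  by case: ltnP => // ln; rewrite Patchpos_bound.
- have [SK SKE] := is_poly_SKser k patch_poly; exists SK => //.
  rewrite -(fps_comp_poly _ treegf0) SKE SKserE (fps_compM _ _ treegf0).
  rewrite (fps_compE _ _ treegf0) fps_compB fps_comp1 (fps_compX treegf0) -SGE.
  rewrite [X in _ = X / _]mulrC mulrK //; apply: unitrX; apply: fps_unit1.
  by rewrite fps_coefB treegf0 subr0.
by rewrite Cser_positive_gf.
Qed.
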